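(* Let $a_n,b_n>0$ with $a_n,b_n\to\infty$ as $n\to\infty$, and let $s_n\in\mathbb{N}$ satisfy $s_n=a_nb_n+\beta\sqrt{a_nb_n(b_n+1)}$ for some fixed $\beta>0$. Put $\rho_n=a_nb_n/s_n$ and let $\beta_n>0$ be given by $$\beta_n^2=s_n\Bigl(\frac{1-\rho_n}{b_n+1}\Bigr)^2\Bigl(1+\frac{b_n}{\rho_n}\Bigr).$$ Let $Q_n$ be the stationary queue length with Gamma–Poisson arrivals with parameters $a_n,b_n$ and capacity $s_n$. Then, as $n\to\infty$, the leading order behavior of $\mathbb{E}Q_n$ is given by $$\mathbb{E}Q_n=\frac{\sqrt2\,\beta_n}{\pi}\Bigl(\frac{b_n+\rho_n}{1-\rho_n}\Bigr)\int_0^\infty\frac{t^2}{\tfrac12\beta_n^2+t^2}\,\frac{\exp(-\tfrac12\beta_n^2-t^2)}{1-\exp(-\tfrac12\beta_n^2-t^2)}\,dt\;(1+o(1)).$$ Furthermore, the leading order behavior (i.e. up to a factor $1+o(1)$) of $\mathbb{P}(Q_n=0)$ is given by $$\exp\Bigl[\frac1\pi\,\frac{b_n+\rho_n}{b_n+1}\int_0^\infty\frac{\beta_n/\sqrt2}{\tfrac12\beta_n^2+t^2}\,\ln\Bigl(1-e^{-\frac12\beta_n^2-t^2}\Bigr)dt\Bigr],$$ and that of $\mathrm{Var}\,Q_n$ is given by $$\frac{\beta_n^3/\sqrt2}{\pi}\Bigl(\frac{b_n+\rho_n}{1-\rho_n}\Bigr)^2\Bigl(\frac{b_n+1}{b_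n+\rho_n}+1\Bigr)\int_0^\infty\frac{t^2}{(\tfrac12\beta_n^2+t^2)^2}\,\frac{\exp(-\tfrac12\beta_n^2-t^2)}{1-\exp(-\tfrac12\beta_n^2-t^2)}\,dt.$$
   Context: Gamma–Poisson arrivals with parameters $a_n,b_n$: $\Lambda_n$ is Gamma distributed with shape $a_n$ and rate $1/b_n$ (mean $a_nb_n$), and conditionally on $\Lambda_n$ the random variable $A_n$ is Poisson with mean $\Lambda_n$; equivalently, $A_n$ has probability generating function $\mathbb{E}[z^{A_n}]=(1+b_n(1-z))^{-a_n}$. Then $\mathbb{E}A_n=a_nb_n$ and $\mathrm{Var}\,A_n=a_nb_n(b_n+1)$. Queue: let $A_{1,n},A_{2,n},\dots$ be i.i.d. copies of $A_n$. The queue length satisfies $Q_{k+1,n}=\max\{Q_{k,n}+A_{k,n}-s_n,0\}$ with initial queue length $0$, and the stationary queue length $Q_n$ is equal in distribution to $\max_{k\ge 0}\sum_{i=1}^k(A_{i,n}-s_n)$ (the empty sum being $0$). *)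

(* Defs.v *)
From HB Require Import structures.
From mathcomp Require Import all_boot all_order all_algebra.
From mathcomp Require Import all_classical all_reals all_analysis.
From mathcomp Require Import measurable_realfun.

Set Implicit Arguments.
Unset Strict Implicit.
Unset Printing Implicit Defensive.

Import Order.TTheory GRing.Theory Num.Theory.
Import numFieldNormedType.Exports.

Local Open Scope classical_set_scope.
Local Open Scope ring_scope.

Definition gamma_fun (R : realType) (a : R) : R :=
  \int[lebesgue_measure]_(x in `]0%R, +oo[) (x `^ (a - 1) * expR (- x)).

Definition gamma_pdf (R : realType) (shape rate x : R) : R :=
  rate `^ shape / gamma_fun shape * x `^ (shape - 1) * expR (- (rate * x)).

(* Law of A, where Lambda is Gamma distributed with shape a and rate 1 / b and,
   conditionally on Lambda, A is Poisson with mean Lambda. *)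
Definition gamma_poisson_pmf (R : realType) (a b : R) (k : nat) : R :=
  \int[lebesgue_measure]_(x in `]0%R, +oo[)
    (poisson_pmf x k * gamma_pdf a b^-1 x).

Definition has_gamma_poisson_law d (T : measurableType d) (R : realType)
    (P : probability T R) (a b : R) (X : {RV P >-> nat}) : Prop :=
  forall k : nat, P [set w | X w = k] = (gamma_poisson_pmf a b k)%:E.

Definition mutually_independent d d' (T : measurableType d)
    (T' : measurableType d') (R : realType) (P : probability T R)
    (X : nat -> {RV P >-> T'}) : Prop :=
  forall (J : seq nat) (B : nat -> set T'),
    uniq J -> (forall j, measurable (B j)) ->
    P (\bigcap_(j in [set` J]) (X j @^-1` B j)) =
    (\prod_(j <- J) P (X j @^-1` B j))%E.

(* The maximum over k >= 0 of the partial sums of the (A i - s). It is taken in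
   the extended reals because it can be infinite (on a null set when the mean
   of A i is less than s). When it is finite it is attained, the summands being
   integers. *)
Definition max_partial_sums (R : realType) (T : Type) (A : nat -> T -> nat)
    (s : nat) (w : T) : \bar R :=
  ereal_sup [set (\sum_(i < k) ((A i w)%:R - s%:R))%:E | k in [set: nat]].

(* Q is distributed as the maximum of the partial sums of the (A i - s), which
   is the stationary law of the recursion Q_{k+1} = max(Q_k + A_k - s, 0). *)
Definition is_stationary_queue_length d d' (T : measurableType d)
    (T' : measurableType d') (R : realType) (P : probability T R)
    (P' : probability T' R) (A : nat -> {RV P >-> nat}) (s : nat)
    (Q : {RV P' >-> R}) : Prop :=
  forall B : set (\bar R), measurable B ->
    P' [set w | B (Q w)%:E] =
    P [set w | B (max_partial_sums R (fun i => A i : T -> nat) s w)].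

(* u n = v n * (1 + o(1)); in particular u n is eventually finite. *)
Definition leading_order (R : realType) (u : nat -> \bar R) (v : nat -> R) :
    Prop :=
  exists e : nat -> R, e @ \oo --> (0 : R) /\
    \forall n \near \oo, u n = (v n * (1 + e n))%:E.

(* Main.v *)
Require Import Defs.
From HB Require Import structures.
From mathcomp Require Import all_boot all_order all_algebra.
From mathcomp Require Import all_classical all_reals all_analysis.
From mathcomp Require Import measurable_realfun.
From mathcomp Require Import ring lra zify.

(** Let sigma^2 = a b (b + 1) be the variance of one arrival count and S_k the
    k-th partial sum of the A_i - s, a random walk whose steps have the mean
    - beta sigma. The stationary queue is the maximum of this walk, and
    Spitzer's identity ([spitzer_identity]) reduces the maximum to the laws of
    the single S_k:
      E Q = sum_k E[S_k^+] / k,    Var Q = sum_k E[(S_k^+)^2] / k,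
      P(Q = 0) = exp(- sum_k P(S_k > 0) / k)
    ([queue_mean], [queue_variance], [queue_empty]).

    For fixed k, S_k + k s is again Gamma-Poisson, with the parameters k a and b,
    hence Poisson with the random mean b (k a + sqrt (k a) Y) where Y is a
    standardized Gamma variable. As a grows, Y becomes Gaussian, and as b grows
    the Poisson noise is negligible compared to sigma; so S_k / sigma tends to a
    normal variable of mean - k beta and variance k ([cvg_walk_mean]). A Chernoff
    bound with an exponent of order 1 / sigma ([gamma_poisson_chernoff]) bounds
    the k-th terms, in units of sigma, by C q^k with q < 1 that does not depend
    on n. By Tannery's theorem ([cvg_nneseries_dominated]) the three series tend
    to those of the Gaussian walk.

    The terms of the Gaussian series are incomplete Gaussian moments. Writing
    exp(- k A) / A as an integral of 2 w exp(- A w^2) over w > sqrt k turns them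
    into integrals over t of a rational function of t times
    exp(- k (beta^2 / 2 + t^2)) ([gaussian_gt0], [gaussian_pos],
    [gaussian_possq]). Under the integral sign the sum over k is a geometric or a
    logarithmic series, which produces the integrals of the theorem with beta
    instead of beta_n.

    Finally beta_n^2 = beta^2 (b + rho) / (b + 1) tends to beta^2, the integrals
    are continuous in beta, and (b + rho) / (1 - rho) is equivalent to
    sigma / beta. The limits are not 0, so the quotients tend to 1. *)

Set Implicit Arguments.
Unset Strict Implicit.
Unset Printing Implicit Defensive.

Import Order.TTheory GRing.Theory Num.Theory.
Import numFieldNormedType.Exports.

Local Open Scope classical_set_scope.
Local Open Scope ring_scope.

(** * Spitzer's identity *)

Section IterMean.
Context {R : realType} (p x : nat -> R) (p_ge0 : forall j, 0 <= p j).
Implicit Types (f g : R -> \bar R) (h : R -> R -> R).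

Definition step_mean f : \bar R := (\sum_(j <oo) (p j)%:E * f (x j))%E.

(** A random walk whose steps take the value x j with probability p j, seen
    only through means, so that independence is built in. For h u v = u + v,
    iter_mean h k f is the mean of f at the k-th partial sum; for
    h u v = (u + v)^+ it is the mean of f at the maximum of the partial sums up
    to k. *)
Fixpoint iter_mean h (k : nat) f : \bar R :=
  if k is k'.+1 then step_mean (fun u => iter_mean h k' (fun v => f (h u v)))
  else f 0.

Lemma step_mean_ge0 f : (forall u, 0 <= f u)%E -> (0 <= step_mean f)%E.
Proof.
by move=> f0; apply: nneseries_ge0 => j _ _; rewrite mule_ge0// lee_fin.
Qed.

Lemma eq_step_mean f g : (forall u, f u = g u) ->
  step_mean f = step_mean g.
Proof. by move=> fg; apply: eq_eseriesr => j _; rewrite fg. Qed.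

Lemma le_step_mean f g : (forall u, 0 <= f u)%E -> (forall u, f u <= g u)%E ->
  (step_mean f <= step_mean g)%E.
Proof.
move=> f0 fg; apply: lee_nneseries => j *; first by rewrite mule_ge0 ?lee_fin.
by rewrite lee_wpmul2l ?lee_fin.
Qed.

Lemma step_meanD f g : (forall u, 0 <= f u)%E -> (forall u, 0 <= g u)%E ->
  step_mean (fun u => f u + g u)%E = (step_mean f + step_mean g)%E.
Proof.
move=> f0 g0; rewrite /step_mean -nneseriesD.
- by apply: eq_eseriesr => j _; rewrite ge0_muleDr.
- by move=> *; rewrite mule_ge0 ?lee_fin.
- by move=> *; rewrite mule_ge0 ?lee_fin.
Qed.

Lemma step_meanZ (c : R) f : 0 <= c -> (forall u, 0 <= f u)%E ->
  step_mean (fun u => c%:E * f u)%E = (c%:E * step_mean f)%E.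
Proof.
move=> c0 f0; rewrite /step_mean -nneseriesZl.
  by apply: eq_eseriesr => j _; rewrite muleCA.
by move=> *; rewrite mule_ge0 ?lee_fin.
Qed.

Lemma step_mean_swap (q y : nat -> R) (F : R -> R -> \bar R) :
  (forall j, 0 <= q j) -> (forall u v, 0 <= F u v)%E ->
  (\sum_(j <oo) (q j)%:E * step_mean (fun v => F (y j) v))%E =
  step_mean (fun v => \sum_(j <oo) (q j)%:E * F (y j) v)%E.
Proof.
move=> q0 F0; rewrite /step_mean.
transitivity (\sum_(j <oo) \sum_(i <oo) (q j)%:E * ((p i)%:E * F (y j) (x i)))%E.
  by apply: eq_eseriesr => j _; rewrite nneseriesZl// => *; rewrite mule_ge0 ?lee_fin.
transitivity (\sum_(i <oo) \sum_(j <oo) (p i)%:E * ((q j)%:E * F (y j) (x i)))%E; last first.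
  by apply: eq_eseriesr => j _; rewrite nneseriesZl// => *; rewrite mule_ge0 ?lee_fin.
rewrite nneseries_interchange.
  by apply: eq_eseriesr => i _; apply: eq_eseriesr => j _; rewrite muleCA.
by move=> *; rewrite !mule_ge0 ?lee_fin.
Qed.

Lemma step_mean_sum (I : Type) (r : seq I) (F : I -> R -> \bar R) :
  (forall i u, 0 <= F i u)%E ->
  step_mean (fun u => \sum_(i <- r) F i u)%E =
  (\sum_(i <- r) step_mean (F i))%E.
Proof.
move=> F0; rewrite /step_mean -nneseries_sum.
  by apply: eq_eseriesr => j _; rewrite ge0_sume_distrr.
by move=> *; rewrite mule_ge0 ?lee_fin.
Qed.

Lemma iter_meanS h k f : iter_mean h k.+1 f =
  step_mean (fun u => iter_mean h k (fun v => f (h u v))).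
Proof. by []. Qed.

Lemma iter_mean_ge0 h k f : (forall u, 0 <= f u)%E -> (0 <= iter_mean h k f)%E.
Proof.
elim: k f => [|k IH] f f0 //=.
by apply: step_mean_ge0 => u; apply: IH.
Qed.

Lemma eq_iter_mean h k f g : f =1 g -> iter_mean h k f = iter_mean h k g.
Proof. by move=> /funext ->. Qed.

Lemma iter_meanD h k f g : (forall u, 0 <= f u)%E -> (forall u, 0 <= g u)%E ->
  iter_mean h k (fun u => f u + g u)%E = (iter_mean h k f + iter_mean h k g)%E.
Proof.
elim: k f g => [|k IH] f g f0 g0 //=.
under eq_step_mean do rewrite IH//.
by rewrite step_meanD// => u; apply: iter_mean_ge0.
Qed.

Lemma iter_meanZ h k (c : R) f : 0 <= c -> (forall u, 0 <= f u)%E ->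
  iter_mean h k (fun u => c%:E * f u)%E = (c%:E * iter_mean h k f)%E.
Proof.
move=> c0; elim: k f => [|k IH] f f0 //=.
under eq_step_mean do rewrite IH//.
by rewrite step_meanZ// => u; apply: iter_mean_ge0.
Qed.

Lemma iter_mean_step h k (F : R -> R -> \bar R) : (forall u v, 0 <= F u v)%E ->
  iter_mean h k (fun u => step_mean (F u)) =
  step_mean (fun v => iter_mean h k (fun u => F u v)).
Proof.
elim: k F => [|k IH] F F0 //=.
under eq_step_mean do rewrite IH//.
apply: (@step_mean_swap p x (fun u v => iter_mean h k (fun w => F (h u w) v))) => //.
by move=> u v; apply: iter_mean_ge0.
Qed.

(** A submultiplicative weight with finite mean, such as exp(theta |u|), keeps
    finite the means of all the functions that it dominates; this is what
    allows subtractions in extended real identities below. *)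
Lemma le_iter_mean_pow (wt : R -> R) (m : R) h k f (C : R) :
  (forall u, 0 <= f u)%E -> (forall u, 0 <= wt u) -> 0 <= C -> wt 0 <= 1 ->
  (forall u v, wt (h u v) <= wt u * wt v) ->
  step_mean (EFin \o wt) = m%:E -> 0 <= m ->
  (forall u, f u <= (C * wt u)%:E)%E -> (iter_mean h k f <= (C * m ^+ k)%:E)%E.
Proof.
move=> + wt0 + wt1 wth mE m0; elim: k C f => [|k IH] C f f0 C0 fC /=.
  rewrite expr0 mulr1; apply: le_trans (fC _) _.
  by rewrite lee_fin ler_piMr.
apply: (@le_trans _ _ (step_mean (fun u => (C * m ^+ k)%:E * (wt u)%:E)%E)).
  apply: le_step_mean => u; first exact: iter_mean_ge0.
  rewrite -EFinM mulrAC; apply: IH => //; first by rewrite mulr_ge0.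
  by move=> v; apply: (le_trans (fC _)); rewrite lee_fin -mulrA ler_wpM2l.
rewrite step_meanZ ?mulr_ge0 ?exprn_ge0//.
by rewrite mE -EFinM exprSr mulrA.
Qed.

Definition walk_mean := iter_mean (fun u v => u + v).
Definition max_mean := iter_mean (fun u v => Num.max (u + v) 0).

Local Notation pos := (Num.max^~ (0 : R)).

(** Baxter's argument. For a fresh step z and values u, v, put w = z + v; then
    f(u^+ + w^+) + f((u + w)^+) = f((u + w^+)^+) + f((u^+ + w)^+). In means,
    the sum of these equations over k telescopes, and the last terms are
    summed by the induction hypothesis for v |-> f((z + v)^+). *)
Lemma spitzer_identity (wt : R -> R) (m : R) :
  (forall u, 0 <= wt u) -> wt 0 <= 1 ->
  (forall u v, wt (u + v) <= wt u * wt v) ->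
  (forall u, wt (pos u) <= wt u) ->
  step_mean (EFin \o wt) = m%:E ->
  forall n (C : R) f, 0 <= C -> (forall u, 0 <= f u)%E ->
  (forall u, f u <= (C * wt u)%:E)%E ->
  (n%:R%:E * max_mean n f)%E =
  (\sum_(k < n) walk_mean k.+1
     (fun u => max_mean (n - k.+1) (fun v => f (pos u + v)%R)))%E.
Proof.
move=> wt0 wt1 wtD wtpos mE.
have m0 : 0 <= m.
  by rewrite -lee_fin -mE step_mean_ge0// => u; rewrite lee_fin.
elim=> [|n IH] C f C0 f0 fC; first by rewrite big_ord0 mul0e.
pose B k l := walk_mean k (fun u => max_mean l (fun v => f (pos (u + v)%R))).
pose D k := walk_mean k.+1 (fun u => max_mean (n.+1 - k.+1) (fun v => f (pos u + v)%R)).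
pose G k := step_mean (fun z => walk_mean k.+1 (fun u => max_mean (n - k.+1)
   (fun v => f (pos (z + (pos u + v)))))).
(* Both sides are the means of the same two values of f, taken in an order
   that depends on the signs of u and w. *)
have key (k : 'I_n) : (D k + B k.+2 (n - k.+1)%N)%E = (B k.+1 (n - k)%N + G k)%E.
  have nk : (n - k = (n - k.+1).+1)%N by have := ltn_ord k; lia.
  rewrite /D /B /G subSS nk.
  set l := (n - k.+1)%N.
  rewrite [walk_mean k.+2]/walk_mean.
  have -> : iter_mean (fun u v => u + v) k.+2
      (fun u => max_mean l (fun v => f (pos (u + v)))) =
    walk_mean k.+1 (fun u => step_mean (fun z =>
      max_mean l (fun v => f (pos (u + (z + v)))))).
    rewrite /walk_mean iter_mean_step; last by move=> *; apply: iter_mean_ge0.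
    rewrite iter_meanS; apply: eq_step_mean => j.
    apply: eq_iter_mean => u; apply: eq_iter_mean => v.
    by rewrite addrA (addrC u).
  have -> : step_mean (fun z => walk_mean k.+1 (fun u => max_mean l
       (fun v => f (pos (z + (pos u + v)))))) =
     walk_mean k.+1 (fun u => step_mean (fun z => max_mean l
       (fun v => f (pos (z + (pos u + v)))))).
    by rewrite /walk_mean iter_mean_step// => *; apply: iter_mean_ge0.
  rewrite /walk_mean -!iter_meanD; last first.
  - by move=> u; apply: step_mean_ge0 => z; apply: iter_mean_ge0.
  - by move=> u; apply: iter_mean_ge0.
  - by move=> u; apply: step_mean_ge0 => z; apply: iter_mean_ge0.
  - by move=> u; apply: iter_mean_ge0.
  apply: eq_iter_mean => u.
  rewrite /max_mean /= -!step_meanD; try by move=> *; apply: iter_mean_ge0.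
  apply: eq_step_mean => j.
  rewrite -!iter_meanD//; apply: eq_iter_mean => v.
  rewrite (addrCA j).
  move: (j + v) => w.
  case: (leP u 0) => u0; case: (leP w 0) => w0; rewrite ?add0r ?addr0.
  - by rewrite !max_r//; lra.
  - by rewrite addeC (max_l (ltW w0)).
  - by rewrite (max_l (ltW u0)).
  - by rewrite !max_l//; lra.
have B0 : B n.+1 0%N = D n.
  by rewrite /B /D /walk_mean subnn; apply: eq_iter_mean => u; rewrite /max_mean /= !addr0.
have B1 : B 1%N n = max_mean n.+1 f.
  rewrite /B /walk_mean /max_mean /=; apply: eq_step_mean => j.
  by rewrite addr0.
have GE : (\sum_(k < n) G k = n%:R%:E * max_mean n.+1 f)%E.
  rewrite -step_mean_sum; last by move=> *; apply: iter_mean_ge0 => ?; apply: iter_mean_ge0.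
  rewrite {2}/max_mean /= -step_meanZ//; last by move=> *; apply: iter_mean_ge0.
  apply: eq_step_mean => j.
  rewrite -(IH (C * wt j) (fun v => f (pos (j + v))))//.
  - by rewrite mulr_ge0.
  - move=> u; apply: (le_trans (fC _)); rewrite lee_fin -mulrA ler_wpM2l//.
    by apply: le_trans (wtpos _) (wtD _ _).
have Bfin k l : B k l \is a fin_num.
  rewrite ge0_fin_numE; last by apply: iter_mean_ge0 => ?; apply: iter_mean_ge0.
  apply: (@le_lt_trans _ _ ((C * m ^+ l) * m ^+ k)%:E); last by rewrite ltry.
  apply: (@le_iter_mean_pow wt) => //.
  - by move=> u; apply: iter_mean_ge0.
  - by rewrite mulr_ge0// exprn_ge0.
  - move=> u; rewrite mulrAC; apply: (@le_iter_mean_pow wt) => //.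
    + by rewrite mulr_ge0.
    + by move=> u' v'; apply: le_trans (wtpos _) (wtD _ _).
    + move=> v; apply: (le_trans (fC _)); rewrite lee_fin -mulrA ler_wpM2l//.
      by apply: le_trans (wtpos _) (wtD _ _).
have : (\sum_(k < n) D k + \sum_(k < n) B k.+2 (n - k.+1)%N =
        \sum_(k < n) B k.+1 (n - k)%N + n%:R%:E * max_mean n.+1 f)%E.
  by rewrite -GE -!big_split; apply: eq_bigr => k _; exact: key.
have sh : (\sum_(k < n) B k.+2 (n - k.+1)%N + B 1%N n =
  \sum_(k < n) B k.+1 (n - k)%N + B n.+1 0%N)%E.
  transitivity (\sum_(k < n.+1) B k.+1 (n - k)%N)%E.
    by rewrite big_ord_recl subn0 addeC; congr (_ + _)%E; apply: eq_bigr => k _; rewrite /bump.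
  by rewrite big_ord_recr subnn.
have Sfin (F : nat -> nat * nat) : (\sum_(k < n) B (F k).1 (F k).2)%E \is a fin_num.
  by apply/sum_fin_numP => i _ _; apply: Bfin.
move: sh; set S1 := (\sum_(k < n) B k.+2 _)%E; set S2 := (\sum_(k < n) B k.+1 _)%E.
move=> sh eqn.
have S1f : S1 \is a fin_num by exact: (Sfin (fun k => (k.+2, (n - k.+1)%N))).
have S2f : S2 \is a fin_num by exact: (Sfin (fun k => (k.+1, (n - k)%N))).
rewrite big_ord_recr/= -/(D n) -B0 -B1.
rewrite -/(D _) -B1 in eqn *.
have -> : (n.+1%:R%:E * B 1%N n = B 1%N n + n%:R%:E * B 1%N n)%E.
  by rewrite -natr1 EFinD ge0_muleDl ?lee_fin// mul1e addeC.
move: eqn sh; rewrite -[(\sum_(k < n) walk_mean _ _)%E]/(\sum_(k < n) D k)%E.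
move: (\sum_(k < n) D k)%E => SD.
move: (Bfin 1%N n) (Bfin n.+1 0%N) S1f S2f.
move: (B 1%N n) (B n.+1 0%N) S1 S2 => b1 b2 s1 s2.
case: b1 => // b1 _; case: b2 => // b2 _; case: s1 => // s1 _; case: s2 => // s2 _.
rewrite -!EFinM -!EFinD.
case: SD => [sd|//|//] /= [e1] [e2].
rewrite -!EFinD; congr EFin; lra.
Qed.

End IterMean.

(** * Nonnegative series and exponentials of power series *)

Section Series.
Context {R : realType}.

Lemma nneseries_antidiagonal (F : nat -> nat -> \bar R) :
  (forall i j, 0 <= F i j)%E ->
  (\sum_(i <oo) \sum_(j <oo) F i j =
   \sum_(n <oo) \sum_(i < n.+1) F i (n - i)%N)%E.
Proof.
move=> F0.
transitivity (\sum_(i <oo) \sum_(n <oo) if (i <= n)%N then F i (n - i)%N else 0)%E.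
  apply: eq_eseriesr => i _.
  transitivity (\sum_(i <= n <oo) F i (n - i)%N)%E.
    rewrite -(nneseries_addn i (f := fun n => F i (n - i)%N))//.
    by apply: eq_eseriesr => j _; rewrite addnK.
  by rewrite ereal_series eseries_mkcond.
rewrite nneseries_interchange; last by move=> i j; case: ifP.
apply: eq_eseriesr => n _.
rewrite (nneseries_split 0%N n.+1); last by move=> k _; case: ifP.
rewrite add0n eseries0 ?adde0; last first.
  by move=> i ni _; rewrite leqNgt ni.
rewrite big_mkord; apply: eq_bigr => i _.
by rewrite -ltnS ltn_ord.
Qed.

Lemma nneseries_cauchy (a b : nat -> R) :
  (forall n, 0 <= a n) -> (forall n, 0 <= b n) ->
  (\sum_(n <oo) (\sum_(i < n.+1) a i * b (n - i)%N)%:E =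
   (\sum_(n <oo) (a n)%:E) * \sum_(n <oo) (b n)%:E)%E.
Proof.
move=> a0 b0.
have b0' : (0 <= \sum_(n <oo) (b n)%:E)%E.
  by apply: nneseries_ge0 => *; rewrite lee_fin.
transitivity (\sum_(i <oo) \sum_(j <oo) (a i)%:E * (b j)%:E)%E.
  rewrite nneseries_antidiagonal; last by move=> *; rewrite mule_ge0 ?lee_fin.
  by apply: eq_eseriesr => n _; rewrite -sumEFin.
transitivity (\sum_(i <oo) (a i)%:E * (\sum_(j <oo) (b j)%:E))%E.
  by apply: eq_eseriesr => i _; rewrite nneseriesZl// => *; rewrite lee_fin.
have [bfin|] := boolP ((\sum_(j <oo) (b j)%:E)%E \is a fin_num).
  rewrite -(fineK bfin) muleC -nneseriesZl; last by move=> *; rewrite lee_fin.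
  by apply: eq_eseriesr => i _; rewrite muleC.
rewrite ge0_fin_numE// -leNgt leye_eq => /eqP ->.
have [a_eq0|] := pselect (forall i, a i = 0).
  rewrite !eseries0 ?mul0e// => i _ _; first by rewrite a_eq0.
  by rewrite a_eq0 mul0e.
move=> /existsNP[i ai].
have ai0 : 0 < a i by rewrite lt_neqAle a0 eq_sym andbT; apply/eqP.
rewrite (eseries_pinfty (k := i))//; last 2 first.
- by move=> j _; rewrite -ltNye (@lt_le_trans _ _ 0%E)// mule_ge0// lee_fin.
- by rewrite gt0_muley// lte_fin.
rewrite gt0_muley//.
apply: (@lt_le_trans _ _ (\sum_(0 <= j < i.+1) (a j)%:E)%E); last first.
  by apply: nneseries_lim_ge => *; rewrite lee_fin.
rewrite big_nat_recr//= (@lt_le_trans _ _ (a i)%:E) ?lte_fin//.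
by rewrite leeDr// sume_ge0// => *; rewrite lee_fin.
Qed.

(** Tannery's theorem: dominated convergence for the counting measure. *)
Lemma cvg_nneseries_dominated (f : nat -> nat -> R) (l g : nat -> R) :
  (forall n k, 0 <= f n k <= g k) -> (\sum_(k <oo) (g k)%:E < +oo)%E ->
  (forall k, f n k @[n --> \oo] --> l k) ->
  (\sum_(k <oo) (f n k)%:E)%E @[n --> \oo] --> (\sum_(k <oo) (l k)%:E)%E.
Proof.
move=> fg goo fl.
have g0 k : 0 <= g k by have /andP[h1 h2] := fg 0%N k; exact: le_trans h1 h2.
have l0 k : 0 <= l k.
  rewrite -(cvg_lim _ (fl k))//; apply: limr_ge; first by apply/cvg_ex; exists (l k).
  by apply: nearW => n; have /andP[] := fg n k.
have cnt (h : nat -> R) : (forall k, 0 <= h k) ->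
    (\sum_(k <oo) (h k)%:E = \int[@counting nat R]_k (h k)%:E)%E.
  by move=> h0; rewrite ge0_integral_count// => k; rewrite lee_fin.
rewrite (cnt l l0).
rewrite (_ : (fun n => _) = (fun n => \int[@counting nat R]_k (f n k)%:E)%E); last first.
  by apply/funext => n; rewrite cnt// => k; have /andP[] := fg n k.
apply: (@dominated_cvg _ _ _ _ _ _ _ _ (EFin \o g)) => //.
- by move=> k _; apply: cvg_EFin; [exact: nearW|exact: fl].
- apply/integrableP; split => //.
  rewrite (eq_integral (fun k => (g k)%:E)); last first.
    by move=> k _ /=; rewrite ger0_norm.
  by rewrite -cnt.
- move=> n k _ /=; have /andP[f0 fgk] := fg n k.
  by rewrite lee_fin ger0_norm.
Qed.

End Series.

Section Renewal.
Context {R : realType}.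
Implicit Types (r u v : nat -> R).

(** u is the sequence of coefficients of exp(sum_k r_k z^(k+1) / (k+1)): the
    recursion is the differential equation y' = (sum_k r_k z^k) y. *)
Definition exp_coef_of r u := u 0%N = 1 /\
  forall n, n%:R * u n = \sum_(k < n) r k * u (n - k.+1)%N.

(** The recursion refers to all the earlier coefficients, so they are kept in
    a list. *)
Definition exp_coef_seq r (n : nat) : seq R :=
  iter n (fun s => rcons s ((\sum_(k < size s) r k * nth 0 s (size s - k.+1))
                    / (size s)%:R)) [:: 1].

Definition exp_coef r n := nth 0 (exp_coef_seq r n) n.

Lemma exp_coefP r : exp_coef_of r (exp_coef r).
Proof.
have sz n : size (exp_coef_seq r n) = n.+1.
  by elim: n => //= n IH; rewrite size_rcons IH.
have nthE n i : (i <= n)%N -> nth 0 (exp_coef_seq r n) i = exp_coef r i.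
  elim: n => [|n IH]; first by rewrite leqn0 => /eqP ->.
  rewrite leq_eqVlt => /predU1P[->//|]; rewrite ltnS => ni.
  by rewrite /= nth_rcons sz ltnS ni IH.
split=> // -[|n]; first by rewrite big_ord0 mul0r.
rewrite {1}/exp_coef /= nth_rcons sz ltnn eqxx mulrC divfK//.
by apply: eq_bigr => k _; rewrite nthE// subSS leq_subr.
Qed.

Lemma exp_coef_unique r u v : exp_coef_of r u -> exp_coef_of r v -> u =1 v.
Proof.
move=> [u0 uE] [v0 vE] n; elim/ltn_ind: n => -[|n] IH; first by rewrite u0 v0.
have n0 : n.+1%:R != 0 :> R by [].
apply: (mulfI n0); rewrite uE vE; apply: eq_bigr => k _.
by rewrite IH// subSS ltnS leq_subr.
Qed.

Lemma exp_coef_ge0 r u : (forall k, 0 <= r k) -> exp_coef_of r u ->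
  forall n, 0 <= u n.
Proof.
move=> r0 [u0 uE] n; elim/ltn_ind: n => -[|n] IH; first by rewrite u0.
rewrite -(@pmulr_rge0 _ n.+1%:R)// uE sumr_ge0// => k _.
by rewrite mulr_ge0// IH// subSS ltnS leq_subr.
Qed.

Definition conv u v n := \sum_(i < n.+1) u i * v (n - i)%N.

Lemma triangle_sum (F : nat -> nat -> R) n :
  \sum_(i < n) \sum_(k < i) F i k = \sum_(k < n) \sum_(i < n - k.+1) F (i + k.+1)%N k.
Proof.
elim: n => [|n IH]; first by rewrite !big_ord0.
rewrite big_ord_recr/= IH [RHS]big_ord_recr/= subnn big_ord0 addr0 -big_split/=.
apply: eq_bigr => k _.
have -> : (n.+1 - k.+1 = (n - k.+1).+1)%N by have := ltn_ord k; lia.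
rewrite big_ord_recr/=; congr (_ + F _ _).
by have := ltn_ord k; lia.
Qed.

Lemma conv_comm u v : conv u v =1 conv v u.
Proof.
move=> n; rewrite /conv (reindex_inj rev_ord_inj); apply: eq_bigr => i _ /=.
rewrite !subSS subKn; last by rewrite -ltnS ltn_ord.
by rewrite mulrC.
Qed.

(** The part of the derivative of a product of two exponentials that comes
    from the first factor. *)
Lemma conv_half (r u v : nat -> R) n :
  (forall n, n%:R * u n = \sum_(k < n) r k * u (n - k.+1)%N) ->
  \sum_(i < n.+1) i%:R * u i * v (n - i)%N = \sum_(k < n) r k * conv u v (n - k.+1)%N.
Proof.
move=> uE.
transitivity (\sum_(i < n.+1) \sum_(k < i) r k * u (i - k.+1)%N * v (n - i)%N).
  by apply: eq_bigr => i _; rewrite uE big_distrl.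
rewrite (triangle_sum (fun i k => r k * u (i - k.+1)%N * v (n - i)%N)).
rewrite big_ord_recr/= subnn big_ord0 addr0.
apply: eq_bigr => k _; rewrite /conv big_distrr/=.
have -> : (n.+1 - k.+1 = (n - k.+1).+1)%N by have := ltn_ord k; lia.
apply: eq_bigr => i _; rewrite addnK -mulrA; congr (_ * (_ * v _)).
by have := ltn_ord i; have := ltn_ord k; lia.
Qed.

(** exp(F) exp(G) = exp(F + G) for power series. *)
Lemma exp_coef_conv r r' u v : exp_coef_of r u -> exp_coef_of r' v ->
  exp_coef_of (fun k => r k + r' k) (conv u v).
Proof.
move=> [u0 uE] [v0 vE]; split.
  by rewrite /conv big_ord_recl big_ord0 u0 v0 mulr1 addr0.
move=> n.
transitivity (\sum_(i < n.+1) i%:R * u i * v (n - i)%N +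
              \sum_(i < n.+1) i%:R * v i * u (n - i)%N).
  rewrite [X in _ + X](reindex_inj rev_ord_inj) -big_split /conv big_distrr/=.
  apply: eq_bigr => i _; rewrite subSS subKn; last by rewrite -ltnS ltn_ord.
  have -> : n%:R = i%:R + (n - i)%:R :> R by rewrite -natrD subnKC// -ltnS ltn_ord.
  ring.
rewrite (conv_half _ _ uE) (conv_half _ _ vE) -big_split; apply: eq_bigr => k _.
by rewrite (conv_comm v) mulrDl.
Qed.

(** 1 / (1 - z) = exp(sum_k z^(k+1) / (k+1)). *)
Lemma exp_coef_cst1 : exp_coef_of (fun=> 1) (fun=> 1).
Proof.
split=> // n; rewrite mulr1 (eq_bigr (fun=> 1)) ?sumr_const ?card_ord//.
by move=> *; rewrite mulr1.
Qed.

(** These are the coefficients of exp(- sum_k r_k z^(k+1) / (k+1)) / (1 - z);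
    the lower bound is the first-order one, like exp(- L) >= 1 - L. *)
Lemma exp_coef_geometric_ge (r w : nat -> R) :
  (forall k, 0 <= r k <= 1) -> exp_coef_of (fun k => 1 - r k) w ->
  forall n, 1 - \sum_(k < n) r k / k.+1%:R <= w n <= 1.
Proof.
move=> r01 [w0 wE] n.
have r0 k : 0 <= r k by have /andP[] := r01 k.
have r1 k : r k <= 1 by have /andP[] := r01 k.
elim/ltn_ind: n => -[|n] IH; first by rewrite big_ord0 w0 subr0 lexx.
have n0 : 0 < n.+1%:R :> R by [].
rewrite -(ler_pM2l n0) -[X in _ && X](ler_pM2l n0) wE mulr1.
have w01 (k : 'I_n.+1) : 0 <= w (n.+1 - k.+1)%N.
  by apply: (exp_coef_ge0 (r := fun k => 1 - r k)) => // j; rewrite subr_ge0.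
apply/andP; split; last first.
  apply: (@le_trans _ _ (\sum_(k < n.+1) (1 : R))); last by rewrite sumr_const card_ord.
  apply: ler_sum => k _.
  have /IH/andP[_ wk] : (n.+1 - k.+1 < n.+1)%N by rewrite subSS ltnS leq_subr.
  by rewrite mulr_ile1// ?subr_ge0// gerBl.
pose L n := \sum_(k < n) r k / k.+1%:R.
have LE : \sum_(k < n.+1) L (n.+1 - k.+1)%N = n.+1%:R * L n.+1 - \sum_(k < n.+1) r k.
  transitivity (\sum_(k < n.+1) L k).
    rewrite (reindex_inj rev_ord_inj); apply: eq_bigr => k _ /=.
    by rewrite !subSS subKn// -ltnS ltn_ord.
  rewrite /L (triangle_sum (fun _ k => r k / k.+1%:R)) big_distrr/= -sumrB.
  apply: eq_bigr => k _; rewrite sumr_const card_ord -[LHS]mulr_natr natrB//.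
  by field; rewrite nat1r pnatr_eq0.
apply: (@le_trans _ _ (\sum_(k < n.+1) (1 - L (n.+1 - k.+1)%N - r k))).
  by rewrite !sumrB LE sumr_const card_ord -/(L n.+1); lra.
apply: ler_sum => k _.
have /IH/andP[wk wk1] : (n.+1 - k.+1 < n.+1)%N by rewrite subSS ltnS leq_subr.
have := r0 k; have := w01 k; rewrite -/(L _) in wk; nra.
Qed.

End Renewal.

(** * The value at 1 of an exponential of a power series *)

Section RenewalLimit.
Context {R : realType} (r : nat -> R) (L : R).
Hypotheses (r01 : forall k, 0 <= r k <= 1)
  (rL : (\sum_(k <oo) (r k / k.+1%:R)%:E = L%:E)%E).

Let r0 k : 0 <= r k. Proof. by have /andP[] := r01 k. Qed.

Let L0 : 0 <= L.
Proof.
by rewrite -lee_fin -rL nneseries_ge0// => k _ _; rewrite lee_fin divr_ge0.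
Qed.

Let partial_le n : \sum_(k < n) r k / k.+1%:R <= L.
Proof.
rewrite -lee_fin -rL -sumEFin -(big_mkord predT (fun k => (r k / k.+1%:R)%:E)).
by apply: nneseries_lim_ge => k _ _; rewrite lee_fin divr_ge0.
Qed.

Let y (s : R) := exp_coef (fun k => s * r k).
Let Y (s : R) := (\sum_(n <oo) (y s n)%:E)%E.

Let y0 (s : R) : 0 <= s -> forall n, 0 <= y s n.
Proof.
by move=> s0; apply: exp_coef_ge0 (exp_coefP _) => k; rewrite mulr_ge0.
Qed.

Let YD (s t : R) : 0 <= s -> 0 <= t -> Y (s + t) = (Y s * Y t)%E.
Proof.
move=> s0 t0; rewrite /Y -nneseries_cauchy; try exact: y0.
apply: eq_eseriesr => n _; congr EFin.
have h := exp_coef_conv (exp_coefP (fun k => s * r k)) (exp_coefP (fun k => t * r k)).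
apply: (exp_coef_unique _ h); have := exp_coefP (fun k => (s + t) * r k).
by congr exp_coef_of; apply/funext => k; rewrite mulrDl.
Qed.

Let Y_ge (s : R) : 0 <= s -> ((1 + s * L)%:E <= Y s)%E.
Proof.
move=> s0; have [e0 eE] := exp_coefP (fun k => s * r k).
rewrite /Y nneseries_recl//; last by move=> *; rewrite lee_fin y0.
rewrite EFinD {1}/y e0 leeD2l// EFinM -rL -nneseriesZl; last first.
  by move=> *; rewrite lee_fin divr_ge0.
rewrite -(nneseries_addn 1 (f := fun n => (y s n)%:E)); last first.
  by move=> *; rewrite lee_fin y0.
apply: lee_nneseries => n *; first by rewrite -EFinM lee_fin mulr_ge0// divr_ge0.
rewrite addn1 -EFinM lee_fin mulrA ler_pdivrMr// mulrC [leRHS]mulrC eE.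
rewrite big_ord_recr/= subnn e0 mulr1 mulrC lerDr sumr_ge0// => k _.
by rewrite mulr_ge0 ?mulr_ge0// y0.
Qed.

Let Y_le (s : R) : 0 <= s <= 1 -> s * L < 1 -> (Y s <= ((1 - s * L)^-1)%:E)%E.
Proof.
move=> /andP[s0 s1] sL; apply: lime_le.
  by apply: is_cvg_nneseries => *; rewrite lee_fin y0.
apply: nearW => n; rewrite sumEFin lee_fin.
case: n => [|n]; first by rewrite big_geq// invr_ge0 subr_ge0 ltW.
rewrite -[leRHS]mul1r ler_pdivlMr ?subr_gt0//.
pose w := exp_coef (fun k => 1 - s * r k).
have wP : exp_coef_of (fun k => 1 - s * r k) w by exact: exp_coefP.
have := exp_coef_conv (exp_coefP (fun k => s * r k)) wP.
have -> : (fun k => s * r k + (1 - s * r k)) = (fun=> 1).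
  by apply/funext => k; rewrite subrKC.
move=> /exp_coef_unique/(_ exp_coef_cst1 n) E; rewrite -[leRHS]E.
rewrite /conv big_mkord big_distrl/=; apply: ler_sum => i _.
rewrite ler_wpM2l// ?y0//.
have sr01 k : 0 <= s * r k <= 1.
  have /andP[rk0 rk1] := r01 k.
  by rewrite mulr_ge0//= mulr_ile1.
have /andP[+ _] := exp_coef_geometric_ge sr01 wP (n - i)%N.
apply: le_trans.
rewrite lerB// (le_trans _ (ler_wpM2l s0 (partial_le (n - i)%N)))//.
by rewrite mulr_sumr; apply: ler_sum => k _; rewrite mulrA.
Qed.

Let YM (s : R) m : 0 <= s -> Y s \is a fin_num -> Y (m%:R * s) = (fine (Y s) ^+ m)%:E.
Proof.
move=> s0 Yf; elim: m => [|m IH].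
  rewrite mul0r expr0 /Y nneseries_recl//; last by move=> *; rewrite lee_fin y0.
  have [e0 eE] := exp_coefP (fun k => 0 * r k).
  rewrite {1}/y e0 eseries0 ?adde0// => -[//|n] _ _.
  have := eE n.+1; rewrite big1; last by move=> k _; rewrite mul0r mul0r.
  by move=> /eqP; rewrite mulf_eq0 pnatr_eq0/= => /eqP; rewrite /y => ->.
rewrite -nat1r mulrDl mul1r YD ?mulr_ge0// IH exprS EFinM fineK//.
Qed.

(** No theory of analytic functions is needed: the value Y s at 1 of the series
    for s r satisfies Y (s + t) = Y s Y t and 1 + s L <= Y s <= 1 / (1 - s L) for
    small s, and therefore Y 1 = exp L. *)
Lemma sum_exp_coef : (\sum_(n <oo) (exp_coef r n)%:E = (expR L)%:E)%E.
Proof.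
have -> : (\sum_(n <oo) (exp_coef r n)%:E = Y 1)%E.
  rewrite /Y /y; congr (limn _); apply/funext => n; apply: eq_bigr => k _.
  by congr (exp_coef _ _)%:E; apply/funext => j; rewrite mul1r.
(* Y 1 is the (m + 1)-st power of Y (1 / (m + 1)), to which the bounds for
   small arguments apply. *)
have bounds (m : nat) : L < m.+1%:R ->
  exists2 c : R, Y 1 = c%:E &
    expR (L / (1 + m.+1%:R^-1 * L)) <= c <= expR (L / (1 - m.+1%:R^-1 * L)).
  move=> Lm; set s : R := m.+1%:R^-1.
  have s0 : 0 < s by rewrite invr_gt0.
  have sL : s * L < 1 by rewrite mulrC ltr_pdivrMr// mul1r.
  have s1 : 0 <= s <= 1 by rewrite ltW//= invf_le1// ler1n.
  have Yup := Y_le s1 sL.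
  have Ylo := Y_ge (ltW s0).
  have Yf : Y s \is a fin_num.
    rewrite ge0_fin_numE ?(le_lt_trans Yup) ?ltry//.
    by rewrite (le_trans _ Ylo)// lee_fin addr_ge0// mulr_ge0// ltW.
  exists (fine (Y s) ^+ m.+1).
    by rewrite -YM ?(ltW s0)// mulfV.
  rewrite -(fineK Yf) !lee_fin in Yup Ylo.
  have sL0 : 0 <= s * L by rewrite mulr_ge0// ltW.
  have LE (t : R) : L / t = m.+1%:R * (s * L / t).
    by rewrite !mulrA mulfV// mul1r.
  have Y0 : 0 <= fine (Y s) by apply: le_trans Ylo; rewrite addr_ge0.
  rewrite !LE !expRM_natl; apply/andP; split; apply: lerXn2r; rewrite ?nnegrE ?expR_ge0//.
  - apply: le_trans Ylo; rewrite -[leLHS]invrK -expRN invf_ple ?posrE ?invr_gt0 ?expR_gt0//; last lra.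
    apply: le_trans (expR_ge1Dx _); rewrite le_eqVlt; apply/orP; left; apply/eqP.
    by field; lra.
  - apply: (le_trans Yup); apply: le_trans (expR_ge1Dx _).
    rewrite le_eqVlt; apply/orP; left; apply/eqP.
    by field; lra.
have hs : (m.+1%:R^-1 * L) @[m --> \oo] --> (0 : R).
  by rewrite -[X in _ --> X](mul0r L); apply: cvgMl; exact: cvg_harmonic.
have lim1 : expR (L / (1 + m.+1%:R^-1 * L)) @[m --> \oo] --> expR L.
  apply: continuous_cvg; first exact: continuous_expR.
  rewrite -[X in _ --> X]divr1; apply: cvgM; first exact: cvg_cst.
  apply: cvgV => //; rewrite -[X in _ --> X](addr0 1); apply: cvgD => //; exact: cvg_cst.
have lim2 : expR (L / (1 - m.+1%:R^-1 * L)) @[m --> \oo] --> expR L.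
  apply: continuous_cvg; first exact: continuous_expR.
  rewrite -[X in _ --> X]divr1; apply: cvgM; first exact: cvg_cst.
  apply: cvgV => //; rewrite -[X in _ --> X](subr0 1); apply: cvgB => //; exact: cvg_cst.
have [m0 Lm0] : exists m : nat, L < m.+1%:R by eexists; exact: truncnS_gt.
have big : \forall m \near \oo, L < m.+1%:R.
  exists m0 => // m /= m0m; apply: (lt_le_trans Lm0).
  by rewrite ler_nat.
have [c cE _] := bounds _ Lm0; rewrite cE; congr EFin.
apply/eqP; rewrite eq_le; apply/andP; split.
  rewrite -(cvg_lim _ lim2)//; apply: limr_ge; first by apply/cvg_ex; eexists; exact: lim2.
  near=> m.
  have Lm : L < m.+1%:R by near: m.
  by have [c' + /andP[_]] := bounds m Lm; rewrite cE => -[->].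
rewrite -(cvg_lim _ lim1)//; apply: limr_le; first by apply/cvg_ex; eexists; exact: lim1.
near=> m.
have Lm : L < m.+1%:R by near: m.
by have [c' + /andP[+ _]] := bounds m Lm; rewrite cE => -[->].
Unshelve. all: by end_near. Qed.

(** The convolution of w with the coefficients of exp(sum_k r_k z^(k+1) / (k+1))
    is the constant sequence 1, by the series for 1 / (1 - z); in the limit,
    exp(L) times the limit of w is 1. *)
Lemma renewal_limit (w : nat -> R) (winf : R) :
  exp_coef_of (fun k => 1 - r k) w -> w n @[n --> \oo] --> winf ->
  winf = expR (- L).
Proof.
move=> wP wlim.
have w01 n : 0 <= w n <= 1.
  have /andP[_ ->] := exp_coef_geometric_ge r01 wP n; rewrite andbT.
  by apply: (exp_coef_ge0 _ wP) => k; rewrite subr_ge0; have /andP[] := r01 k.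
have e0 : forall n, 0 <= exp_coef r n by exact: (exp_coef_ge0 r0 (exp_coefP r)).
pose f n i := if (i <= n)%N then exp_coef r i * w (n - i)%N else 0.
have fE n : (\sum_(i <oo) (f n i)%:E = 1)%E.
  have f0 i : (0 <= (f n i)%:E)%E.
    rewrite lee_fin /f; case: ifP => // _; rewrite mulr_ge0//.
    by have /andP[] := w01 (n - i)%N.
  rewrite (nneseries_split 0%N n.+1); last by move=> *.
  rewrite add0n eseries0 ?adde0; last by move=> i ni _; rewrite /f leqNgt ni.
  rewrite sumEFin big_mkord -/(1%:E); congr EFin.
  have := exp_coef_conv (exp_coefP r) wP.
  have -> : (fun k => r k + (1 - r k)) = (fun=> 1).
    by apply/funext => k; rewrite subrKC.
  move=> /exp_coef_unique/(_ exp_coef_cst1 n) E; rewrite -[RHS]E.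
  by apply: eq_bigr => i _; rewrite /f -ltnS ltn_ord.
have : (\sum_(i <oo) (f n i)%:E)%E @[n --> \oo] -->
    (\sum_(i <oo) (exp_coef r i * winf)%:E)%E.
  apply: (cvg_nneseries_dominated (g := exp_coef r)).
  - move=> n k; rewrite /f; case: ifP => _; last by rewrite lexx e0.
    have /andP[h1 h2] := w01 (n - k)%N.
    by rewrite mulr_ge0//= ler_piMr.
  - by rewrite sum_exp_coef ltry.
  - move=> k; rewrite -(cvg_shiftn k).
    rewrite (_ : (fun n => f (n + k)%N k) = (fun n => exp_coef r k * w n)).
      by apply: cvgM => //; exact: cvg_cst.
    by apply/funext => n; rewrite /f leq_addl addnK.
under eq_fun do rewrite fE.
move=> /(cvg_unique _ (cvg_cst _)) => /(_ (@ereal_hausdorff _)).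
have winf0 : 0 <= winf.
  rewrite -(cvg_lim _ wlim)//; apply: limr_ge; first by apply/cvg_ex; eexists; exact: wlim.
  by apply: nearW => n; have /andP[] := w01 n.
under eq_eseriesr do rewrite mulrC EFinM.
rewrite nneseriesZl; last by move=> *; rewrite lee_fin.
rewrite sum_exp_coef -EFinM => -[] h.
rewrite expRN -[RHS]mul1r; apply/(canRL (mulfK _)); last by rewrite -h.
by rewrite gt_eqF ?expR_gt0.
Qed.

End RenewalLimit.

(** * Moments of the maximum of a random walk *)

Section SpitzerRecursions.
Context {R : realType}.
Implicit Types (e c v d : nat -> R).

Lemma sum_rev_shift (F : nat -> R) n :
  \sum_(k < n) F (n - k.+1)%N = \sum_(k < n) F k.
Proof.
rewrite (reindex_inj rev_ord_inj); apply: eq_bigr => k _ /=.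
by rewrite subnSK// subKn// ltnW.
Qed.

Lemma spitzer_mean_recursion e c : e 0%N = 0 ->
  (forall n, n%:R * e n = \sum_(k < n) (c k + e (n - k.+1)%N)) ->
  forall n, e n = \sum_(k < n) c k / k.+1%:R.
Proof.
move=> e0 eE; elim=> [|n IH]; first by rewrite big_ord0.
have n0 : n.+1%:R != 0 :> R by [].
apply: (mulfI n0); rewrite [in RHS]big_ord_recr/= -IH.
have -> : n.+1%:R * (e n + c n / n.+1%:R) = n%:R * e n + e n + c n.
  by rewrite -natr1; field; rewrite natr1.
rewrite !eE !big_split/= !sum_rev_shift !big_ord_recr/=.
ring.
Qed.

Lemma spitzer_second_recursion e c v d : v 0%N = 0 ->
  (forall n, e n = \sum_(k < n) c k / k.+1%:R) ->
  (forall n, n%:R * v n =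
     \sum_(k < n) (d k + 2 * (c k * e (n - k.+1)%N) + v (n - k.+1)%N)) ->
  forall n, v n = \sum_(k < n) (d k / k.+1%:R +
     \sum_(i < k) (c i / i.+1%:R) * (c (k - i.+1)%N / (k - i.+1).+1%:R)).
Proof.
move=> v0 eE vE; pose x i := c i / i.+1%:R.
elim=> [|n IH]; first by rewrite big_ord0.
have n0 : n.+1%:R != 0 :> R by [].
apply: (mulfI n0); rewrite big_ord_recr/= -IH.
set S := \sum_(i < n) _.
have -> : n.+1%:R * (v n + (d n / n.+1%:R + S)) = n%:R * v n + v n + d n + n.+1%:R * S.
  by rewrite -natr1; field; rewrite natr1.
have cx i : c i = i.+1%:R * x i by rewrite /x mulrC divfK.
have SE : n.+1%:R * S = 2 * \sum_(k < n) c k * x (n - k.+1)%N.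
  have -> : 2 * \sum_(k < n) c k * x (n - k.+1)%N =
     \sum_(k < n) c k * x (n - k.+1)%N + \sum_(k < n) c (n - k.+1)%N * x k.
    rewrite mulr2n mulrDl mul1r; congr (_ + _).
    rewrite (reindex_inj rev_ord_inj); apply: eq_bigr => k _ /=.
    by rewrite subnSK// subKn// ltnW.
  rewrite -big_split /S big_distrr; apply: eq_bigr => k _ /=.
  rewrite -/(x k) -/(x (n - k.+1)%N) !cx subnSK//.
  have -> : n.+1%:R = k.+1%:R + (n - k)%:R :> R.
    by rewrite -natrD addSn subnKC// ltnW.
  ring.
have T : \sum_(k < n.+1) c k * e (n.+1 - k.+1)%N =
   \sum_(k < n) c k * e (n - k.+1)%N + \sum_(k < n) c k * x (n - k.+1)%N.
  rewrite big_ord_recr/= subnn (eE 0%N) big_ord0 mulr0 addr0 -big_split.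
  apply: eq_bigr => k _ /=.
  have -> : (n.+1 - k.+1 = (n - k.+1).+1)%N by have := ltn_ord k; lia.
  by rewrite (eE (n - k.+1).+1) big_ord_recr/= -eE mulrDr.
rewrite SE !vE !big_split/= -!mulr_sumr T.
rewrite [\sum_(i < n.+1) d i]big_ord_recr !sum_rev_shift.
rewrite [\sum_(i < n.+1) v i]big_ord_recr/=.
ring.
Qed.

End SpitzerRecursions.

Section WalkMoments.
Context {R : realType} (p x : nat -> R) (p_ge0 : forall j, 0 <= p j).
Variables (theta m : R).
Hypotheses (theta0 : 0 < theta)
  (mass1 : step_mean p x (fun=> 1%E) = 1%E)
  (expm : step_mean p x (fun u => (expR (theta * `|u|))%:E) = m%:E).

Local Notation pos := (Num.max^~ (0 : R)).
Local Notation walk := (walk_mean p x).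
Local Notation maxi := (max_mean p x).

Let wt (u : R) := expR (theta * `|u|).

Lemma iter_mean_cst h k (c : R) : 0 <= c -> iter_mean p x h k (fun=> c%:E) = c%:E.
Proof.
move=> c0; elim: k => [//|k IH] /=.
rewrite (@eq_step_mean _ p x _ (fun=> (c%:E * 1)%E)); last by move=> u; rewrite IH mule1.
by rewrite step_meanZ// mass1 mule1.
Qed.

Lemma eq_max_mean_ge0 k (f g : R -> \bar R) :
  (forall u, 0 <= u -> f u = g u) -> maxi k f = maxi k g.
Proof.
case: k => [|k] fg; first by rewrite /max_mean /= fg.
rewrite /max_mean !iter_meanS; apply: eq_step_mean => u.
by apply: eq_iter_mean => v; apply: fg; rewrite le_max lexx orbT.
Qed.

Let wtpos u : wt (pos u) <= wt u.
Proof.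
rewrite ler_expR ler_wpM2l ?(ltW theta0)//.
by case: (leP u 0) => u0; rewrite ?normr0 ?normr_ge0.
Qed.

Let wtD u v : wt (u + v) <= wt u * wt v.
Proof. by rewrite /wt -expRD -mulrDr ler_expR ler_wpM2l ?ler_normD ?(ltW theta0). Qed.

Let wt0 u : 0 <= wt u. Proof. exact: expR_ge0. Qed.

Let wt00 : wt 0 <= 1. Proof. by rewrite /wt normr0 mulr0 expR0. Qed.

Let m0 : 0 <= m.
Proof. by rewrite -lee_fin -expm step_mean_ge0// => u; rewrite lee_fin. Qed.

Let spitzer n (C : R) f : 0 <= C -> (forall u, 0 <= f u)%E ->
  (forall u, f u <= (C * wt u)%:E)%E ->
  (n%:R%:E * maxi n f)%E = (\sum_(k < n) walk k.+1
     (fun u => maxi (n - k.+1) (fun v => f (pos u + v)%R)))%E.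
Proof. by move=> *; apply: (spitzer_identity p_ge0 (wt := wt) (m := m)); eauto. Qed.

Let walk_fin k (C : R) f : 0 <= C -> (forall u, 0 <= f u)%E ->
  (forall u, f u <= (C * wt u)%:E)%E -> walk k f \is a fin_num.
Proof.
move=> C0 f0 fC; rewrite ge0_fin_numE; last exact: iter_mean_ge0.
by apply: (le_lt_trans (le_iter_mean_pow p_ge0 (wt := wt) (m := m) _ f0 _ C0 _ _ _ _ fC)) => //; rewrite ltry.
Qed.

Let maxi_fin k (C : R) f : 0 <= C -> (forall u, 0 <= f u)%E ->
  (forall u, f u <= (C * wt u)%:E)%E -> maxi k f \is a fin_num.
Proof.
move=> C0 f0 fC; rewrite ge0_fin_numE; last exact: iter_mean_ge0.
apply: (le_lt_trans (le_iter_mean_pow p_ge0 (wt := wt) (m := m) _ f0 _ C0 _ _ _ _ fC)) => //; last by rewrite ltry.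
by move=> u v; apply: le_trans (wtpos _) (wtD _ _).
Qed.

Definition pos_fun (u : R) : \bar R := (pos u)%:E.
Definition possq_fun (u : R) : \bar R := (pos u ^+ 2)%:E.
Definition gt0_fun (u : R) : \bar R := ((0 < u)%R%:R)%:E.
Definition le0_fun (u : R) : \bar R := ((u <= 0)%R%:R)%:E.

Let pos_ge0 u : 0 <= pos u. Proof. by rewrite le_max lexx orbT. Qed.
Let pos_fun0 u : (0 <= pos_fun u)%E. Proof. by rewrite lee_fin. Qed.
Let possq_fun0 u : (0 <= possq_fun u)%E. Proof. by rewrite lee_fin exprn_ge0. Qed.
Let gt0_fun0 u : (0 <= gt0_fun u)%E. Proof. by rewrite lee_fin. Qed.
Let le0_fun0 u : (0 <= le0_fun u)%E. Proof. by rewrite lee_fin. Qed.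

Lemma pos_le_expR u : pos u <= theta^-1 * expR (theta * u).
Proof.
rewrite mulrC ler_pdivlMr// mulrC.
case: (leP u 0) => u0; first by rewrite mulr0 expR_ge0.
by apply: le_trans (expR_ge1Dx _); lra.
Qed.

Lemma possq_le_expR u : pos u ^+ 2 <= 2 * theta^-1 ^+ 2 * expR (theta * u).
Proof.
have t0 := ltW theta0.
case: (leP u 0) => u0.
  by rewrite expr0n/= mulr_ge0 ?expR_ge0// mulr_ge0// exprn_ge0// invr_ge0.
have : 1 + (theta * u) ^+ 2 / 2 <= expR (theta * u).
  by apply: (expR_ge1Dxn 1); rewrite mulr_ge0// ltW.
move=> h.
have -> : u ^+ 2 = 2 * theta^-1 ^+ 2 * ((theta * u) ^+ 2 / 2) by field; rewrite gt_eqF.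
by rewrite ler_wpM2l ?mulr_ge0// ?exprn_ge0 ?invr_ge0//; lra.
Qed.

Let wtexp u : expR (theta * u) <= wt u.
Proof. by rewrite ler_expR ler_wpM2l ?ler_norm// ltW. Qed.

Let C1 : 0 <= theta^-1. Proof. by rewrite invr_ge0 ltW. Qed.
Let C2 : 0 <= 2 * theta^-1 ^+ 2. Proof. by rewrite mulr_ge0// exprn_ge0. Qed.

Let pos_fun_le u : (pos_fun u <= (theta^-1 * wt u)%:E)%E.
Proof. by rewrite lee_fin (le_trans (pos_le_expR _))// ler_wpM2l. Qed.

Let possq_fun_le u : (possq_fun u <= (2 * theta^-1 ^+ 2 * wt u)%:E)%E.
Proof. by rewrite lee_fin (le_trans (possq_le_expR _))// ler_wpM2l. Qed.

Let wt_ge1 u : 1 <= wt u.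
Proof. by apply: le_trans (expR_ge1Dx _); rewrite lerDl mulr_ge0// ltW. Qed.

Let le0_fun_le u : (le0_fun u <= (1 * wt u)%:E)%E.
Proof. by rewrite lee_fin mul1r (le_trans _ (wt_ge1 u))// lern1 leq_b1. Qed.

Let gt0_fun_le u : (gt0_fun u <= (1 * wt u)%:E)%E.
Proof. by rewrite lee_fin mul1r (le_trans _ (wt_ge1 u))// lern1 leq_b1. Qed.

Lemma walk_pos_fin k : walk k pos_fun \is a fin_num.
Proof. exact: walk_fin C1 pos_fun0 pos_fun_le. Qed.

Lemma walk_possq_fin k : walk k possq_fun \is a fin_num.
Proof. exact: walk_fin C2 possq_fun0 possq_fun_le. Qed.

Lemma walk_gt0_fin k : walk k gt0_fun \is a fin_num.
Proof. exact: walk_fin ler01 gt0_fun0 gt0_fun_le. Qed.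

Lemma max_pos_fin k : maxi k pos_fun \is a fin_num.
Proof. exact: maxi_fin C1 pos_fun0 pos_fun_le. Qed.

Lemma max_possq_fin k : maxi k possq_fun \is a fin_num.
Proof. exact: maxi_fin C2 possq_fun0 possq_fun_le. Qed.

Lemma max_le0_fin k : maxi k le0_fun \is a fin_num.
Proof. exact: maxi_fin ler01 le0_fun0 le0_fun_le. Qed.

Lemma walk_le0 k : walk k le0_fun = (1 - fine (walk k gt0_fun))%:E.
Proof.
have : (walk k le0_fun + walk k gt0_fun = 1)%E.
  rewrite /walk_mean -iter_meanD// -(iter_mean_cst (fun u v => u + v) k ler01).
  apply: eq_iter_mean => u; rewrite /le0_fun /gt0_fun -EFinD -natrD.
  by case: leP.
have := walk_gt0_fin k; case: (walk k gt0_fun) => // g _.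
by case: (walk k le0_fun) => //= l; rewrite -EFinD => -[] <-; rewrite addrK.
Qed.

Let c k := fine (walk k.+1 pos_fun).
Let d k := fine (walk k.+1 possq_fun).
Let r k := fine (walk k.+1 gt0_fun).

(** Spitzer's identity for f u = u^+, where f (S^+ + M) = S^+ + M. *)
Lemma max_mean_pos n : maxi n pos_fun = (\sum_(k < n) c k / k.+1%:R)%:E.
Proof.
pose e n := fine (maxi n pos_fun).
have eE k : maxi k pos_fun = (e k)%:E by rewrite fineK// max_pos_fin.
have e0 k : 0 <= e k by rewrite -lee_fin -eE; apply: iter_mean_ge0.
rewrite eE; congr EFin; apply: spitzer_mean_recursion.
  by rewrite /e /max_mean /= maxxx.
move=> {}n; apply: EFin_inj; rewrite EFinM -eE (spitzer _ C1 pos_fun0 pos_fun_le).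
rewrite -sumEFin; apply: eq_bigr => k _.
transitivity (walk k.+1 (fun u => pos_fun u + (e (n - k.+1)%N)%:E)%E).
  apply: eq_iter_mean => u; rewrite -eE.
  rewrite (eq_max_mean_ge0 _ (g := fun v => (pos u)%:E + pos_fun v)%E); last first.
    by move=> v v0; rewrite /pos_fun -EFinD !(max_l v0) max_l// addr_ge0.
  by rewrite /max_mean iter_meanD ?iter_mean_cst// => ?; rewrite lee_fin.
rewrite /walk_mean iter_meanD//; last by move=> u; rewrite lee_fin.
have cE : walk k.+1 pos_fun = (c k)%:E by rewrite /c fineK// walk_pos_fin.
by rewrite iter_mean_cst// -/(walk k.+1 pos_fun) cE.
Qed.

(** Spitzer's identity for f u = (u^+)^2; the cross term 2 S^+ M brings in the
    mean of the maximum. *)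
Lemma max_mean_possq n : maxi n possq_fun =
  (\sum_(k < n) (d k / k.+1%:R + \sum_(i < k)
    (c i / i.+1%:R) * (c (k - i.+1)%N / (k - i.+1).+1%:R)))%:E.
Proof.
pose e n := fine (maxi n pos_fun).
pose v n := fine (maxi n possq_fun).
have eE k : maxi k pos_fun = (e k)%:E by rewrite fineK// max_pos_fin.
have vE k : maxi k possq_fun = (v k)%:E by rewrite fineK// max_possq_fin.
have e0 k : 0 <= e k by rewrite -lee_fin -eE; apply: iter_mean_ge0.
have v0 k : 0 <= v k by rewrite -lee_fin -vE; apply: iter_mean_ge0.
rewrite vE; congr EFin; apply: (spitzer_second_recursion (e := e)).
- by rewrite /v /max_mean /possq_fun /= maxxx expr0n.
- by move=> k; rewrite /e max_mean_pos.
move=> {}n; apply: EFin_inj; rewrite EFinM -vE (spitzer _ C2 possq_fun0 possq_fun_le).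
rewrite -sumEFin; apply: eq_bigr => k _; set l := (n - k.+1)%N.
transitivity (walk k.+1
    (fun u => possq_fun u + (2 * e l)%:E * pos_fun u + (v l)%:E)%E).
  apply: eq_iter_mean => u; rewrite -vE.
  rewrite (eq_max_mean_ge0 _ (g := fun w => (pos u ^+ 2)%:E +
     (2 * pos u)%:E * pos_fun w + possq_fun w)%E); last first.
    move=> w w0; rewrite /possq_fun /pos_fun -!EFinM -!EFinD (max_l w0) max_l ?addr_ge0//.
    by congr EFin; ring.
  rewrite /max_mean !iter_meanD//.
  all: try by move=> ?; rewrite ?adde_ge0 ?mule_ge0 ?lee_fin ?exprn_ge0 ?mulr_ge0.
  rewrite iter_mean_cst ?exprn_ge0// iter_meanZ ?mulr_ge0//.
  rewrite -/(maxi l pos_fun) eE /possq_fun /pos_fun -!EFinM.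
  by rewrite -mulrA (mulrC (pos u)) mulrA.
rewrite /walk_mean !iter_meanD//.
all: try by move=> ?; rewrite ?adde_ge0 ?mule_ge0 ?lee_fin ?exprn_ge0 ?mulr_ge0.
rewrite iter_mean_cst// iter_meanZ ?mulr_ge0//.
rewrite -/(walk k.+1 pos_fun) -/(walk k.+1 possq_fun).
rewrite -(fineK (walk_pos_fin _)) -(fineK (walk_possq_fin _)) -!EFinM -!EFinD.
by congr EFin; rewrite -/(c k) -/(d k); ring.
Qed.

(** Spitzer's identity for the indicator of u <= 0: the sum S^+ + M of two
    nonnegative numbers is 0 exactly when both are. *)
Lemma max_mean_le0 :
  exp_coef_of (fun k => 1 - r k) (fun n => fine (maxi n le0_fun)).
Proof.
pose w n := fine (maxi n le0_fun).
have wE k : maxi k le0_fun = (w k)%:E by rewrite fineK// max_le0_fin.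
have w0 k : 0 <= w k by rewrite -lee_fin -wE; apply: iter_mean_ge0.
split; first by rewrite /max_mean /= /le0_fun lexx.
move=> n; apply: EFin_inj; rewrite EFinM -/(w n) -wE (spitzer _ ler01 le0_fun0 le0_fun_le).
rewrite -sumEFin; apply: eq_bigr => k _; set l := (n - k.+1)%N.
transitivity (walk k.+1 (fun u => (w l)%:E * le0_fun u)%E).
  apply: eq_iter_mean => u; rewrite -wE.
  rewrite (eq_max_mean_ge0 _ (g := fun v => (((u <= 0)%R)%:R)%:E * le0_fun v)%E); last first.
    move=> v v0; rewrite /le0_fun -EFinM -natrM mulnb; congr (_%:R)%:E; congr nat_of_bool.
    case: (leP u 0) => u0 /=; first by rewrite add0r.
    by apply/negbTE; rewrite -ltNge; lra.
  by rewrite /max_mean iter_meanZ// muleC.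
by rewrite {1}/walk_mean iter_meanZ// -/(walk k.+1 le0_fun) walk_le0 -EFinM mulrC.
Qed.

Let c0 k : 0 <= c k.
Proof. by rewrite fine_ge0// iter_mean_ge0. Qed.
Let d0 k : 0 <= d k.
Proof. by rewrite fine_ge0// iter_mean_ge0. Qed.

Lemma cvg_max_mean_pos :
  maxi n pos_fun @[n --> \oo] --> (\sum_(k <oo) (c k / k.+1%:R)%:E)%E.
Proof.
under eq_fun do rewrite max_mean_pos -sumEFin -(big_mkord predT (fun k => (c k / k.+1%:R)%:E)).
by apply: is_cvg_nneseries => *; rewrite lee_fin divr_ge0.
Qed.

(** The double sum is the Cauchy square of the series for the mean, so the
    series L2 alone is the variance of the maximum. *)
Lemma cvg_max_mean_possq (L1 L2 : R) :
  (\sum_(k <oo) (c k / k.+1%:R)%:E = L1%:E)%E ->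
  (\sum_(k <oo) (d k / k.+1%:R)%:E = L2%:E)%E ->
  maxi n possq_fun @[n --> \oo] --> (L2 + L1 ^+ 2)%:E.
Proof.
move=> L1E L2E; pose y i := c i / i.+1%:R.
have y0 i : 0 <= y i by rewrite divr_ge0.
suff H : maxi n.+1 possq_fun @[n --> \oo] --> (L2%:E + (L1 ^+ 2)%:E)%E.
  by rewrite EFinD -cvg_shiftS; exact: H.
rewrite (_ : (fun n => _) = (fun n => \sum_(0 <= k < n.+1) (d k / k.+1%:R)%:E +
   \sum_(0 <= k < n) (\sum_(i < k.+1) y i * y (k - i)%N)%:E)%E); last first.
  apply/funext => n; rewrite max_mean_possq !sumEFin -EFinD !big_mkord big_split/=.
  congr (_ + _)%:E; rewrite big_ord_recl big_ord0 add0r.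
  by apply: eq_bigr => k _; apply: eq_bigr => i _; rewrite /bump/= subSS.
apply: cvgeD => //.
- have h : \sum_(0 <= k < n) (d k / k.+1%:R)%:E @[n --> \oo] --> L2%:E.
    by rewrite -L2E; apply: is_cvg_nneseries => *; rewrite lee_fin divr_ge0.
  by move: h; rewrite -cvg_shiftS.
- have -> : (L1 ^+ 2)%:E = (\sum_(n <oo) (\sum_(i < n.+1) y i * y (n - i)%N)%:E)%E.
    by rewrite nneseries_cauchy// L1E -EFinM expr2.
  apply: is_cvg_nneseries => k _ _; rewrite lee_fin sumr_ge0// => i _.
  by rewrite mulr_ge0.
Qed.

(** Chernoff's bound: each step multiplies the mean of exp(theta u) by rho. *)
Lemma walk_le_exp (rho : R) k (C : R) f : 0 <= C -> (forall u, 0 <= f u)%E ->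
  step_mean p x (fun u => (expR (theta * u))%:E) = rho%:E ->
  (forall u, f u <= (C * expR (theta * u))%:E)%E -> (walk k f <= (C * rho ^+ k)%:E)%E.
Proof.
move=> C0 f0 rhoE fC.
apply: (le_iter_mean_pow p_ge0 (wt := fun u => expR (theta * u))) => //.
- by rewrite mulr0 expR0.
- by move=> u v; rewrite mulrDr expRD.
- by rewrite -lee_fin -rhoE step_mean_ge0// => u; rewrite lee_fin expR_ge0.
Qed.

End WalkMoments.

(** * From the queue to the random walk *)

Section RandomWalk.
Context {R : realType} d (T : measurableType d) (P : probability T R).
Variables (A : nat -> {RV P >-> nat}) (s : nat) (p : nat -> R).
Hypotheses (A_indep : mutually_independent A)
  (A_law : forall i j, P [set w | A i w = j] = (p j)%:E).

Let x (j : nat) : R := j%:R - s%:R.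

Let p_ge0 j : 0 <= p j.
Proof. by rewrite -lee_fin -(A_law 0%N). Qed.

(** The maximum over at most k steps of the walk with steps A i - s, i >= m, by
    recursion on the first step: once the arrivals before time m are fixed, the
    part that remains has the same form. *)
Definition running_max (m k : nat) (w : T) : R :=
  (fix F k m := if k is k'.+1 then Num.max (x (A m w) + F k' m.+1) 0 else 0) k m.

Lemma running_maxS m k w :
  running_max m k.+1 w = Num.max (x (A m w) + running_max m.+1 k w) 0.
Proof. by []. Qed.

Lemma measurable_A m j : measurable [set w | A m w = j].
Proof. by have := measurable_funP (A m) measurableT [set j] I; rewrite setTI. Qed.

Definition prefix_event (l : seq nat) : set T :=
  [set w | forall i, (i < size l)%N -> A i w = nth 0%N l i].

Lemma prefix_event_bigcap l :
  prefix_event l = \bigcap_(i in [set` iota 0 (size l)]) (A i @^-1` [set nth 0%N l i]).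
Proof.
apply/seteqP; split => w /= h i.
  by rewrite /= mem_iota => /h.
by move=> il; apply: h; rewrite /= mem_iota.
Qed.

Lemma measurable_prefix_event l : measurable (prefix_event l).
Proof.
rewrite prefix_event_bigcap; apply: fin_bigcap_measurable => [|i _].
  exact: finite_seq.
exact: measurable_A.
Qed.

Lemma prob_prefix_event l : P (prefix_event l) = (\prod_(j <- l) p j)%:E.
Proof.
rewrite prefix_event_bigcap A_indep ?iota_uniq//.
rewrite -[in RHS](mkseq_nth 0%N l) big_map -prodEFin.
apply: eq_bigr => i _; exact: A_law.
Qed.

Lemma prefix_event_rcons l j : prefix_event (rcons l j) =
  prefix_event l `&` [set w | A (size l) w = j].
Proof.
apply/seteqP; split => w /=.
  move=> h; split; last first.
    by have := h (size l); rewrite size_rcons ltnS leqnn nth_rcons ltnn eqxx; apply.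
  move=> i il; have := h i; rewrite size_rcons nth_rcons il; apply.
  exact: ltnW.
move=> [h1 h2] i; rewrite size_rcons ltnS leq_eqVlt nth_rcons => /predU1P[->|il].
  by rewrite ltnn eqxx.
by rewrite il h1.
Qed.

Lemma measurable_running_max m k : measurable_fun setT (running_max m k).
Proof.
elim: k m => [|k IH] m; first exact: measurable_cst.
apply: measurable_maxr => //; apply: measurable_funD; last exact: IH.
apply: measurable_funB => //.
by apply: (@measurableT_comp _ _ _ _ _ _ (fun j : nat => j%:R : R)).
Qed.

(** The steps take countably many values, so f itself may be arbitrary. *)
Lemma measurable_fun_running_max m k (f : R -> \bar R) :
  measurable_fun setT (f \o running_max m k).
Proof.
elim: k m f => [|k IH] m f; first exact: (measurable_cst (f 0)).
move=> _ B mB; rewrite setTI.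
rewrite (_ : _ @^-1` B = \bigcup_j ([set w | A m w = j] `&`
   (((fun v => f (Num.max (x j + v) 0)) \o running_max m.+1 k) @^-1` B))).
  apply: bigcup_measurable => j _; apply: measurableI; first exact: measurable_A.
  by rewrite -[X in measurable X]setTI; apply: IH.
apply/seteqP; split => w /=.
  by move=> h; exists (A m w).
by move=> [j _ [<-]].
Qed.

(** The only use of independence: given the first arrivals l, the maximum that
    starts after them has the mean max_mean. One more arrival is appended to l
    at each step of the induction on k. *)
Lemma integral_running_max k l (f : R -> \bar R) : (forall u, 0 <= f u)%E ->
  (\int[P]_(w in prefix_event l) f (running_max (size l) k w) =
   P (prefix_event l) * max_mean p x k f)%E.
Proof.
elim: k l f => [|k IH] l f f0.
  by rewrite /max_mean /= (integral_cst _ (measurable_prefix_event l)) muleC.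
have E : prefix_event l = \bigcup_j prefix_event (rcons l j).
  apply/seteqP; split => w.
    by move=> wl; exists (A (size l) w) => //; rewrite prefix_event_rcons; split.
  by move=> [j _]; rewrite prefix_event_rcons => -[].
have step j w : prefix_event (rcons l j) w -> running_max (size l) k.+1 w =
    Num.max (x j + running_max (size (rcons l j)) k w) 0.
  by rewrite prefix_event_rcons size_rcons running_maxS => -[_ <-].
rewrite {1}E ge0_integral_bigcup//=; last 3 first.
- by move=> j; exact: measurable_prefix_event.
- by apply: measurable_funTS; exact: (measurable_fun_running_max (size l) k.+1).
- apply/trivIsetP => i j _ _ ij; rewrite !prefix_event_rcons.
  apply/seteqP; split => w //= [[_ wi] [_ wj]].
  by move/eqP : ij; apply; rewrite -wi -wj.
rewrite /max_mean iter_meanS /step_mean prob_prefix_event -nneseriesZl; last first.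
  by move=> j _; rewrite mule_ge0 ?lee_fin// iter_mean_ge0.
apply: eq_eseriesr => j _.
transitivity (\int[P]_(w in prefix_event (rcons l j))
    (fun v => f (Num.max (x j + v) 0)%R) (running_max (size (rcons l j)) k w))%E.
  by apply: eq_integral => w /set_mem wl; rewrite -step.
rewrite (IH (rcons l j) (fun v => f (Num.max (x j + v) 0)%R))//.
by rewrite prob_prefix_event -cats1 big_cat big_seq1/= EFinM -muleA.
Qed.

Lemma integral_running_max0 k (f : R -> \bar R) : (forall u, 0 <= f u)%E ->
  (\int[P]_w f (running_max 0 k w) = max_mean p x k f)%E.
Proof.
move=> f0; have := @integral_running_max k [::] f f0.
rewrite (_ : prefix_event [::] = setT); last by apply/seteqP; split.
by rewrite probability_setT mul1e.
Qed.

Lemma running_max_ge m k i w : (i <= k)%N ->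
  \sum_(j < i) x (A (m + j)%N w) <= running_max m k w.
Proof.
elim: k m i => [|k IH] m [|i]; rewrite ?big_ord0//.
  by move=> _; rewrite running_maxS le_max lexx orbT.
rewrite ltnS => ik; rewrite running_maxS big_ord_recl addn0 le_max lerD2l.
apply/orP; left; apply: le_trans (IH m.+1 i ik).
by apply: ler_sum => j _; rewrite /bump/= addSnnS.
Qed.

Lemma running_max_attained m k w : exists2 i, (i <= k)%N &
  running_max m k w = \sum_(j < i) x (A (m + j)%N w).
Proof.
elim: k m => [|k IH] m; first by exists 0%N => //; rewrite big_ord0.
rewrite running_maxS; case: leP => _; first by exists 0%N => //; rewrite big_ord0.
have [i ik ->] := IH m.+1; exists i.+1 => //.
rewrite big_ord_recl addn0; congr (_ + _).
by apply: eq_bigr => j _; rewrite /bump/= addSnnS.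
Qed.

Lemma running_max_ge0 m k w : 0 <= running_max m k w.
Proof. by have := @running_max_ge m k 0%N w (leq0n _); rewrite big_ord0. Qed.

Lemma running_max_nondecreasing w : nondecreasing_seq (running_max 0 ^~ w).
Proof.
move=> k l kl; have [i ik ->] := running_max_attained 0 k w.
by apply: running_max_ge; exact: leq_trans kl.
Qed.

Let M := max_partial_sums R (fun i => A i : T -> nat) s.

Lemma cvg_running_max w : (running_max 0 k w)%:E @[k --> \oo] --> M w.
Proof.
have -> : M w = ereal_sup (range (fun k => (running_max 0 k w)%:E)).
  apply/eqP; rewrite eq_le; apply/andP; split; apply: ge_ereal_sup => _ [k _ <-].
    apply: (@le_trans _ _ (running_max 0 k w)%:E); last by apply: ereal_sup_ubound; exists k.
    by rewrite lee_fin; exact: (@running_max_ge 0%N k k w (leqnn k)).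
  have [i ik ->] := running_max_attained 0 k w.
  by apply: ereal_sup_ubound; exists i.
by apply: ereal_nondecreasing_cvgn => k l kl; rewrite lee_fin running_max_nondecreasing.
Qed.

Lemma running_max_le_max_partial_sums k w : ((running_max 0 k w)%:E <= M w)%E.
Proof.
have [i ik ->] := running_max_attained 0 k w.
by apply: ereal_sup_ubound; exists i.
Qed.

Lemma max_partial_sums_ge0 w : (0 <= M w)%E.
Proof.
by apply: ereal_sup_ubound; exists 0%N => //; rewrite big_ord0.
Qed.

Lemma measurable_max_partial_sums : measurable_fun setT M.
Proof.
apply: (emeasurable_fun_cvg (fun k => EFin \o running_max 0 k)).
  by move=> k; apply/measurable_EFinP; exact: measurable_running_max.
by move=> w _; exact: cvg_running_max.
Qed.

Variables (d' : measure_display) (T' : measurableType d') (P' : probability T' R)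
  (Q : {RV P' >-> R}) (Q_stat : is_stationary_queue_length A s Q).

Let mQ : measurable_fun setT (EFin \o Q).
Proof. by apply/measurable_EFinP. Qed.

Lemma stationary_integral (g : \bar R -> \bar R) : measurable_fun setT g ->
  (forall y, 0 <= g y)%E ->
  (\int[P']_w g (Q w)%:E = \int[P]_w g (M w))%E.
Proof.
move=> mg g0.
rewrite -[LHS](ge0_integral_pushforward mQ P' measurableT)//.
rewrite -[RHS](ge0_integral_pushforward measurable_max_partial_sums P measurableT)//.
apply: eq_measure_integral; first exact: measurable_max_partial_sums.
by move=> mM B mB _; exact: (Q_stat mB).
Qed.

Let posE w : maxe (M w) 0 = M w.
Proof. by rewrite max_l// max_partial_sums_ge0. Qed.

Lemma stationary_ge0 : P' [set w | Q w < 0] = 0.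
Proof.
have := @Q_stat [set y | (y < 0)%E] _.
have -> : [set w | [set y : \bar R | (y < 0)%E] (Q w)%:E] = [set w | Q w < 0].
  by apply/seteqP; split => w /=; rewrite lte_fin.
move=> ->; last first.
  rewrite (_ : [set y | _] = `]-oo, 0%E[%classic); last by apply/seteqP; split => y /=; rewrite in_itv.
  exact: emeasurable_itv.
rewrite (_ : [set w | _] = set0) ?measure0//.
by apply/seteqP; split => w //=; rewrite ltNge max_partial_sums_ge0.
Qed.

Let cvg_integral_monotone (g : nat -> T -> \bar R) (G : T -> \bar R) :
  (forall k, measurable_fun setT (g k)) -> (forall k w, 0 <= g k w)%E ->
  (forall w, nondecreasing_seq (g ^~ w)) ->
  (forall w, g k w @[k --> \oo] --> G w) ->
  (\int[P]_w g k w)%E @[k --> \oo] --> (\int[P]_w G w)%E.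
Proof.
move=> mg g0 gnd gG.
rewrite (eq_integral (fun w => limn (g ^~ w))); last first.
  by move=> w _; apply/esym/cvg_lim.
by apply: cvg_monotone_convergence => // w _; exact: gnd.
Qed.

(** Monotone convergence of the running maxima. The law of Q gives Q >= 0 only
    almost surely, whence the detour through the positive part. *)
Lemma stationary_mean :
  max_mean p x k (pos_fun (R := R)) @[k --> \oo] --> ('E_(P')[Q])%E.
Proof.
have -> : ('E_(P')[Q] = \int[P']_w maxe (Q w)%:E 0)%E.
  rewrite expectation_def; apply: ae_eq_integral => //.
    by apply: measurable_maxe.
  exists [set w | Q w < 0]; split.
  - rewrite -[X in measurable X]setTI.
    have := measurable_funP Q measurableT `]-oo, 0[%classic (measurable_itv _).
    by congr measurable; congr (_ `&` _); apply/seteqP; split => w /=; rewrite in_itv.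
  - exact: stationary_ge0.
  - move=> w /= h; rewrite ltNge; apply/negP => Q0; apply: h => _.
    by rewrite max_l.
rewrite (stationary_integral (g := fun y => maxe y 0)); last 2 first.
- exact: measurable_maxe.
- by move=> y; rewrite le_max lexx orbT.
under eq_integral do rewrite posE.
have -> : (fun k => max_mean p x k (pos_fun (R := R))) =
    (fun k => \int[P]_w (running_max 0 k w)%:E)%E.
  apply/funext => k; rewrite -integral_running_max0; last first.
    by move=> u; rewrite lee_fin le_max lexx orbT.
  by apply: eq_integral => w _; rewrite /pos_fun max_l// running_max_ge0.
apply: cvg_integral_monotone => //.
- by move=> k; apply/measurable_EFinP; exact: measurable_running_max.
- by move=> k w; rewrite lee_fin running_max_ge0.
- by move=> w k l kl; rewrite lee_fin running_max_nondecreasing.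
- exact: cvg_running_max.
Qed.

Lemma stationary_second_moment :
  max_mean p x k (possq_fun (R := R)) @[k --> \oo] --> (\int[P']_w (Q w ^+ 2)%:E)%E.
Proof.
have -> : (\int[P']_w (Q w ^+ 2)%:E = \int[P']_w ((Q w)%:E * (Q w)%:E))%E.
  by apply: eq_integral => w _; rewrite -EFinM expr2.
rewrite (stationary_integral (g := fun y => y * y)%E); last 2 first.
- exact: emeasurable_funM.
- by move=> y; rewrite -expe2 sqre_ge0.
have -> : (fun k => max_mean p x k (possq_fun (R := R))) =
    (fun k => \int[P]_w ((running_max 0 k w)%:E * (running_max 0 k w)%:E))%E.
  apply/funext => k; rewrite -integral_running_max0; last first.
    by move=> u; rewrite lee_fin exprn_ge0// le_max lexx orbT.
  by apply: eq_integral => w _; rewrite /possq_fun max_l ?running_max_ge0// -EFinM expr2.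
apply: cvg_integral_monotone => //.
- by move=> k; apply: emeasurable_funM; apply/measurable_EFinP; exact: measurable_running_max.
- by move=> k w; rewrite mule_ge0 ?lee_fin ?running_max_ge0.
- move=> w k l kl; rewrite -!EFinM lee_fin.
  by rewrite ler_pM ?running_max_ge0// running_max_nondecreasing.
- move=> w; apply: cvgeM; try exact: cvg_running_max.
  rewrite /mule_def; have := max_partial_sums_ge0 w.
  by case: (M w) => [r| |] //=; rewrite ?andbF ?eqxx.
Qed.

(** Continuity from above: the maximum of the walk is 0 when no running maximum
    is positive. *)
Lemma stationary_empty :
  max_mean p x k (le0_fun (R := R)) @[k --> \oo] --> P' [set w | Q w = 0].
Proof.
pose F k := [set w | running_max 0 k w <= 0].
have mF k : measurable (F k).
  rewrite -[F k]setTI.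
  have := @measurable_running_max 0%N k measurableT `]-oo, 0]%classic (measurable_itv _).
  by congr measurable; congr (_ `&` _); apply/seteqP; split => w /=; rewrite in_itv.
have -> : (fun k => max_mean p x k (le0_fun (R := R))) = P \o F.
  apply/funext => k; rewrite -integral_running_max0 => [|u]; last by rewrite lee_fin.
  transitivity (P (F k `&` setT)); last by rewrite setIT.
  rewrite -integral_indic//; apply: eq_integral => w _.
  rewrite /le0_fun indicE; case: (boolP (running_max 0 k w <= 0)) => h.
    by rewrite mem_set.
  by rewrite memNset//; exact/negP.
have -> : P' [set w | Q w = 0] = P (\bigcap_k F k).
  have := @Q_stat [set 0%E] (emeasurable_set1 _).
  rewrite (_ : [set w | _] = [set w | Q w = 0]); last first.
    by apply/seteqP; split => w /= h; [case: h|rewrite h].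
  move=> ->; congr (P _); apply/seteqP; split => w /=.
    move=> M0 k _; have := running_max_le_max_partial_sums k w.
    by rewrite /M M0 lee_fin.
  move=> h; apply/eqP; rewrite eq_le max_partial_sums_ge0 andbT.
  rewrite -/(M w) -(cvg_lim _ (@cvg_running_max w))//; apply: lime_le.
    by apply/cvg_ex; eexists; exact: cvg_running_max.
  by apply: nearW => k; rewrite lee_fin; exact: h.
apply: nonincreasing_cvg_mu => //.
- by rewrite (le_lt_trans (probability_le1 _ _))// ltry.
- exact: bigcap_measurable.
- move=> k l kl; apply/subsetPset => w; rewrite /F/=.
  by apply: le_trans; exact: running_max_nondecreasing.
Qed.

End RandomWalk.

(** * Integrals over half-lines *)

Section RealIntegrals.
Context {R : realType}.
Local Notation mu := (@lebesgue_measure R).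

(** The image of Lebesgue measure under x |-> c x + m, suitably scaled, agrees
    with Lebesgue measure on intervals. *)
Lemma ge0_integral_affine (c m : R) (f : R -> \bar R) : 0 < c ->
  measurable_fun setT f -> (forall x, 0 <= f x)%E ->
  (\int[mu]_x f x = c%:E * \int[mu]_x f (c * x + m)%R)%E.
Proof.
move=> c0 mf f0; pose phi (x : R) : measurableTypeR R := c * x + m.
have mphi : measurable_fun setT phi.
  by apply: measurable_funD => //; exact: measurable_funM.
pose nu := mscale (NngNum (ltW c0))
  (measure_function_pushforward__canonical__measure_function_Measure mu mphi).
have nuE A : measurable A -> mu A = nu A.
  move=> mA; apply: lebesgue_measure_unique => //= _ [[a b]] _ <-.
  rewrite /nu /mscale /= /pushforward/=.
  rewrite (_ : _ @^-1` _ = `](a - m) / c, (b - m) / c]%classic); last first.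
    apply/seteqP; split => x /=; rewrite !in_itv/= ltr_pdivrMr// ler_pdivlMr// /phi.
      by move=> /andP[h1 h2]; apply/andP; split; lra.
    by move=> /andP[h1 h2]; apply/andP; split; lra.
  rewrite !lebesgue_measure_itv/= !lte_fin ltr_pM2r ?invr_gt0// ltrD2r.
  case: ifPn => ab; last by rewrite mule0.
  by rewrite -!EFinD -EFinM; congr EFin; field; rewrite gt_eqF.
transitivity (\int[nu]_x f x)%E.
  by apply: eq_measure_integral => // A mA _; exact: nuE.
rewrite ge0_integral_mscale//=; congr (_ * _)%E.
by rewrite ge0_integral_pushforward.
Qed.

Lemma ge0_integral_scale (c : R) (f : R -> \bar R) : 0 < c ->
  measurable_fun (`]0, +oo[%classic : set R) f -> (forall x, (0 < x)%R -> 0 <= f x)%E ->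
  (\int[mu]_(x in `]0%R, +oo[) f x = c%:E * \int[mu]_(x in `]0%R, +oo[) f (c * x)%R)%E.
Proof.
move=> c0 mf f0; rewrite integral_mkcond.
rewrite (@ge0_integral_affine c 0)//.
- rewrite [in RHS]integral_mkcond; congr (_ * _)%E; apply: eq_integral => x _.
  rewrite addr0 /patch; congr (if _ then _ else _).
  by apply/idP/idP; rewrite !inE/= !in_itv/= !andbT pmulr_rgt0.
- by apply/(measurable_restrictT _ _).1 => //; exact: measurable_itv.
- move=> x; rewrite /patch; case: ifPn => //; rewrite inE/= in_itv/= andbT => x0.
  exact: f0.
Qed.

(** Dominated convergence from the bounded intervals extends the fundamental
    theorem of calculus to integrands of variable sign on a half-line. *)
Lemma integrable_continuous_FTC2y (f F : R -> R) (a l : R) :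
  {within `[a, +oo[, continuous f} ->
  mu.-integrable `[a, +oo[ (EFin \o f) ->
  F x @[x --> +oo%R] --> l ->
  (forall x, a < x -> derivable F x 1)%R -> F x @[x --> a^'+] --> F a ->
  {in `]a, +oo[, F^`()%classic =1 f} ->
  \int[mu]_(x in `[a, +oo[) f x = l - F a.
Proof.
move=> cf intf Fl dF Fa dFE.
pose D : set R := `[a, +oo[%classic.
pose fn (n : nat) := (EFin \o f) \_ `[a, a + n.+1%:R].
have mD : measurable D by exact: measurable_itv.
have mf : measurable_fun D (EFin \o f) by case/integrableP : intf.
have cvgI : (\int[mu]_(x in D) fn n x)%E @[n --> \oo] --> (\int[mu]_(x in D) (f x)%:E)%E.
  apply: (@dominated_cvg _ _ _ mu D mD fn _ (fun x => (`|f x|)%:E)) => //.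
  - move=> n; apply/(measurable_restrict _ _ _).1 => //.
    by apply: measurable_funS mf => // x [].
  - move=> x Dx; apply: cvg_near_cst; near=> n.
    rewrite /fn patchE mem_set//= in_itv/=.
    move: Dx; rewrite /D/= in_itv/= andbT => ->/=.
    rewrite -lerBlDl; apply: ltW; apply: (lt_le_trans (truncnS_gt _)).
    rewrite ler_nat ltnS; near: n; exact: nbhs_infty_ge.
  - exact: integrable_abse intf.
  - move=> n x Dx; rewrite /fn patchE; case: ifPn => _ //=.
    by rewrite normr0 lee_fin.
have FE n : (\int[mu]_(x in D) fn n x = (F (a + n.+1%:R) - F a)%:E)%E.
  rewrite /fn -integral_mkcondr (_ : D `&` _ = `[a, a + n.+1%:R]%classic); last first.
    apply/seteqP; split => x /=; rewrite /D/= !in_itv/=; first by case.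
    by move=> /andP[-> ->].
  have an : a < a + n.+1%:R by rewrite ltrDl.
  rewrite (@continuous_FTC2 _ _ F)//.
  - apply: continuous_subspaceW cf => x /=; rewrite !in_itv/= andbT.
    by case/andP.
  - split => //.
    + by move=> x; rewrite in_itv/= => /andP[ax _]; exact: dF.
    + apply: cvg_at_left_filter; apply: differentiable_continuous.
      by apply/derivable1_diffP; apply: dF.
  - by move=> x; rewrite in_itv/= => /andP[ax _]; rewrite dFE// in_itv/= ax.
have limF : (F (a + n.+1%:R) - F a)%:E @[n --> \oo] --> (l - F a)%:E.
  apply: cvg_EFin; first exact: nearW.
  apply: cvgB; last exact: cvg_cst.
  apply: (cvg_comp _ F _ Fl); apply/cvgryPge => M; near=> n.
  rewrite -lerBlDl; apply: ltW; apply: (lt_le_trans (truncnS_gt _)).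
  rewrite ler_nat ltnS; near: n; exact: nbhs_infty_ge.
rewrite /Rintegral; apply: EFin_inj; rewrite fineK; last exact: integrable_fin_num.
have := cvgI; under eq_fun do rewrite FE.
by move=> /(cvg_unique _ limF) => /(_ (@ereal_hausdorff _)) ->.
Unshelve. all: by end_near. Qed.

Lemma derive1_expRM (c x : R) : is_derive x 1 (fun t => expR (c * t)) (c * expR (c * x)).
Proof.
have h : is_derive x (1 : R) (fun t : R => c * t) c.
  apply: DeriveDef; first by apply: derivableM.
  by rewrite deriveMl// derive_id mulr1.
have := @is_derive1_comp _ expR (fun t => c * t) x _ _ (is_derive_expR _) h.
by rewrite mulrC.
Qed.

Lemma cvgr_expRN (c : R) : 0 < c -> expR (- (c * x)) @[x --> +oo%R] --> (0 : R).
Proof.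
move=> c0; apply: (cvg_comp (fun x => c * x) (fun x => expR (- x))); last exact: cvgr_expR.
by apply: gt0_cvgMry => //; exact: cvg_id.
Qed.

Lemma continuous_expRM (c : R) : continuous (fun t => expR (c * t)).
Proof.
move=> x; apply: differentiable_continuous; apply/derivable1_diffP.
by have [] := derive1_expRM c x.
Qed.

Lemma integral_expRN (c a : R) : 0 < c ->
  (\int[mu]_(x in `[a, +oo[) (expR (- (c * x)))%:E = (expR (- (c * a)) / c)%:E)%E.
Proof.
move=> c0; have E (x : R) : - (c * x) = (- c) * x by rewrite mulNr.
rewrite (@ge0_continuous_FTC2y _ _ (fun x => - (expR (- (c * x)) / c)) _ 0).
- by rewrite -EFinB sub0r opprK.
- by move=> x _; exact: expR_ge0.
- apply: continuous_subspaceT => x; under eq_fun do rewrite E; exact: continuous_expRM.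
- rewrite -oppr0; apply: cvgN; rewrite -(mul0r c^-1); apply: cvgM; last exact: cvg_cst.
  exact: cvgr_expRN.
- by move=> x _; apply: derivableN; apply: derivableM.
- apply: cvg_at_right_filter; apply: cvgN; apply: cvgM; last exact: cvg_cst.
  under eq_fun do rewrite E; rewrite E; exact: continuous_expRM.
- move=> x _; rewrite derive1E deriveN//.
  have [d1 d2] := derive1_expRM (- c) x.
  have -> : (fun t => expR (- (c * t)) / c) = (fun t => expR (- c * t) / c).
    by apply/funext => t; rewrite E.
  rewrite deriveMr//.
  by rewrite d2 E; field; rewrite gt_eqF.
Qed.

End RealIntegrals.

(** * The Gamma function *)

Section Gamma.
Context {R : realType}.
Local Notation mu := (@lebesgue_measure R).
Local Notation D := (`]0, +oo[%classic : set R).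
Implicit Types a b c x z : R.

Let mD : measurable D. Proof. exact: measurable_itv. Qed.

Lemma measurable_powR_expR a c :
  measurable_fun D (fun x => (x `^ a * expR (- (c * x)))%:E).
Proof.
apply/measurable_EFinP; apply: measurable_funM.
  by apply: measurable_funTS; exact: measurable_powR.
apply: measurable_funTS; apply: measurableT_comp => //.
apply: measurableT_comp => //; exact: measurable_funM.
Qed.

(** From ln y < y at y = t x, with t chosen so that a t <= c. *)
Lemma powR_le_expR a c : 0 <= a -> 0 < c ->
  exists2 K : R, 0 < K & forall x, 0 < x -> x `^ a <= K * expR (c * x).
Proof.
move=> a0 c0; pose t := c / (a + 1).
have t0 : 0 < t by rewrite divr_gt0// ltr_pwDr.
exists (expR (- (a * ln t))); first exact: expR_gt0.
move=> x x0; rewrite /powR gt_eqF// -expRD ler_expR.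
have h : ln (t * x) <= t * x by apply/ltW/ln_sublinear; rewrite mulr_gt0.
rewrite lnM ?posrE// in h.
have : a * ln x <= a * (t * x) - a * ln t by rewrite -mulrBr ler_wpM2l//; lra.
move/le_trans; apply; rewrite addrC lerD2l mulrA ler_wpM2r ?ltW//.
by rewrite /t mulrA ltr_pdivrMr ?ltr_pwDr// mulrDr mulr1 mulrC ltrDl.
Qed.

Lemma integrable_powR_expR a c : 0 <= a -> 0 < c ->
  mu.-integrable D (fun x => (x `^ a * expR (- (c * x)))%:E).
Proof.
move=> a0 c0; have c20 : 0 < c / 2 by rewrite divr_gt0.
have [K K0 Kx] := powR_le_expR a0 c20.
apply: (@le_integrable _ _ _ mu D mD _ (fun x => (K%:E * (expR (- (c / 2 * x)))%:E)%E)).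
- exact: measurable_powR_expR.
- move=> x /=; rewrite in_itv/= andbT => x0.
  rewrite lee_fin !ger0_norm ?mulr_ge0 ?powR_ge0 ?expR_ge0// ?(ltW K0)//.
  apply: le_trans (ler_wpM2r (expR_ge0 _) (Kx _ x0)) _.
  by rewrite -[leLHS]mulrA -expRD; apply: ler_wpM2l; [exact: ltW|rewrite ler_expR; lra].
- apply: integrableZl => //; apply/integrableP; split.
    have := measurable_powR_expR 0 (c / 2); congr measurable_fun.
    by apply/funext => x; rewrite powRr0 mul1r.
  under eq_integral do rewrite gee0_abs ?lee_fin ?expR_ge0//.
  rewrite integral_itv_obnd_cbnd; last first.
    have := measurable_powR_expR 0 (c / 2); congr measurable_fun.
    by apply/funext => x; rewrite powRr0 mul1r.
  by rewrite integral_expRN// ltry.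
Qed.

Let mg a : measurable_fun D (fun x => (x `^ a * expR (- x))%:E).
Proof.
have := measurable_powR_expR a 1; congr measurable_fun.
by apply/funext => x; rewrite mul1r.
Qed.

Let g_ge0 a c x : (0 <= (x `^ a * expR (- (c * x)))%:E)%E.
Proof. by rewrite lee_fin mulr_ge0 ?powR_ge0 ?expR_ge0. Qed.

Let g_ge01 a x : (0 <= (x `^ a * expR (- x))%:E)%E.
Proof. by rewrite lee_fin mulr_ge0 ?powR_ge0 ?expR_ge0. Qed.

Lemma gamma_funE a : 1 <= a ->
  (\int[mu]_(x in D) (x `^ (a - 1) * expR (- x))%:E = (gamma_fun a)%:E)%E.
Proof.
move=> a1; rewrite /gamma_fun /Rintegral fineK//.
have a10 : 0 <= a - 1 by lra.
have intf := integrable_powR_expR a10 ltr01.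
apply: integrable_fin_num => //.
by move: intf; congr (integrable _ _ _); apply/funext => x; rewrite mul1r.
Qed.

Lemma gamma_scaled a c : 1 <= a -> 0 < c ->
  (\int[mu]_(x in D) (x `^ (a - 1) * expR (- (c * x)))%:E =
   (c^-1 `^ a * gamma_fun a)%:E)%E.
Proof.
move=> a1 c0; have ci : 0 < c^-1 by rewrite invr_gt0.
rewrite (ge0_integral_scale ci (measurable_powR_expR _ _)); last by move=> x _; exact: g_ge0.
rewrite EFinM -gamma_funE// -[RHS]ge0_integralZl_EFin ?powR_ge0//.
rewrite -ge0_integralZl_EFin ?(ltW ci)//.
- apply: eq_integral => x; rewrite inE/= in_itv/= andbT => x0.
  rewrite mulVKf ?gt_eqF// -!EFinM powRM ?ltW// mulrA; congr (_%:E).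
  by rewrite !mulrA mulr_powRB1 ?ltW//; lra.
- apply/measurable_EFinP; apply: measurable_funM.
    apply: (@measurableT_comp _ _ _ _ _ _ (fun y => y `^ (a - 1))); first exact: measurable_powR.
    by apply: measurable_funTS; exact: measurable_funM.
  apply: measurable_funTS; apply: measurableT_comp => //.
  by apply: measurableT_comp => //; apply: measurable_funM => //; exact: measurable_funM.
- exact: mg.
Qed.

Lemma gamma_fun_gt0 a : 1 <= a -> 0 < gamma_fun a.
Proof.
move=> a1; rewrite -lte_fin -gamma_funE//.
have sD : `]1%R, 2%R]%classic `<=` D.
  by move=> x /=; rewrite !in_itv/= andbT => /andP[x1 _]; apply: lt_trans x1.
apply: (@lt_le_trans _ _ (\int[mu]_(x in `]1%R, 2%R]) (expR (- 2))%:E)%E).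
  rewrite integral_cst//= lebesgue_measure_itv/= lte_fin ltr1n -EFinD -EFinM lte_fin.
  by rewrite mulr_gt0 ?expR_gt0//; lra.
apply: (@le_trans _ _ (\int[mu]_(x in `]1%R, 2%R]) (x `^ (a - 1) * expR (- x))%:E)%E).
  apply: ge0_le_integral => //.
  - exact: (measurable_funS mD sD (mg _)).
  - move=> x /=; rewrite in_itv/= => /andP[x1 x2]; rewrite lee_fin.
    rewrite -[leLHS]mul1r ler_pM ?expR_ge0 ?ler_expR//; last by rewrite lerN2.
    rewrite /powR gt_eqF; last by lra.
    by rewrite -[leLHS]expR0 ler_expR mulr_ge0 ?ln_ge0 ?subr_ge0 ?(ltW x1).
by apply: ge0_subset_integral => //; exact: mg.
Qed.

Lemma is_derive_powR_expR a x : 0 < x ->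
  is_derive x 1 (fun t => - (t `^ a * expR (- t)))
    (x `^ a * expR (- x) - a * (x `^ (a - 1) * expR (- x))).
Proof.
move=> x0; have xI : x \in `]0, +oo[ by rewrite in_itv/= x0.
have dp : derivable (fun t : R => t `^ a) x 1 by exact: derivable_powR.
have de := derive1_expRM (-1) x.
have E : (fun t : R => expR (- t)) = (fun t => expR (-1 * t)).
  by apply/funext => t; rewrite mulN1r.
apply: DeriveDef.
  by apply: derivableN; apply: derivableM => //; rewrite E; case: de.
rewrite deriveN; last by apply: derivableM => //; rewrite E; case: de.
rewrite deriveM//.
have -> : 'D_1 (fun t : R => expR (- t)) x = -1 * expR (-1 * x) by rewrite E; case: de.
by rewrite -derive1E (powR_derive1 _ xI) !mulN1r /GRing.scale/=; ring.
Qed.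

(** Partial integration. *)
Lemma gamma_funD1 a : 1 < a -> gamma_fun (a + 1) = a * gamma_fun a.
Proof.
move=> a1.
have a0 : 0 < a by lra.
have a10 : 0 < a - 1 by lra.
pose f x := x `^ a * expR (- x) - a * (x `^ (a - 1) * expR (- x)).
have int1 c : 0 <= c -> mu.-integrable D (EFin \o (fun x => x `^ c * expR (- x))).
  move=> c0; have := integrable_powR_expR c0 ltr01.
  by congr (integrable _ _ _); apply/funext => x; rewrite /= mul1r.
have int2 : mu.-integrable D (fun x => a%:E * (x `^ (a - 1) * expR (- x))%:E)%E.
  by apply: integrableZl => //; exact: (int1 _ (ltW a10)).
have intf : mu.-integrable D (EFin \o f).
  apply: (@integrableB _ _ _ mu D mD (EFin \o (fun x => x `^ a * expR (- x)))
     (fun x => a%:E * (x `^ (a - 1) * expR (- x))%:E)%E).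
  - exact: (int1 _ (ltW a0)).
  - exact: int2.
have -> : gamma_fun (a + 1) = \int[mu]_(x in D) (x `^ a * expR (- x)).
  by rewrite /gamma_fun addrK.
apply/eqP; rewrite -subr_eq0 /gamma_fun -RintegralZl//; last exact: (int1 _ (ltW a10)).
rewrite -RintegralB//; last exact: (int1 _ (ltW a0)).
rewrite Rintegral_itv_obnd_cbnd//.
rewrite (@integrable_continuous_FTC2y _ f (fun t => - (t `^ a * expR (- t))) 0 0).
- by rewrite powR0 ?(lt0r_neq0 a0)// mul0r oppr0 subr0.
- apply/continuous_within_itvcyP; split.
    move=> x; rewrite in_itv/= andbT => x0.
    have dp c : derivable (fun t : R => t `^ c) x 1.
      by apply: derivable_powR; rewrite in_itv/= x0.
    have cp c : {for x, continuous (fun t : R => t `^ c)}.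
      by apply: differentiable_continuous; apply/derivable1_diffP; exact: dp.
    have ce : {for x, continuous (fun t : R => expR (- t))}.
      by apply: continuous_comp; [exact: opp_continuous|exact: continuous_expR].
    rewrite /continuous_at; apply: cvgB; first by apply: cvgM; [exact: cp|exact: ce].
    apply: cvgM; first exact: cvg_cst.
    by apply: cvgM; [exact: cp|exact: ce].
  have ce : expR (- t) @[t --> (0:R)^'+] --> (1 : R).
    apply: cvg_at_right_filter; rewrite -[X in _ --> X](@expR0 R) -[X in expR X](@oppr0 R).
    by apply: continuous_comp; [exact: opp_continuous|exact: continuous_expR].
  rewrite /f powR0 ?(lt0r_neq0 a0)// powR0 ?(lt0r_neq0 a10)// !mul0r mulr0 subr0.
  rewrite -[X in _ --> X](subr0 (0 : R)); apply: cvgB.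
    by rewrite -[X in _ --> X](mul0r (1 : R)); apply: cvgM => //; exact: powR_cvg0.
  rewrite -[X in _ --> X](mulr0 a); apply: cvgM; first exact: cvg_cst.
  by rewrite -[X in _ --> X](mul0r (1 : R)); apply: cvgM => //; exact: powR_cvg0.
- have /integrableP[m1 m2] := intf; apply/integrableP; split.
    apply: measurable_funTS; apply/measurable_EFinP.
    have me : measurable_fun setT (fun t : R => expR (- t)) by exact: measurableT_comp.
    apply: measurable_funB; first by apply: measurable_funM => //; exact: measurable_powR.
    by apply: measurable_funM => //; apply: measurable_funM => //; exact: measurable_powR.
  by rewrite -integral_itv_obnd_cbnd//; exact: measurableT_comp.
- rewrite -oppr0; apply: cvgN.
  have h2 : (0 : R) < 2^-1 by rewrite invr_gt0.
  have [K K0 Kx] := powR_le_expR (ltW a0) h2.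
  apply: (@squeeze_cvgr _ _ _ _ (cst 0) (fun x => K * expR (- (2^-1 * x)))).
  + near=> x; have x0 : 0 < x by near: x; exact: nbhs_pinfty_gt.
    rewrite /= mulr_ge0 ?powR_ge0 ?expR_ge0//=.
    apply: le_trans (ler_wpM2r (expR_ge0 _) (Kx _ x0)) _.
    by rewrite -[leLHS]mulrA -expRD; apply: ler_wpM2l; [exact: ltW|rewrite ler_expR; lra].
  + exact: cvg_cst.
  + rewrite -[X in _ --> X](mulr0 K); apply: cvgM; first exact: cvg_cst.
    exact: cvgr_expRN.
- by move=> x x0; have [] := is_derive_powR_expR a x0.
- rewrite powR0 ?(lt0r_neq0 a0)// mul0r; apply: cvgN; rewrite -[X in _ --> X](mul0r (1 : R)).
  apply: cvgM; first exact: powR_cvg0.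
  apply: cvg_at_right_filter; rewrite -[X in _ --> X](@expR0 R) -[X in expR X](@oppr0 R).
  by apply: continuous_comp; [exact: opp_continuous|exact: continuous_expR].
- move=> x; rewrite in_itv/= andbT => x0; rewrite derive1E.
  by have [_ ->] := is_derive_powR_expR a x0.
Unshelve. all: by end_near. Qed.

End Gamma.

(** * Gamma-Poisson laws *)

Section GammaPoisson.
Context {R : realType}.
Local Notation mu := (@lebesgue_measure R).
Local Notation D := (`]0, +oo[%classic : set R).
Implicit Types a b c x z : R.

Let mD : measurable D. Proof. exact: measurable_itv. Qed.

(** Coefficients of the power series (1 - z)^(-a). *)
Definition neg_binomial_coef a k : R := (\prod_(i < k) (a + i%:R)) / k`!%:R.

Lemma neg_binomial_coefS a k :
  k.+1%:R * neg_binomial_coef a k.+1 = (a + k%:R) * neg_binomial_coef a k.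
Proof.
rewrite /neg_binomial_coef big_ord_recr/= factS natrM.
have h1 : k.+1%:R != 0 :> R by [].
have h2 : k`!%:R != 0 :> R by rewrite pnatr_eq0 -lt0n fact_gt0.
move: (k.+1%:R : R) (k`!%:R : R) h1 h2 => N F h1 h2.
by field; rewrite h1 h2.
Qed.

(** (1 - z)^(-a) = exp(a sum_k z^(k+1) / (k+1)), which yields the convolution
    identity of Vandermonde without binomial manipulations. *)
Lemma exp_coef_neg_binomial a : exp_coef_of (fun=> a) (neg_binomial_coef a).
Proof.
split; first by rewrite /neg_binomial_coef big_ord0 fact0 divr1.
elim=> [|n IH]; first by rewrite big_ord0 mul0r.
rewrite neg_binomial_coefS mulrDl IH big_ord_recl subSS subn0; congr (_ + _).
Qed.

Lemma neg_binomial_vandermonde a a' n :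
  \sum_(i < n.+1) neg_binomial_coef a i * neg_binomial_coef a' (n - i)%N =
  neg_binomial_coef (a + a') n.
Proof.
have h := exp_coef_conv (exp_coef_neg_binomial a) (exp_coef_neg_binomial a').
exact: (exp_coef_unique h (exp_coef_neg_binomial (a + a'))).
Qed.

Lemma neg_binomial_coef_ge0 a k : 0 <= a -> 0 <= neg_binomial_coef a k.
Proof. by move=> a0; rewrite divr_ge0// prodr_ge0// => i _; rewrite addr_ge0. Qed.

Lemma gamma_funDn a n : 1 < a ->
  gamma_fun (a + n%:R) = (\prod_(i < n) (a + i%:R)) * gamma_fun a.
Proof.
move=> a1; elim: n => [|n IH]; first by rewrite addr0 big_ord0 mul1r.
rewrite -natr1 addrA gamma_funD1; last by rewrite ltr_wpDr.
by rewrite IH big_ord_recr/=; ring.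
Qed.

Lemma gamma_pdf_ge0 a b x : 1 < a -> 0 < b -> 0 < x -> 0 <= gamma_pdf a b^-1 x.
Proof.
move=> a1 b0 x0; rewrite /gamma_pdf !mulr_ge0 ?powR_ge0 ?expR_ge0// invr_ge0.
by rewrite ltW// gamma_fun_gt0// ltW.
Qed.

Lemma measurable_gamma_pdf a b : measurable_fun D (EFin \o gamma_pdf a b).
Proof.
have -> : EFin \o gamma_pdf a b = (fun x => (b `^ a / gamma_fun a)%:E *
    (x `^ (a - 1) * expR (- (b * x)))%:E)%E.
  by apply/funext => x; rewrite /= /gamma_pdf -EFinM -mulrA.
by apply: emeasurable_funM; [exact: measurable_cst|exact: measurable_powR_expR].
Qed.

(** Tilting a Gamma density by an exponential only changes its rate. *)
Lemma integral_tilted_gamma a b c (k : nat) : 1 < a -> 0 < b -> - b^-1 < c ->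
  (\int[mu]_(x in D) ((x ^+ k * expR (- (c * x))) * gamma_pdf a b^-1 x)%:E =
   ((\prod_(i < k) (a + i%:R)) * b^-1 `^ a * (c + b^-1)^-1 `^ (a + k%:R))%:E)%E.
Proof.
move=> a1 b0 cb; have cb0 : 0 < c + b^-1 by lra.
have ak1 : 1 <= a + k%:R by rewrite (le_trans (ltW a1))// lerDl.
have Ga := gamma_fun_gt0 (ltW a1).
transitivity (\int[mu]_(x in D) ((b^-1 `^ a / gamma_fun a)%:E *
    (x `^ (a + k%:R - 1) * expR (- ((c + b^-1) * x)))%:E))%E.
  apply: eq_integral => x; rewrite inE/= in_itv/= andbT => x0.
  rewrite -EFinM /gamma_pdf; congr EFin.
  have -> : x `^ (a + k%:R - 1) = x ^+ k * x `^ (a - 1).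
    rewrite -powR_mulrn ?(ltW x0)// -powRD; last by apply/implyP => _; exact: lt0r_neq0.
    by congr (_ `^ _); ring.
  by rewrite mulrDl opprD expRD; ring.
rewrite ge0_integralZl_EFin//.
- rewrite gamma_scaled// -EFinM gamma_funDn//; congr EFin.
  by field; rewrite gt_eqF.
- by move=> x _; rewrite lee_fin mulr_ge0 ?powR_ge0 ?expR_ge0.
- exact: measurable_powR_expR.
- by rewrite divr_ge0 ?powR_ge0// ltW.
Qed.

Lemma gamma_poisson_integral a b k : 1 < a -> 0 < b ->
  (\int[mu]_(x in D) (poisson_pmf x k * gamma_pdf a b^-1 x)%:E =
   ((1 + b)^-1 `^ a * (b / (1 + b)) ^+ k * neg_binomial_coef a k)%:E)%E.
Proof.
move=> a1 b0; have b1 : 0 < 1 + b by lra.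
transitivity (\int[mu]_(x in D) ((k`!%:R^-1)%:E *
    ((x ^+ k * expR (- (1 * x))) * gamma_pdf a b^-1 x)%:E))%E.
  apply: eq_integral => x; rewrite inE/= in_itv/= andbT => x0.
  by rewrite -EFinM /poisson_pmf x0 mul1r; congr EFin; ring.
have bi : 0 < b^-1 by rewrite invr_gt0.
rewrite ge0_integralZl_EFin//.
- rewrite integral_tilted_gamma//; last by lra.
  rewrite -EFinM; congr EFin.
  have -> : (1 + b^-1)^-1 = b / (1 + b) by field; lra.
  have q0 : 0 < b / (1 + b) by rewrite divr_gt0.
  rewrite powRD; last by apply/implyP => _; exact: lt0r_neq0.
  rewrite powR_mulrn ?(ltW q0)// /neg_binomial_coef.
  move: q0; set q := b / (1 + b) => q0.
  have -> : (1 + b)^-1 = b^-1 * q by rewrite /q; field; lra.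
  rewrite [(b^-1 * q) `^ a]powRM ?(ltW bi) ?(ltW q0)//.
  by move: (b^-1 `^ a) (q `^ a) (q ^+ k) => ? ? ?; ring.
- by move=> x; rewrite /= in_itv/= andbT => x0;
   rewrite lee_fin mulr_ge0 ?gamma_pdf_ge0// mulr_ge0 ?expR_ge0// exprn_ge0// ltW.
- rewrite (_ : (fun x => _) = (fun x => (x ^+ k * expR (- (1 * x)))%:E * (gamma_pdf a b^-1 x)%:E)%E); last first.
    by apply/funext => x; rewrite -EFinM.
  apply: emeasurable_funM; last exact: measurable_gamma_pdf.
  apply/measurable_EFinP; apply: measurable_funM; first exact: measurable_funX.
  apply: measurable_funTS; apply: measurableT_comp => //.
  by apply: measurableT_comp => //; exact: measurable_funM.
Qed.

Lemma gamma_poisson_pmfE a b k : 1 < a -> 0 < b ->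
  gamma_poisson_pmf a b k =
  (1 + b)^-1 `^ a * (b / (1 + b)) ^+ k * neg_binomial_coef a k.
Proof. by move=> a1 b0; rewrite /gamma_poisson_pmf /Rintegral gamma_poisson_integral. Qed.

Lemma gamma_poisson_pmf_ge0 a b k : 1 < a -> 0 < b -> 0 <= gamma_poisson_pmf a b k.
Proof.
move=> a1 b0; rewrite gamma_poisson_pmfE// mulr_ge0 ?neg_binomial_coef_ge0//; last by lra.
by rewrite mulr_ge0 ?powR_ge0// exprn_ge0// divr_ge0; lra.
Qed.

(** Gamma-Poisson laws with the same b form a convolution semigroup in a, so
    that the partial sums of the arrivals are again Gamma-Poisson. *)
Lemma gamma_poisson_conv a a' b n : 1 < a -> 1 < a' -> 0 < b ->
  \sum_(i < n.+1) gamma_poisson_pmf a b i * gamma_poisson_pmf a' b (n - i)%N =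
  gamma_poisson_pmf (a + a') b n.
Proof.
move=> a1 a1' b0; have aa' : 1 < a + a' by lra.
rewrite gamma_poisson_pmfE// -neg_binomial_vandermonde big_distrr/=.
apply: eq_bigr => i _; rewrite !gamma_poisson_pmfE//.
rewrite powRD; last by apply/implyP => _; rewrite invr_eq0; lra.
have -> : (b / (1 + b)) ^+ n = (b / (1 + b)) ^+ i * (b / (1 + b)) ^+ (n - i)%N.
  by rewrite -exprD subnKC// -ltnS ltn_ord.
ring.
Qed.

Lemma walk_mean_gamma_poisson a b (s : nat) k (f : R -> \bar R) :
  1 < a -> 0 < b -> (forall u, 0 <= f u)%E ->
  walk_mean (gamma_poisson_pmf a b) (fun j => j%:R - s%:R) k.+1 f =
  (\sum_(j <oo) (gamma_poisson_pmf (k.+1%:R * a) b j)%:E *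
     f (j%:R - (k.+1 * s)%:R)%R)%E.
Proof.
move=> a1 b0; elim: k f => [|k IH] f f0.
  rewrite /walk_mean /= /step_mean; apply: eq_eseriesr => j _.
  by rewrite mul1r mul1n addr0.
have ka1 : 1 < k.+1%:R * a.
  by apply: (lt_le_trans a1); rewrite ler_peMl ?ler1n//; lra.
rewrite /walk_mean iter_meanS /step_mean.
transitivity (\sum_(i <oo) \sum_(j <oo) (gamma_poisson_pmf a b i)%:E *
   ((gamma_poisson_pmf (k.+1%:R * a) b j)%:E * f ((i + j)%:R - (k.+2 * s)%:R)%R))%E.
  apply: eq_eseriesr => i _; rewrite -/(walk_mean _ _) IH// nneseriesZl; last first.
    by move=> *; rewrite mule_ge0 ?lee_fin ?gamma_poisson_pmf_ge0.
  congr (_ * _)%E; apply: eq_eseriesr => j _; congr (_ * f _)%E.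
  by rewrite natrD !natrM -!natr1; ring.
rewrite nneseries_antidiagonal; last first.
  by move=> *; rewrite !mule_ge0 ?lee_fin ?gamma_poisson_pmf_ge0.
apply: eq_eseriesr => n _.
transitivity (\sum_(i < n.+1) (gamma_poisson_pmf a b i *
    gamma_poisson_pmf (k.+1%:R * a) b (n - i)%N)%:E * f (n%:R - (k.+2 * s)%:R)%R)%E.
  apply: eq_bigr => i _; rewrite muleA -EFinM subnKC//.
  by rewrite -ltnS ltn_ord.
rewrite -ge0_sume_distrl; last first.
  by move=> i _; rewrite lee_fin mulr_ge0 ?gamma_poisson_pmf_ge0.
rewrite sumEFin (gamma_poisson_conv _ a1 ka1 b0).
have -> : k.+2%:R = 1 + k.+1%:R :> R by rewrite nat1r.
by rewrite mulrDl mul1r.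
Qed.

Definition poisson_mean x (g : nat -> \bar R) : \bar R :=
  (\sum_(j <oo) (poisson_pmf x j)%:E * g j)%E.

Lemma measurable_poisson_mean (E : set R) (g : nat -> \bar R) : measurable E ->
  (forall j, 0 <= g j)%E -> measurable_fun E (poisson_mean ^~ g).
Proof.
move=> mE g0; apply: ge0_emeasurable_sum.
  by move=> k x _ _; rewrite mule_ge0 ?lee_fin ?poisson_pmf_ge0.
move=> k _; apply: emeasurable_funM; last exact: measurable_cst.
by apply/measurable_EFinP; exact: measurable_poisson_pmf.
Qed.

Lemma gamma_poisson_mixture a b (g : nat -> \bar R) :
  1 < a -> 0 < b -> (forall j, 0 <= g j)%E ->
  (\sum_(j <oo) (gamma_poisson_pmf a b j)%:E * g j =
   \int[mu]_(x in D) (poisson_mean x g * (gamma_pdf a b^-1 x)%:E))%E.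
Proof.
move=> a1 b0 g0.
have mpg j : measurable_fun D (fun x => (poisson_pmf x j * gamma_pdf a b^-1 x)%:E).
  rewrite (_ : (fun x => _) = (fun x => (poisson_pmf x j)%:E * (gamma_pdf a b^-1 x)%:E)%E); last first.
    by apply/funext => x; rewrite -EFinM.
  apply: emeasurable_funM; last exact: measurable_gamma_pdf.
  by apply/measurable_EFinP; exact: measurable_poisson_pmf.
have pg0 j x : D x -> (0 <= (poisson_pmf x j * gamma_pdf a b^-1 x)%:E)%E.
  rewrite /= in_itv/= andbT => x0.
  by rewrite lee_fin mulr_ge0 ?poisson_pmf_ge0 ?gamma_pdf_ge0.
transitivity (\int[mu]_(x in D) \sum_(j <oo)
   ((poisson_pmf x j * gamma_pdf a b^-1 x)%:E * g j))%E.
  rewrite integral_nneseries//.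
  - apply: eq_eseriesr => j _; rewrite ge0_integralZr//; try exact: mpg; try exact: pg0.
    by rewrite gamma_poisson_integral// gamma_poisson_pmfE.
  - by move=> j; apply: emeasurable_funM; [exact: mpg|exact: measurable_cst].
  - by move=> j x Dx; rewrite mule_ge0// pg0.
apply: eq_integral => x /set_mem Dx; rewrite /poisson_mean muleC.
have x0 : 0 < x by move: Dx; rewrite /= in_itv/= andbT.
rewrite -nneseriesZl; last by move=> *; rewrite mule_ge0 ?lee_fin ?poisson_pmf_ge0.
by apply: eq_eseriesr => j _; rewrite EFinM [X in (X * _)%E]muleC -muleA.
Qed.

Lemma poisson_mean_exp x z : 0 < x -> 0 <= z ->
  poisson_mean x (fun j => (z ^+ j)%:E) = (expR (x * (z - 1)))%:E.
Proof.
move=> x0 z0; rewrite /poisson_mean.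
have xz0 : 0 <= x * z by rewrite mulr_ge0 ?(ltW x0).
transitivity (\sum_(j <oo) ((expR (- x))%:E * (exp_coeff (x * z) j)%:E))%E.
  apply: eq_eseriesr => j _; rewrite -!EFinM /poisson_pmf x0 /exp_coeff /= exprMn.
  by congr EFin; ring.
rewrite nneseriesZl; last by move=> j _; rewrite lee_fin exp_coeff_ge0.
have -> : (\sum_(j <oo) (exp_coeff (x * z) j)%:E = (expR (x * z))%:E)%E.
  rewrite /expR -EFin_lim; last exact: is_cvg_series_exp_coeff.
  by apply/congr_lim/funext => n /=; rewrite sumEFin.
by rewrite -EFinM -expRD; congr (expR _)%:E; ring.
Qed.

Lemma gamma_poisson_pgf a b z : 1 < a -> 0 < b -> 0 <= z -> b * (z - 1) < 1 ->
  (\sum_(j <oo) (gamma_poisson_pmf a b j)%:E * (z ^+ j)%:E =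
   ((1 - b * (z - 1))^-1 `^ a)%:E)%E.
Proof.
move=> a1 b0 z0 bz; have bi : 0 < b^-1 by rewrite invr_gt0.
rewrite gamma_poisson_mixture//; last by move=> j; rewrite lee_fin exprn_ge0.
have zb : z - 1 < b^-1 by rewrite -(ltr_pM2l b0) mulfV ?gt_eqF.
transitivity (\int[mu]_(x in D)
    ((x ^+ 0 * expR (- ((1 - z) * x))) * gamma_pdf a b^-1 x)%:E)%E.
  apply: eq_integral => x; rewrite inE/= in_itv/= andbT => x0.
  rewrite poisson_mean_exp// -EFinM expr0 mul1r; congr (expR _ * _)%:E; ring.
rewrite integral_tilted_gamma//; last by lra.
rewrite big_ord0 mul1r addr0 -powRM ?(ltW bi)//; last by rewrite invr_ge0; lra.
congr (_ `^ _)%:E; field; lra.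
Qed.

End GammaPoisson.

(** * An exponential bound that is uniform in the parameters *)

Section Chernoff.
Context {R : realType}.
Implicit Types a b x y z beta : R.

Lemma expR_le_quadratic x : 0 <= x <= 2^-1 -> expR x - 1 <= x + 2 * x ^+ 2.
Proof.
move=> /andP[x0 x2].
have h : 1 - x <= expR (- x) by have := expR_ge1Dx (- x); lra.
have e0 := expR_gt0 x.
have h2 : (1 - x) * expR x <= 1.
  apply: (@le_trans _ _ (expR (- x) * expR x)); first by rewrite ler_wpM2r// ltW.
  by rewrite mulrC expRxMexpNx_1.
have h3 : 1 <= (1 - x) * (1 + x + 2 * x ^+ 2).
  have -> : (1 - x) * (1 + x + 2 * x ^+ 2) = 1 + x ^+ 2 * (1 - 2 * x) by ring.
  by rewrite lerDl mulr_ge0 ?sqr_ge0//; lra.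
suff : expR x <= 1 + x + 2 * x ^+ 2 by lra.
by rewrite -(@ler_pM2l _ (1 - x)); lra.
Qed.

Lemma ln_1B_ge x : 0 <= x <= 2^-1 -> - (x + 2 * x ^+ 2) <= ln (1 - x).
Proof.
move=> /andP[x0 x2].
have y0 : 0 < 1 - x by lra.
have h : ln ((1 - x)^-1) <= x / (1 - x).
  have E : (1 - x)^-1 = 1 + x / (1 - x) by field; lra.
  by rewrite [X in ln X]E; apply: le_ln1Dx; rewrite (@lt_le_trans _ _ 0)// divr_ge0// ltW.
rewrite lnV ?posrE// in h.
suff : x / (1 - x) <= x + 2 * x ^+ 2 by lra.
rewrite ler_pdivrMr//.
have -> : (x + 2 * x ^+ 2) * (1 - x) = x + x ^+ 2 * (1 - 2 * x) by ring.
by rewrite lerDl mulr_ge0 ?sqr_ge0//; lra.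
Qed.

(** For t = beta / (16 sigma) the logarithm of the mean of exp(t (A - s)) is
    - t beta sigma up to a multiple of (t sigma)^2, so it is of order beta^2
    whatever a and b; the constant 16 makes it at most - beta^2 / 32. The
    condition on a keeps 4 b t <= 1, where the quadratic bounds on exp and ln
    apply. *)
Lemma gamma_poisson_chernoff a b beta (s : nat) :
  1 < a -> 1 <= b -> 0 < beta -> beta ^+ 2 / 16 <= a ->
  let sigma := Num.sqrt (a * b * (b + 1)) in
  s%:R = a * b + beta * sigma ->
  exists2 rho, 0 <= rho <= expR (- (beta ^+ 2 / 32)) &
  step_mean (gamma_poisson_pmf a b) (fun j => j%:R - s%:R)
    (fun u => (expR (beta / 16 / sigma * u))%:E) = rho%:E.
Proof.
move=> a1 b1 beta0 abeta sigma sE.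
have a0 : 0 < a by lra.
have b0 : 0 < b by lra.
have abb : 0 < a * b * (b + 1) by rewrite !mulr_gt0//; lra.
have sg0 : 0 < sigma by rewrite sqrtr_gt0.
have sg2 : sigma ^+ 2 = a * b * (b + 1) by rewrite sqr_sqrtr// ltW.
pose t := beta / 16 / sigma.
have t0 : 0 < t by rewrite !divr_gt0.
have tsg : t * sigma = beta / 16 by rewrite /t divfK// gt_eqF.
have bt : 4 * b * t <= 1.
  have h : (4 * b * t) ^+ 2 <= 1.
    have E : 4 * b * t * sigma = 4 * b * (beta / 16) by rewrite -mulrA tsg.
    rewrite -(@ler_pM2r _ (sigma ^+ 2)) ?exprn_gt0// mul1r -exprMn E sg2.
    have -> : (4 * b * (beta / 16)) ^+ 2 = beta ^+ 2 / 16 * (b * b) by field.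
    apply: (@le_trans _ _ (a * (b * b))); first by rewrite ler_wpM2r// mulr_ge0// ltW.
    by rewrite -mulrA ler_wpM2l ?(ltW a0)// ler_wpM2l ?(ltW b0)//; lra.
  have bt0 : 0 <= 4 * b * t by apply: mulr_ge0; [apply: mulr_ge0; [|exact: ltW]|exact: ltW].
  by move: h; rewrite -[X in _ <= X -> _](expr1n _ 2) ler_pXn2r ?nnegrE.
have t4 : 4 * t <= 1.
  by apply: le_trans bt; rewrite ler_wpM2r ?(ltW t0)//; lra.
pose z := expR t; pose u := b * (z - 1).
have z1 : 0 <= z - 1 by rewrite subr_ge0 -[leLHS]expR0 ler_expR ltW.
have z1' : z - 1 <= t + 2 * t ^+ 2 by apply: expR_le_quadratic; lra.
have tt : t ^+ 2 * 4 <= t.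
  by rewrite expr2 -mulrA -[leRHS]mulr1 ler_wpM2l ?(ltW t0)//; lra.
have u0 : 0 <= u by rewrite mulr_ge0// ltW.
have u2 : u <= 2 * b * t.
  rewrite /u (mulrC 2) -mulrA ler_wpM2l ?(ltW b0)//.
  by apply: (le_trans z1'); lra.
have u12 : 0 <= u <= 2^-1 by rewrite u0/=; lra.
have u1 : 0 < 1 - u by lra.
exists (expR (- (t * s%:R)) * (1 - u)^-1 `^ a); last first.
  rewrite /step_mean EFinM -(gamma_poisson_pgf (z := z))//; last 2 first.
  - exact: expR_ge0.
  - by rewrite -/u; lra.
  rewrite -nneseriesZl; last first.
    by move=> j _; rewrite mule_ge0// lee_fin ?gamma_poisson_pmf_ge0// exprn_ge0// expR_ge0.
  apply: eq_eseriesr => j _; rewrite -!EFinM mulrCA; congr (_ * _)%:E.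
  by rewrite /z -expRM_natr -expRD; congr expR; rewrite -/t; ring.
rewrite mulr_ge0 ?expR_ge0 ?powR_ge0//=.
rewrite /powR gt_eqF ?invr_gt0// -expRD ler_expR lnV ?posrE//.
have lnu := ln_1B_ge u12.
have au : a * - ln (1 - u) <= a * (u + 2 * u ^+ 2) by rewrite ler_wpM2l ?(ltW a0)//; lra.
have au1 : a * u <= a * (b * (t + 2 * t ^+ 2)).
  by rewrite ler_wpM2l ?(ltW a0)// ler_wpM2l ?(ltW b0).
have au2 : a * u ^+ 2 <= a * (2 * b * t) ^+ 2.
  by rewrite ler_wpM2l ?(ltW a0)// lerXn2r// ?nnegrE// (le_trans u0).
have tsE : t * s%:R = t * (a * b) + beta ^+ 2 / 16.
  by rewrite sE mulrDr [t * (beta * sigma)]mulrCA tsg; ring.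
have tq : 2 * (a * b * t ^+ 2) + 8 * (a * b ^+ 2 * t ^+ 2) <= beta ^+ 2 / 32.
  apply: (@le_trans _ _ (8 * (t * sigma) ^+ 2)); last by rewrite tsg; lra.
  rewrite [(t * sigma) ^+ 2]exprMn sg2.
  have -> : 8 * (t ^+ 2 * (a * b * (b + 1))) =
     2 * (a * b * t ^+ 2) + 8 * (a * b ^+ 2 * t ^+ 2) + 6 * (a * b * t ^+ 2) by ring.
  by rewrite lerDl mulr_ge0// mulr_ge0 ?sqr_ge0// mulr_ge0 ?(ltW a0) ?(ltW b0).
have -> : - (beta ^+ 2 / 32) = beta ^+ 2 / 32 - beta ^+ 2 / 16 by field.
rewrite tsE; lra.
Qed.

Lemma gamma_poisson_mass a b (s : nat) : 1 < a -> 0 < b ->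
  step_mean (gamma_poisson_pmf a b) (fun j => j%:R - s%:R) (fun=> 1%E) = 1%E.
Proof.
move=> a1 b0; have h := @gamma_poisson_pgf R a b 1 a1 b0 ler01.
rewrite subrr mulr0 subr0 invr1 powR1 in h.
rewrite /step_mean -[RHS]h ?ltr01//.
by apply: eq_eseriesr => j _; rewrite expr1n.
Qed.

Lemma gamma_poisson_exp_moment a b theta rho (s : nat) : 1 < a -> 0 < b ->
  0 < theta ->
  step_mean (gamma_poisson_pmf a b) (fun j => j%:R - s%:R)
    (fun u => (expR (theta * u))%:E) = rho%:E ->
  exists m, step_mean (gamma_poisson_pmf a b) (fun j => j%:R - s%:R)
    (fun u => (expR (theta * `|u|))%:E) = m%:E.
Proof.
move=> a1 b0 th0 rhoE.
set X := step_mean _ _ _.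
have p0 j : 0 <= gamma_poisson_pmf a b j by exact: gamma_poisson_pmf_ge0.
have X0 : (0 <= X)%E by apply: step_mean_ge0 => // u; rewrite lee_fin expR_ge0.
exists (fine X); rewrite fineK// ge0_fin_numE//.
apply: (@le_lt_trans _ _ (rho%:E + (expR (theta * s%:R))%:E * 1)%E); last first.
  by rewrite mule1 -EFinD ltry.
rewrite -(gamma_poisson_mass s a1 b0) -rhoE -step_meanZ ?expR_ge0//.
rewrite -step_meanD//; try by move=> *; rewrite ?mule1 lee_fin expR_ge0.
rewrite /X /step_mean; apply: lee_nneseries => j *.
  by rewrite mule_ge0 ?lee_fin ?expR_ge0.
apply: lee_wpmul2l; first by rewrite lee_fin.
rewrite mule1 -EFinD lee_fin.
have [u0|u0] := leP 0 (j%:R - s%:R : R).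
  by rewrite ger0_norm// lerDl expR_ge0.
rewrite ltr0_norm//; apply: ler_wpDl; first exact: expR_ge0.
rewrite ler_expR ler_wpM2l ?(ltW th0)// opprB gerDl oppr_le0.
exact: ler0n.
Qed.

End Chernoff.

Section PoissonMoments.
Context {R : realType}.
Implicit Types (x c : R).

Lemma poisson_mean_le x (g h : nat -> \bar R) : (forall j, 0 <= g j)%E ->
  (forall j, g j <= h j)%E -> (poisson_mean x g <= poisson_mean x h)%E.
Proof.
move=> g0 gh; apply: lee_nneseries => j *.
  by rewrite mule_ge0// lee_fin poisson_pmf_ge0.
by rewrite lee_wpmul2l// lee_fin poisson_pmf_ge0.
Qed.

Lemma poisson_mean_ge0 x (g : nat -> \bar R) : (forall j, 0 <= g j)%E ->
  (0 <= poisson_mean x g)%E.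
Proof.
by move=> g0; apply: nneseries_ge0 => j _ _; rewrite mule_ge0// lee_fin poisson_pmf_ge0.
Qed.

Lemma poisson_meanD x (g h : nat -> \bar R) : (forall j, 0 <= g j)%E ->
  (forall j, 0 <= h j)%E ->
  poisson_mean x (fun j => g j + h j)%E = (poisson_mean x g + poisson_mean x h)%E.
Proof.
move=> g0 h0; rewrite /poisson_mean -nneseriesD.
- by apply: eq_eseriesr => j _; rewrite ge0_muleDr.
- by move=> *; rewrite mule_ge0// lee_fin poisson_pmf_ge0.
- by move=> *; rewrite mule_ge0// lee_fin poisson_pmf_ge0.
Qed.

Lemma poisson_meanZ x c (g : nat -> \bar R) : 0 <= c -> (forall j, 0 <= g j)%E ->
  poisson_mean x (fun j => c%:E * g j)%E = (c%:E * poisson_mean x g)%E.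
Proof.
move=> c0 g0; rewrite /poisson_mean -nneseriesZl.
  by apply: eq_eseriesr => j _; rewrite muleCA.
by move=> *; rewrite mule_ge0// lee_fin poisson_pmf_ge0.
Qed.

Lemma poisson_mean_cst x c : 0 < x -> 0 <= c -> poisson_mean x (fun=> c%:E) = c%:E.
Proof.
move=> x0 c0; have := poisson_mean_exp x0 ler01.
rewrite subrr mulr0 expR0.
have -> : (fun j => (1 ^+ j)%:E) = (fun=> 1%E) :> (nat -> \bar R).
  by apply/funext => j; rewrite expr1n.
move=> h; rewrite -[RHS]mule1 -h -poisson_meanZ//.
by congr poisson_mean; apply/funext => j; rewrite mule1.
Qed.

(** E[N g(N - 1)] = x E[g(N)] characterizes the Poisson law, and gives its
    factorial moments. *)
Lemma poisson_mean_shift x (g : nat -> \bar R) : 0 < x -> (forall j, 0 <= g j)%E ->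
  poisson_mean x (fun j => j%:R%:E * g j.-1)%E = (x%:E * poisson_mean x g)%E.
Proof.
move=> x0 g0; rewrite /poisson_mean nneseries_recl//; last first.
  by move=> j _; rewrite !mule_ge0// lee_fin poisson_pmf_ge0.
rewrite mul0e mule0 add0e -(nneseries_addn 1
   (f := fun j => (poisson_pmf x j)%:E * (j%:R%:E * g j.-1))%E); last first.
  by move=> j; rewrite !mule_ge0// lee_fin poisson_pmf_ge0.
rewrite -nneseriesZl; last by move=> *; rewrite mule_ge0// lee_fin poisson_pmf_ge0.
apply: eq_eseriesr => j _; rewrite addn1/= !muleA -!EFinM; congr (_%:E * _)%E.
have h1 : j.+1%:R != 0 :> R by [].
have h2 : j`!%:R != 0 :> R by rewrite pnatr_eq0 -lt0n fact_gt0.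
rewrite /poisson_pmf x0 factS natrM exprS.
move: (j.+1%:R : R) (j`!%:R : R) h1 h2 => N F h1 h2.
by field; rewrite h1 h2.
Qed.

Lemma poisson_second_moment x c : 0 < x ->
  poisson_mean x (fun j => ((j%:R - c) ^+ 2)%:E) = (x + (x - c) ^+ 2)%:E.
Proof.
move=> x0.
have m1 : poisson_mean x (fun j => j%:R%:E) = x%:E.
  transitivity (poisson_mean x (fun j => j%:R%:E * 1)%E).
    by congr poisson_mean; apply/funext => j; rewrite mule1.
  rewrite (poisson_mean_shift (g := fun=> 1%E) x0)//.
  by rewrite (poisson_mean_cst x0 ler01) mule1.
have m2 : poisson_mean x (fun j => j%:R%:E * (j.-1)%:R%:E)%E = (x ^+ 2)%:E.
  by rewrite (poisson_mean_shift (g := fun j => j%:R%:E) x0)// m1 -EFinM expr2.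
have E (j : nat) : (j%:R - c) ^+ 2 = j%:R * j.-1%:R + j%:R + c ^+ 2 - 2 * c * j%:R.
  by case: j => [|j]; rewrite ?mul0r/= -?natr1; ring.
(* The means are defined for nonnegative functions, so the cross term of the
   square is moved to the other side unless its sign is already positive. *)
have [c0|c0] := leP 0 c.
  have : (poisson_mean x (fun j => ((j%:R - c) ^+ 2)%:E) + (2 * c * x)%:E =
      (x ^+ 2 + x + c ^+ 2)%:E)%E.
    rewrite EFinM -m1 -poisson_meanZ ?mulr_ge0// -poisson_meanD//; last 2 first.
    - by move=> j; rewrite lee_fin sqr_ge0.
    - by move=> j; rewrite -EFinM lee_fin !mulr_ge0.
    transitivity (poisson_mean x
        (fun j => j%:R%:E * j.-1%:R%:E + j%:R%:E + (c ^+ 2)%:E)%E).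
      congr poisson_mean; apply/funext => j.
      by rewrite -!EFinM -!EFinD E; congr EFin; ring.
    rewrite !poisson_meanD//; last 2 first.
    - by move=> j; rewrite adde_ge0 ?mule_ge0 ?lee_fin.
    - by move=> j; rewrite lee_fin sqr_ge0.
    by rewrite m1 m2 poisson_mean_cst ?sqr_ge0.
  case: (poisson_mean x _) => //= r; rewrite -EFinD => -[] h; congr EFin.
  by apply: (addIr (2 * c * x)); rewrite h; ring.
have c0' : 0 <= 1 - 2 * c by lra.
have -> : x + (x - c) ^+ 2 = x ^+ 2 + (1 - 2 * c) * x + c ^+ 2 by ring.
transitivity (poisson_mean x (fun j => j%:R%:E * j.-1%:R%:E +
    (1 - 2 * c)%:E * j%:R%:E + (c ^+ 2)%:E)%E).
  congr poisson_mean; apply/funext => j.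
  by rewrite -!EFinM -!EFinD E; congr EFin; ring.
rewrite !poisson_meanD//; last 3 first.
- by move=> j; rewrite mule_ge0 ?lee_fin.
- by move=> j; rewrite adde_ge0 ?mule_ge0 ?lee_fin.
- by move=> j; rewrite lee_fin sqr_ge0.
by rewrite poisson_meanZ// m1 m2 poisson_mean_cst ?sqr_ge0.
Qed.

End PoissonMoments.

(** * The standardized Gamma density *)

Section GammaWeight.
Context {R : realType}.
Local Notation mu := (@lebesgue_measure R).
Implicit Types (al u y : R).

(** With p = sqrt (1 + u), the bound ln (1 + u) = 2 ln p <= 2 (p - 1) gains a
    quadratic term over ln (1 + u) <= u. *)
Lemma ln1D_le_quadratic u : -1 < u -> ln (1 + u) <= u - u ^+ 2 / (2 * (2 + u)).
Proof.
move=> u1; have u10 : 0 < 1 + u by lra.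
pose p := Num.sqrt (1 + u).
have p0 : 0 < p by rewrite sqrtr_gt0.
have pE : 1 + u = p ^+ 2 by rewrite sqr_sqrtr// ltW.
have uE : u = p ^+ 2 - 1 by rewrite -pE; ring.
have lnp : ln p <= p - 1.
  have -> : p = 1 + (p - 1) by ring.
  by rewrite addrC addrK; have := @le_ln1Dx R (p - 1); rewrite (addrC 1) subrK; apply; lra.
rewrite pE lnXn// mulr2n.
have -> : u - u ^+ 2 / (2 * (2 + u)) = 2 * (p - 1) +
   (p - 1) ^+ 2 * ((p - 1) ^+ 2 / (2 * (1 + p ^+ 2))).
  by rewrite uE; field; rewrite gt_eqF// ltr_pwDl// sqr_ge0.
suff : 0 <= (p - 1) ^+ 2 * ((p - 1) ^+ 2 / (2 * (1 + p ^+ 2))) by lra.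
by rewrite mulr_ge0 ?sqr_ge0// divr_ge0 ?sqr_ge0// mulr_ge0// addr_ge0// sqr_ge0.
Qed.

Lemma ln1D_taylor2 u : `|u| <= 2^-1 ->
  `|ln (1 + u) - u + u ^+ 2 / 2| <= 2 * `|u| ^+ 3.
Proof.
move=> u2; pose F (t : R) := ln (1 + t) - t + t ^+ 2 / 2.
have dF (t : R) : -1 < t -> is_derive t 1 F (t ^+ 2 / (1 + t)).
  move=> t1; have t10 : 0 < 1 + t by lra.
  have dln : is_derive t 1 (fun t : R => ln (1 + t)) (1 + t)^-1.
    have h1 : is_derive t (1 : R) (fun t : R => 1 + t) 1.
      apply: DeriveDef; first by apply: derivableD.
      by rewrite deriveD// derive_cst derive_id add0r.
    have h2 := is_derive1_ln t10.
    have := is_derive1_comp h2 h1; by rewrite mulr1.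
  have -> : t ^+ 2 / (1 + t) = (1 + t)^-1 - 1 + t by field; lra.
  by apply: is_derive_eq; rewrite /GRing.scale/=; field; lra.
have F0 : F 0 = 0 by rewrite /F addr0 ln1 subr0 expr0n/= mul0r addr0.
have bound (t : R) : `|t| <= `|u| -> `|t ^+ 2 / (1 + t)| <= 2 * `|u| ^+ 2.
  move=> tu; have t12 : 2^-1 <= 1 + t.
    have := ler_norm (- t); rewrite normrN; lra.
  rewrite normrM normfV [`|1 + t|]ger0_norm; last by lra.
  rewrite ler_pdivrMr; last by lra.
  rewrite normrX.
  have h2 : `|t| ^+ 2 <= `|u| ^+ 2 by rewrite lerXn2r ?nnegrE.
  apply: (le_trans h2); rewrite -mulrA mulrCA -[leLHS]mulr1.
  by apply: ler_wpM2l; [exact: sqr_ge0|lra].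
have cF (t : R) : -1 < t -> {for t, continuous F}.
  move=> t1; apply: differentiable_continuous; apply/derivable1_diffP.
  by have [] := dF t t1.
have [u0|u0|u0] := ltgtP 0 u; last 1 first.
- by rewrite -u0 addr0 ln1 subr0 expr0n/= mul0r addr0 normr0 mulr_ge0.
- have um : `|u| = u by rewrite gtr0_norm.
  have dFi (t : R) : t \in `]0, u[ -> is_derive t 1 F (t ^+ 2 / (1 + t)).
    by rewrite in_itv/= => /andP[t0 _]; apply: dF; lra.
  have cFi : {within `[0, u], continuous F}.
    apply: continuous_in_subspaceT => t; rewrite inE/= in_itv/= => /andP[t0 _].
    by apply: cF; lra.
  have [c + E] := MVT u0 dFi cFi.
  rewrite in_itv/= => /andP[c0 cu].
  rewrite F0 !subr0 in E.
  rewrite -/(F u) E normrM [_ ^+ 3]exprSr mulrA; apply: ler_wpM2r => //.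
  by apply: bound; rewrite !gtr0_norm// ltW.
- have um : `|u| = - u by rewrite ltr0_norm.
  have dFi (t : R) : t \in `]u, 0[ -> is_derive t 1 F (t ^+ 2 / (1 + t)).
    by rewrite in_itv/= => /andP[t0 _]; apply: dF; lra.
  have cFi : {within `[u, 0], continuous F}.
    apply: continuous_in_subspaceT => t; rewrite inE/= in_itv/= => /andP[t0 _].
    by apply: cF; lra.
  have [c + E] := MVT u0 dFi cFi.
  rewrite in_itv/= => /andP[cu c0].
  rewrite F0 !sub0r mulrN in E.
  rewrite -/(F u) (oppr_inj E) normrM [_ ^+ 3]exprSr mulrA; apply: ler_wpM2r => //.
  by apply: bound; rewrite !ltr0_norm//; lra.
Qed.

(** Up to a constant, the density at y of (X - al) / sqrt al, X being Gamma
    distributed with shape al and rate 1. *)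
Definition gamma_weight al y : R :=
  if -1 < y / Num.sqrt al then
    expR ((al - 1) * ln (1 + y / Num.sqrt al) - Num.sqrt al * y) else 0.

Lemma gamma_weight_ge0 al y : 0 <= gamma_weight al y.
Proof. by rewrite /gamma_weight; case: ifP => // _; exact: expR_ge0. Qed.

Lemma measurable_gamma_weight al : measurable_fun setT (gamma_weight al).
Proof.
have mu' : measurable_fun setT (fun y : R => y / Num.sqrt al) by exact: measurable_funM.
apply: measurable_fun_ifT => //; first exact: measurable_fun_ltr.
apply: measurableT_comp => //; apply: measurable_funB; last exact: measurable_funM.
apply: measurable_funM => //; apply: measurableT_comp => //.
exact: measurable_funD.
Qed.

(** The quadratic gain in the bound on ln (1 + u) is what makes this bound
    integrable and independent of al. *)
Lemma gamma_weight_le al y : 2 <= al ->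
  gamma_weight al y <= expR (3 / 2 - `|y| / 4).
Proof.
move=> al2; rewrite /gamma_weight; case: ifPn => [u1|_]; last exact: expR_ge0.
pose r := Num.sqrt al; rewrite -/r in u1 *.
have r2 : r ^+ 2 = al by rewrite sqr_sqrtr//; lra.
have r1 : 1 <= r by rewrite -[leLHS](@sqrtr1 R) ler_sqrt//; lra.
have r0 : 0 < r by lra.
pose u := y / r; rewrite -/u in u1 *.
have yE : y = u * r by rewrite /u divfK// gt_eqF.
have ryE : r * y = al * u by rewrite yE -r2; ring.
rewrite ler_expR ryE.
have h := ln1D_le_quadratic u1.
have hal : (al - 1) * ln (1 + u) <= (al - 1) * (u - u ^+ 2 / (2 * (2 + u))).
  by rewrite ler_wpM2l//; lra.
have uy : `|u| <= `|y|.
  have -> : `|y| = `|u| * r by rewrite -[X in _ * X]ger0_norm ?(ltW r0)// -normrM -yE.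
  by rewrite -[leLHS]mulr1; apply: ler_wpM2l.
have un : u <= `|u| := ler_norm u.
have key : (`|y| - 2) / 4 <= (al - 1) * (u ^+ 2 / (2 * (2 + u))).
  have h1 : (al / 2) * (u ^+ 2 / (2 * (2 + `|y|))) <= (al - 1) * (u ^+ 2 / (2 * (2 + u))).
    apply: ler_pM; [lra| |lra|].
      by rewrite divr_ge0 ?sqr_ge0// mulr_ge0// addr_ge0.
    rewrite ler_wpM2l ?sqr_ge0// lef_pV2 ?posrE; first by lra.
      by rewrite mulr_gt0// ltr_pwDl.
    by lra.
  apply: le_trans h1.
  have -> : al / 2 * (u ^+ 2 / (2 * (2 + `|y|))) = `|y| ^+ 2 / (4 * (2 + `|y|)).
    rewrite real_normK ?num_real// yE -r2; field.
    by rewrite gt_eqF// ltr_pwDl.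
  rewrite ler_pdivlMr; last by rewrite mulr_gt0// ltr_pwDl.
  have -> : (`|y| - 2) / 4 * (4 * (2 + `|y|)) = `|y| ^+ 2 - 4 by field.
  lra.
lra.
Qed.

Lemma cvg_gamma_weight (al : nat -> R) y : al @ \oo --> +oo ->
  gamma_weight (al n) y @[n --> \oo] --> expR (- (y ^+ 2 / 2)).
Proof.
move=> aloo; pose r n := Num.sqrt (al n); pose u n := y / r n.
pose E n := (al n - 1) * ln (1 + u n) - r n * y.
have rinv0 : (r n)^-1 @[n --> \oo] --> (0 : R).
  apply/cvgrPdist_lt => e e0; near=> n.
  have al0 : e^-1 ^+ 2 < al n by near: n; move/cvgryPgt : aloo; apply.
  have rn : e^-1 < r n.
    rewrite /r -[e^-1]gtr0_norm ?invr_gt0// -sqrtr_sqr ltr_sqrt//.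
    by rewrite (le_lt_trans _ al0)// sqr_ge0.
  have r0 : 0 < r n by rewrite (le_lt_trans _ rn)// invr_ge0 ltW.
  by rewrite sub0r normrN gtr0_norm ?invr_gt0// invf_plt ?posrE.
have u0 : u n @[n --> \oo] --> (0 : R).
  by rewrite -[X in _ --> X](mulr0 y); apply: cvgM => //; exact: cvg_cst.
have un0 : `|u n| @[n --> \oo] --> (0 : R).
  by rewrite -(@normr0 _ R); apply: cvg_norm.
have u12 : \forall n \near \oo, `|u n| <= 2^-1.
  have /cvgrPdist_le/(_ 2^-1) h := un0.
  have h2 : (0 : R) < 2^-1 by rewrite invr_gt0.
  by apply: filterS (h h2) => n; rewrite sub0r normrN normr_id.
have Elim : E n @[n --> \oo] --> - (y ^+ 2 / 2).
  apply/subr_cvg0; apply: norm_cvg0.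
  apply: (@squeeze_cvgr _ _ _ _ (cst 0) (fun n => (2 * y ^+ 2 + 2) * `|u n|)); last 2 first.
  - exact: cvg_cst.
  - by rewrite -[X in _ --> X](mulr0 (2 * y ^+ 2 + 2)); apply: cvgM => //; exact: cvg_cst.
  near=> n; rewrite /= normr_ge0/=.
  have al1 : 1 < al n by near: n; move/cvgryPgt : aloo; apply.
  have r0 : 0 < r n by rewrite sqrtr_gt0; lra.
  have r2 : r n ^+ 2 = al n by rewrite sqr_sqrtr//; lra.
  have yE : y = u n * r n by rewrite /u divfK// gt_eqF.
  have uh : `|u n| <= 2^-1 by near: n.
  have T := ln1D_taylor2 uh.
  set T0 := ln (1 + u n) - u n + u n ^+ 2 / 2 in T.
  have -> : E n - - (y ^+ 2 / 2) = al n * T0 - ln (1 + u n).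
    by rewrite /E /T0 yE -r2; field.
  have lnb : `|ln (1 + u n)| <= 2 * `|u n|.
    have -> : ln (1 + u n) = T0 + u n - u n ^+ 2 / 2 by rewrite /T0; ring.
    apply: (le_trans (ler_normB _ _)).
    have h1 := ler_normD T0 (u n).
    rewrite [`|_ ^+ 2 / 2|]ger0_norm ?divr_ge0 ?sqr_ge0//.
    rewrite -(real_normK (num_real (u n))).
    have h0 := normr_ge0 (u n); move: (`|u n|) uh h0 T h1 => v *; nra.
  have alT : `|al n * T0| <= 2 * y ^+ 2 * `|u n|.
    rewrite normrM ger0_norm; last by lra.
    have -> : 2 * y ^+ 2 * `|u n| = al n * (2 * `|u n| ^+ 3).
      rewrite {1}yE exprMn r2 -(real_normK (num_real (u n))); ring.
    by rewrite ler_wpM2l//; lra.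
  apply: (le_trans (ler_normB _ _)); lra.
have expElim : expR (E n) @[n --> \oo] --> expR (- (y ^+ 2 / 2)).
  by apply: continuous_cvg; [exact: continuous_expR|exact: Elim].
apply: cvg_trans expElim; apply: near_eq_cvg; near=> n.
have uh : `|u n| <= 2^-1 by near: n.
have : - u n <= 2^-1 by apply: le_trans uh; rewrite -normrN ler_norm.
by rewrite /gamma_weight -/(r n) -/(u n) => h; rewrite ifT//; lra.
Unshelve. all: by end_near. Qed.

End GammaWeight.

(** * Concentration of the Poisson mixture *)

Section GaussianLimit.
Context {R : realType}.
Local Notation mu := (@lebesgue_measure R).
Local Notation D := (`]0, +oo[%classic : set R).
Implicit Types (a b al beta : R).

(** Substituting x = b (al + sqrt al * y) in the Gamma mixture of Poisson laws. *)
Lemma gamma_poisson_weighted al b : 1 < al -> 0 < b ->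
  exists2 c : R, 0 < c & forall g : nat -> \bar R, (forall j, 0 <= g j)%E ->
  (\sum_(j <oo) (gamma_poisson_pmf al b j)%:E * g j =
   c%:E * \int[mu]_y (poisson_mean (b * (al + Num.sqrt al * y))%R g *
                      (gamma_weight al y)%:E))%E.
Proof.
move=> al1 b0; have al0 : 0 < al by lra.
pose r := Num.sqrt al; have r0 : 0 < r by rewrite sqrtr_gt0.
have r2 : r ^+ 2 = al by rewrite sqr_sqrtr// ltW.
have br0 : 0 < b * r by rewrite mulr_gt0.
have bal0 : 0 < b * al by rewrite mulr_gt0.
pose C := b^-1 `^ al / gamma_fun al * (b * al) `^ (al - 1) * expR (- al).
have C0 : 0 < C.
  rewrite !mulr_gt0 ?expR_gt0 ?powR_gt0 ?invr_gt0//.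
  by apply: gamma_fun_gt0; exact: ltW.
have pdfE y : -1 < y / r ->
    gamma_pdf al b^-1 (b * r * y + b * al) = C * gamma_weight al y.
  move=> u1; have u10 : 0 < 1 + y / r by lra.
  have E : b * r * y + b * al = b * al * (1 + y / r).
    by rewrite -r2; field; rewrite gt_eqF.
  rewrite /gamma_weight -/r u1 /gamma_pdf E powRM ?(ltW bal0) ?(ltW u10)//.
  rewrite [(1 + y / r) `^ _]/powR gt_eqF// expRD.
  have -> : expR (- (b^-1 * (b * al * (1 + y / r)))) = expR (- al) * expR (- (r * y)).
    by rewrite -expRD; congr expR; rewrite -r2; field; rewrite !gt_eqF.
  by rewrite /C; ring.
exists (b * r * C); first by rewrite mulr_gt0.
move=> g g0; rewrite gamma_poisson_mixture//.
pose F (x : R) : \bar R := (poisson_mean x g * (gamma_pdf al b^-1 x)%:E)%E.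
rewrite [LHS](_ : _ = \int[mu]_x (F \_ D) x)%E; last by rewrite -integral_mkcond.
rewrite (@ge0_integral_affine _ (b * r) (b * al))//; last 2 first.
- apply/(measurable_restrictT _ _).1; first exact: measurable_itv.
  apply: emeasurable_funM; last exact: measurable_gamma_pdf.
  by apply: measurable_poisson_mean => //; exact: measurable_itv.
- move=> x; rewrite /patch; case: ifPn => //; rewrite inE/= in_itv/= andbT => x0.
  by rewrite mule_ge0 ?poisson_mean_ge0// lee_fin gamma_pdf_ge0.
rewrite [(b * r * C)%:E]EFinM -[RHS]muleA; congr (_ * _)%E.
rewrite -ge0_integralZl_EFin ?(ltW C0)//; last 2 first.
- by move=> x _; rewrite mule_ge0 ?poisson_mean_ge0// lee_fin gamma_weight_ge0.
- apply: emeasurable_funM; last by apply/measurable_EFinP; exact: measurable_gamma_weight.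
  apply: (measurableT_comp (measurable_poisson_mean measurableT g0)).
  by apply: measurable_funM => //; apply: measurable_funD => //; exact: measurable_funM.
apply: eq_integral => y _; rewrite /patch.
have dom : (b * r * y + b * al \in D) = (-1 < y / r).
  have -> : b * r * y + b * al = b * al * (y / r - -1).
    by rewrite -r2; field; rewrite gt_eqF.
  by rewrite -subr_gt0; apply/idP/idP; rewrite inE/= in_itv/= andbT pmulr_rgt0.
rewrite dom; case: ifPn => [u1|u1]; last first.
  by rewrite /gamma_weight -/r (negbTE u1) !mule0.
have E : b * r * y + b * al = b * (al + Num.sqrt al * y) by rewrite -/r; ring.
rewrite /F (pdfE _ u1) E; move: (poisson_mean _ g) (gamma_weight al y) => X v.
by rewrite EFinM muleCA.
Qed.

Lemma scaled_poisson_second_moment (x S sg x0 : R) : 0 < x -> 0 < sg ->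
  poisson_mean x (fun j => (((j%:R - S) / sg - x0) ^+ 2)%:E) =
  (x / sg ^+ 2 + ((x - S) / sg - x0) ^+ 2)%:E.
Proof.
move=> x_gt0 sg0; have sgn : sg != 0 by rewrite gt_eqF.
transitivity (poisson_mean x
   (fun j => (sg ^- 2)%:E * ((j%:R - (S + sg * x0)) ^+ 2)%:E)%E).
  by congr poisson_mean; apply/funext => j; rewrite -EFinM; congr EFin; field.
rewrite poisson_meanZ; last 2 first.
- by rewrite invr_ge0 exprn_ge0// ltW.
- by move=> j; rewrite lee_fin sqr_ge0.
by rewrite poisson_second_moment// -EFinM; congr EFin; field.
Qed.

(** Chebyshev's argument: a function that is within eps of f x0 up to a
    multiple of (x - x0)^2 has a mean within eps of f x0 up to the same multiple
    of the second moment about x0. *)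
Lemma poisson_mean_dist (f : R -> R) (x S sg x0 eps M : R) :
  0 < x -> 0 < sg -> (forall u, 0 <= f u) -> 0 <= eps -> 0 <= M ->
  (forall u, `|f u - f x0| <= eps + M * (u - x0) ^+ 2) ->
  exists2 m, poisson_mean x (fun j => (f ((j%:R - S) / sg))%:E) = m%:E &
    `|m - f x0| <= eps + M * (x / sg ^+ 2 + ((x - S) / sg - x0) ^+ 2).
Proof.
move=> x_gt0 sg0 f0 eps0 M0 fM.
set q := x / sg ^+ 2 + _.
set X := poisson_mean x _.
have X0 : (0 <= X)%E by apply: poisson_mean_ge0 => j; rewrite lee_fin.
have q0 j : (0 <= (((j%:R - S) / sg - x0) ^+ 2)%:E :> \bar R)%E by rewrite lee_fin sqr_ge0.
have c0 c : 0 <= c -> poisson_mean x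
    (fun j => c%:E + M%:E * (((j%:R - S) / sg - x0) ^+ 2)%:E)%E = (c + M * q)%:E.
  move=> c_ge0; rewrite poisson_meanD//; last by move=> j; rewrite mule_ge0// lee_fin.
  by rewrite poisson_mean_cst// poisson_meanZ// scaled_poisson_second_moment.
have up : (X <= (f x0 + eps + M * q)%:E)%E.
  rewrite -c0 ?addr_ge0//; apply: poisson_mean_le => j; first by rewrite lee_fin.
  rewrite -EFinM -EFinD lee_fin; have := fM ((j%:R - S) / sg).
  by move=> /(le_trans (ler_norm _)); lra.
have lo : ((f x0)%:E <= X + (eps + M * q)%:E)%E.
  rewrite -[X in (X <= _)%E](poisson_mean_cst x_gt0 (f0 x0)) -c0// -poisson_meanD.
  - apply: poisson_mean_le => j; first by rewrite lee_fin.
    rewrite -EFinM -!EFinD lee_fin; have := fM ((j%:R - S) / sg).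
    by rewrite distrC => /(le_trans (ler_norm _)); lra.
  - by move=> j; rewrite lee_fin.
  - by move=> j; apply: adde_ge0; [rewrite lee_fin|apply: mule_ge0; [rewrite lee_fin|exact: q0]].
have XE : X = (fine X)%:E.
  by rewrite fineK// ge0_fin_numE// (le_lt_trans up)// ltry.
exists (fine X) => //; move: up lo; rewrite XE -EFinD !lee_fin => up lo.
by rewrite ler_norml; apply/andP; split; lra.
Qed.

(** The left side is the second moment of the rescaled Poisson variable about
    its Gaussian limit sqrt K * y - K beta. Its variance and the error of
    replacing sqrt (b / (b + 1)) by 1 are both of order 1 / b. *)
Lemma walk_scaling_bound (a b K y s beta : R) : 1 <= a -> 1 <= b -> 1 <= K ->
  let sg := Num.sqrt (a * b * (b + 1)) in
  let x := b * (K * a + Num.sqrt (K * a) * y) in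
  s = a * b + beta * sg ->
  x / sg ^+ 2 + ((x - K * s) / sg - (Num.sqrt K * y - K * beta)) ^+ 2 <=
  K * (1 + `|y| + y ^+ 2) / (b + 1).
Proof.
move=> a1 b1 K1 sg x sE.
have a0 : 0 < a by lra.
have b0 : 0 < b by lra.
have K0 : 0 < K by lra.
have b10 : 0 < b + 1 by lra.
have abb : 0 < a * b * (b + 1) by rewrite !mulr_gt0.
have sg0 : 0 < sg by rewrite sqrtr_gt0.
have sg2 : sg ^+ 2 = a * b * (b + 1) by rewrite sqr_sqrtr// ltW.
pose ra := Num.sqrt a; pose rK := Num.sqrt K.
have ra2 : ra ^+ 2 = a by rewrite sqr_sqrtr// ltW.
have rK2 : rK ^+ 2 = K by rewrite sqr_sqrtr// ltW.
have ra1 : 1 <= ra by rewrite -[leLHS](@sqrtr1 R) ler_sqrt ?(ltW a0).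
have rK1 : 1 <= rK by rewrite -[leLHS](@sqrtr1 R) ler_sqrt ?(ltW K0).
have rKa : Num.sqrt (K * a) = rK * ra by rewrite sqrtrM// ltW.
pose tau := b * ra / sg.
have tau2 : tau ^+ 2 = b / (b + 1).
  by rewrite /tau !exprMn exprVn sg2 ra2; field; rewrite !gt_eqF.
have tau0 : 0 <= tau by rewrite /tau divr_ge0 ?(ltW sg0)// mulr_ge0 ?(ltW b0) ?sqrtr_ge0.
have tau1 : tau <= 1.
  rewrite -(@ler_pXn2r _ 2) ?nnegrE// tau2 expr1n ler_pdivrMr//; lra.
have tauB : (tau - 1) ^+ 2 <= (b + 1)^-1.
  have h : tau ^+ 2 <= tau by rewrite expr2 -[leRHS]mulr1 ler_wpM2l.
  have h2 : 1 - tau <= (b + 1)^-1.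
    have -> : (b + 1)^-1 = 1 - tau ^+ 2 by rewrite tau2; field; lra.
    lra.
  have -> : (tau - 1) ^+ 2 = (1 - tau) * (1 - tau) by ring.
  have h3 : (1 - tau) * (1 - tau) <= (1 - tau) * 1 by apply: ler_wpM2l; lra.
  lra.
have -> : (x - K * s) / sg - (rK * y - K * beta) = rK * y * (tau - 1).
  by rewrite /x rKa sE /tau; field; rewrite gt_eqF.
have -> : x / sg ^+ 2 = (K + rK * y / ra) / (b + 1).
  rewrite sg2 /x rKa -ra2; field; rewrite !gt_eqF//; lra.
have -> : K * (1 + `|y| + y ^+ 2) / (b + 1) =
   (K + K * `|y|) / (b + 1) + K * y ^+ 2 * (b + 1)^-1 by ring.
apply: lerD.
  rewrite ler_pM2r ?invr_gt0// lerD2l.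
  apply: (le_trans (ler_norm _)); rewrite !normrM mulrAC.
  apply: ler_wpM2r => //.
  rewrite ger0_norm ?(le_trans _ rK1)// ger0_norm ?invr_ge0 ?(le_trans _ ra1)//.
  rewrite ler_pdivrMr ?(lt_le_trans _ ra1)// -rK2 -mulrA -[leLHS]mulr1.
  apply: ler_wpM2l; first lra.
  by rewrite -[leLHS]mulr1; apply: ler_pM; lra.
rewrite !exprMn rK2; apply: ler_wpM2l => //.
by rewrite mulr_ge0 ?sqr_ge0// ltW.
Qed.

Lemma integrable_expRN_norm (c : R) : 0 < c ->
  mu.-integrable setT (fun y => (expR (- (c * `|y|)))%:E).
Proof.
move=> c0.
have cont : continuous (fun y : R => expR (- (c * `|y|))).
  move=> y; apply: (@continuous_comp _ _ _ (fun y => - (c * `|y|)) expR); last exact: continuous_expR.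
  apply: continuous_comp; last exact: opp_continuous.
  by apply: cvgM; [exact: cvg_cst|exact: norm_continuous].
apply/integrableP; split.
  by apply/measurable_EFinP; exact: continuous_measurable_fun.
under eq_integral do rewrite gee0_abs ?lee_fin ?expR_ge0//.
rewrite ge0_symfun_integralT//; last by move=> y /=; rewrite normrN.
rewrite (_ : [set x | _] = `[0, +oo[%classic); last first.
  by apply/seteqP; split => x/=; rewrite in_itv/= andbT.
rewrite [X in (_ * X)%E](_ : _ = \int[mu]_(x in `[0%R, +oo[) (expR (- (c * x)))%:E)%E.
  by rewrite integral_expRN// -EFinM ltry.
by apply: eq_integral => y; rewrite inE/= in_itv/= andbT => y0; rewrite ger0_norm.
Qed.

Lemma quadratic_le_expR (y : R) : 1 + y ^+ 2 <= 256 * expR (`|y| / 8).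
Proof.
have h0 := normr_ge0 y.
have h1 : 1 + `|y| / 16 <= expR (`|y| / 16) by exact: expR_ge1Dx.
have -> : expR (`|y| / 8) = expR (`|y| / 16) ^+ 2.
  by rewrite -expRM_natr; congr expR; field.
have h2 : (1 + `|y| / 16) ^+ 2 <= expR (`|y| / 16) ^+ 2.
  by rewrite lerXn2r ?nnegrE ?expR_ge0//; lra.
rewrite -(real_normK (num_real y)); nra.
Qed.

End GaussianLimit.

(** * The Gaussian limit for a fixed number of steps *)

Section FixedTime.
Context {R : realType}.
Local Notation mu := (@lebesgue_measure R).

(** What the limit theorem asks of a test function: it may grow quadratically
    and jump at 0 only; second moments then control it everywhere. *)
Definition quadratic_test (f : R -> R) (C : R) :=
  [/\ measurable_fun setT f, forall u, 0 <= f u, forall u, f u <= C * (1 + u ^+ 2) &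
      forall x0, x0 != 0 -> forall eps, 0 < eps -> exists2 M, 0 <= M &
        forall u, `|f u - f x0| <= eps + M * (u - x0) ^+ 2].

Lemma quadratic_test1 : quadratic_test (fun=> 1) 1.
Proof.
split => // [u|x0 _ eps eps0].
  by rewrite mul1r lerDl sqr_ge0.
by exists 0 => // u; rewrite subrr normr0 mul0r addr0 ltW.
Qed.

Lemma quadratic_test_gt0 : quadratic_test (fun u => (0 < u)%R%:R) 1.
Proof.
split.
- rewrite (_ : (fun u => _) = (fun u => if 0 < u then 1 else 0)); last first.
    by apply/funext => u; case: ifP.
  by apply: measurable_fun_ifT => //; exact: measurable_fun_ltr.
- by move=> u; rewrite ler0n.
- by move=> u; rewrite mul1r (@le_trans _ _ 1) ?lern1 ?leq_b1// lerDl sqr_ge0.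
- move=> x0 x00 eps eps0; have x02 : 0 < x0 ^+ 2 by rewrite exprn_even_gt0.
  exists (x0 ^- 2); first by rewrite invr_ge0 ltW.
  move=> u; apply: ler_wpDl; first exact: ltW.
  have nn : 0 <= x0 ^- 2 * (u - x0) ^+ 2 by rewrite mulr_ge0 ?sqr_ge0// invr_ge0 ltW.
  rewrite mulrC ler_pdivlMr//.
  have [h1|h1] := ltP 0 u; have [h2|h2] := ltP 0 x0;
    rewrite /= ?subrr ?normr0 ?mul0r ?sqr_ge0// ?subr0 ?sub0r ?normrN normr1 mul1r; nra.
Qed.

Let pos_dist (u v : R) : `|Num.max u 0 - Num.max v 0| <= `|u - v|.
Proof.
rewrite /Num.max; case: ltP => h1; case: ltP => h2; rewrite ?subrr ?normr0//.
- by rewrite sub0r normrN (ger0_norm h2) ler0_norm; lra.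
- by rewrite subr0 (ger0_norm h1) ger0_norm; lra.
Qed.

Lemma quadratic_test_pos : quadratic_test (fun u => Num.max u 0) 1.
Proof.
split.
- exact: measurable_maxr.
- by move=> u; rewrite le_max lexx orbT.
- by move=> u; rewrite mul1r ge_max; apply/andP; split; nra.
- move=> x0 _ eps eps0; exists (4 * eps)^-1; first by rewrite invr_ge0; lra.
  move=> u; apply: (le_trans (pos_dist _ _)).
  rewrite -(real_normK (num_real (u - x0))).
  rewrite -subr_ge0; set d := `|_|.
  have -> : eps + (4 * eps)^-1 * d ^+ 2 - d = (d - 2 * eps) ^+ 2 / (4 * eps).
    by field; rewrite gt_eqF.
  by rewrite divr_ge0 ?sqr_ge0//; lra.
Qed.

Lemma quadratic_test_possq : quadratic_test (fun u => Num.max u 0 ^+ 2) 1.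
Proof.
split.
- by apply: measurable_funX; exact: measurable_maxr.
- by move=> u; rewrite sqr_ge0.
- by move=> u; rewrite mul1r /Num.max; case: ltP => h; nra.
- move=> x0 _ eps eps0; exists (1 + x0 ^+ 2 / eps).
    by rewrite addr_ge0// divr_ge0 ?sqr_ge0// ltW.
  move=> u; have h := pos_dist u x0.
  have px0 : Num.max x0 0 <= `|x0| by rewrite ge_max ler_norm normr_ge0.
  have px : 0 <= Num.max x0 0 by rewrite le_max lexx orbT.
  have pu : 0 <= Num.max u 0 by rewrite le_max lexx orbT.
  rewrite subr_sqr normrM -(real_normK (num_real (u - x0))).
  rewrite -(real_normK (num_real x0)).
  have h2 : `|Num.max u 0 + Num.max x0 0| <= `|u - x0| + 2 * `|x0|.
    rewrite ger0_norm ?addr_ge0//; have := ler_norm (Num.max u 0 - Num.max x0 0); lra.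
  apply: (le_trans (ler_pM _ _ h h2)) => //.
  set d := `|u - x0|; set e := `|x0|; rewrite -subr_ge0.
  have -> : eps + (1 + e ^+ 2 / eps) * d ^+ 2 - d * (d + 2 * e) =
      (eps - e * d) ^+ 2 / eps.
    by field; rewrite gt_eqF.
  by rewrite divr_ge0 ?sqr_ge0// ltW.
Qed.

Lemma gaussian_integral :
  (\int[mu]_y (expR (- (y ^+ 2 / 2)))%:E = (Num.sqrt 2 * Num.sqrt pi)%:E)%E.
Proof.
have s0 : 0 < Num.sqrt 2 :> R by rewrite sqrtr_gt0.
have si0 : 0 < (Num.sqrt 2)^-1 :> R by rewrite invr_gt0.
have mg : measurable_fun setT (fun y : R => (gauss_fun y)%:E).
  by apply/measurable_EFinP; exact: measurable_gauss_fun.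
have := @ge0_integral_affine R _ 0 _ si0 mg.
rewrite integralT_gauss => /(_ _); rewrite EFinM => ->; last first.
  by move=> x; rewrite lee_fin gauss_fun_ge0.
rewrite muleA -EFinM divff ?gt_eqF// mul1e; apply: eq_integral => y _.
rewrite /gauss_fun addr0 exprMn exprVn sqr_sqrtr//; congr (expR _)%:E; ring.
Qed.

Section Limit.
Variables (a b : nat -> R) (s : nat -> nat) (beta : R) (k : nat).
Hypotheses (a2 : forall n, 2 <= a n) (b1 : forall n, 1 <= b n).
Hypotheses (aoo : a @ \oo --> +oo) (boo : b @ \oo --> +oo).
Let sg n := Num.sqrt (a n * b n * (b n + 1)).
Hypothesis sE : forall n, (s n)%:R = a n * b n + beta * sg n.
Let K : R := k.+1%:R.
Let x n y := b n * (K * a n + Num.sqrt (K * a n) * y).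
Let h (f : R -> R) n y :=
  poisson_mean (x n y) (fun j => (f ((j%:R - K * (s n)%:R) / sg n))%:E).
Let w n y := gamma_weight (K * a n) y.

Let K1 : 1 <= K. Proof. by rewrite ler1n. Qed.
Let al2 n : 2 <= K * a n.
Proof. by apply: (le_trans (a2 n)); rewrite ler_peMl//; have := a2 n; lra. Qed.
Let a1 n : 1 <= a n. Proof. by have := a2 n; lra. Qed.
Let b0 n : 0 < b n. Proof. by have := b1 n; lra. Qed.
Let sg0 n : 0 < sg n.
Proof. by rewrite sqrtr_gt0 !mulr_gt0//; have := a1 n; have := b1 n; lra. Qed.

Let x_gt0 n y : -1 < y / Num.sqrt (K * a n) -> 0 < x n y.
Proof.
have al0 : 0 < K * a n by have := al2 n; lra.
have r0 : 0 < Num.sqrt (K * a n) by rewrite sqrtr_gt0.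
rewrite ltr_pdivlMr// => h1.
rewrite /x mulr_gt0// -[X in X + _](sqr_sqrtr (ltW al0)) expr2 -mulrDr mulr_gt0//.
by lra.
Qed.

Let moment_bound n y : -1 < y / Num.sqrt (K * a n) ->
  x n y / sg n ^+ 2 + ((x n y - K * (s n)%:R) / sg n - (Num.sqrt K * y - K * beta)) ^+ 2
  <= K * (1 + `|y| + y ^+ 2) / (b n + 1).
Proof. by move=> _; apply: walk_scaling_bound => //; exact: sE. Qed.

Let cvg_h f C y : quadratic_test f C -> y != Num.sqrt K * beta ->
  (h f n y * (w n y)%:E)%E @[n --> \oo] -->
  (f (Num.sqrt K * y - K * beta) * expR (- (y ^+ 2 / 2)))%:E.
Proof.
move=> [mf f0 fC ftest] yn; set z := Num.sqrt K * y - K * beta.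
have rK0 : 0 < Num.sqrt K by rewrite sqrtr_gt0; exact: lt_le_trans K1.
have z0 : z != 0.
  have -> : z = Num.sqrt K * (y - Num.sqrt K * beta).
    by rewrite mulrBr mulrA -expr2 sqr_sqrtr// (le_trans _ K1).
  by apply: mulf_neq0; [exact: lt0r_neq0|rewrite subr_eq0].
have aloo : (K * a n) @[n --> \oo] --> +oo.
  apply/cvgryPge => M; near=> n; apply: (@le_trans _ _ (a n)).
    by near: n; move/cvgryPge : aoo; apply.
  by rewrite ler_peMl// (le_trans _ (a1 n)).
have rinv0 : y / Num.sqrt (K * a n) @[n --> \oo] --> (0 : R).
  apply/cvgrPdist_lt => e e0; near=> n.
  have al0 : (`|y| / e) ^+ 2 < K * a n by near: n; move/cvgryPgt : aloo; apply.
  have rn : `|y| / e < Num.sqrt (K * a n).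
    rewrite -[ltLHS]ger0_norm ?divr_ge0 ?(ltW e0)// -sqrtr_sqr ltr_sqrt//.
    by rewrite (le_lt_trans _ al0)// sqr_ge0.
  have r0 : 0 < Num.sqrt (K * a n) by rewrite (le_lt_trans _ rn)// divr_ge0 ?(ltW e0).
  rewrite sub0r normrN normrM normfV (gtr0_norm r0) ltr_pdivrMr//.
  by move: rn; rewrite ltr_pdivrMr// mulrC.
have near1 : \forall n \near \oo, -1 < y / Num.sqrt (K * a n).
  by move/cvgr_gt : rinv0; apply; rewrite ltrN10.
have hlim : h f n y @[n --> \oo] --> (f z)%:E.
  apply/fine_cvgP; split.
    near=> n.
    have [M M0 fM] := ftest z z0 1 ltr01.
    have n1 : -1 < y / Num.sqrt (K * a n) by near: n.
    have [m mE _] := poisson_mean_dist (K * (s n)%:R) (x_gt0 n1) (sg0 n) f0 ler01 M0 fM.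
    by rewrite /h mE.
  apply/cvgrPdist_le => eps eps0.
  have e2 : 0 < eps / 2 by rewrite divr_gt0.
  have [M M0 fM] := ftest z z0 _ e2.
  pose B := M * (K * (1 + `|y| + y ^+ 2)).
  have B0 : 0 <= B.
    by rewrite !mulr_ge0 ?(le_trans _ K1)// !addr_ge0// sqr_ge0.
  near=> n.
  have n1 : -1 < y / Num.sqrt (K * a n) by near: n.
  have [m mE mM] := poisson_mean_dist (K * (s n)%:R) (x_gt0 n1) (sg0 n) f0 (ltW e2) M0 fM.
  rewrite /= /h mE /= distrC; apply: (le_trans mM).
  have b10 : 0 < b n + 1 by have := b0 n; lra.
  have hb : B / (b n + 1) <= eps / 2.
    rewrite ler_pdivrMr// mulrC -ler_pdivrMr//.
    have : B / (eps / 2) <= b n by near: n; move/cvgryPge : boo; apply.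
    by lra.
  have := ler_wpM2l M0 (moment_bound n1).
  rewrite -/z [M * (K * _ / _)]mulrA -/B => mb.
  by apply: (le_trans (lerD (lexx _) (le_trans mb hb))); lra.
rewrite EFinM; apply: cvgeM => //.
by apply: cvg_EFin; [exact: nearW|exact: cvg_gamma_weight].
Unshelve. all: by end_near. Qed.

Let dominator (C y : R) := C * (1 + 8 * K + 4 * (K ^+ 2 * beta ^+ 2)) * 256 * expR (3 / 2) *
  expR (- (8^-1 * `|y|)).

Let h_dominated f C n y : quadratic_test f C ->
  (`|h f n y * (w n y)%:E| <= (dominator C y)%:E)%E.
Proof.
move=> [mf f0 fC ftest].
have C0 : 0 <= C by have := fC 0; have := f0 0; rewrite expr0n/= addr0; lra.
have K0 : 0 <= K by rewrite (le_trans _ K1).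
have P0 : 0 <= 1 + 8 * K + 4 * (K ^+ 2 * beta ^+ 2).
  apply: addr_ge0; first by apply: addr_ge0 => //; exact: mulr_ge0.
  by apply: mulr_ge0 => //; apply: mulr_ge0; exact: sqr_ge0.
have [n1|n1] := ltP (-1) (y / Num.sqrt (K * a n)); last first.
  rewrite /w /gamma_weight ltNge n1/= mule0 abse0 lee_fin /dominator.
  by do 4 (apply: mulr_ge0; last by rewrite ?expR_ge0).
have h0 : (0 <= h f n y)%E by apply: poisson_mean_ge0 => j; rewrite lee_fin.
rewrite gee0_abs; last by rewrite mule_ge0// lee_fin gamma_weight_ge0.
set S := K * (s n)%:R.
pose q := x n y / sg n ^+ 2 + ((x n y - S) / sg n) ^+ 2.
have hq : (h f n y <= (C * (1 + q))%:E)%E.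
  apply: (@le_trans _ _ (poisson_mean (x n y)
      (fun j => C%:E + C%:E * (((j%:R - S) / sg n - 0) ^+ 2)%:E)%E)).
    apply: poisson_mean_le => j; first by rewrite lee_fin.
    by rewrite -EFinM -EFinD lee_fin subr0; apply: (le_trans (fC _)); rewrite mulrDr mulr1.
  have xy0 := x_gt0 n1.
  have sq0 j : (0 <= (((j%:R - S) / sg n - 0) ^+ 2)%:E :> \bar R)%E.
    by rewrite lee_fin sqr_ge0.
  rewrite poisson_meanD//; last by move=> j; rewrite mule_ge0.
  rewrite poisson_mean_cst// poisson_meanZ// scaled_poisson_second_moment//.
  by rewrite subr0 -EFinM -EFinD lee_fin [leRHS]mulrDr mulr1.
have q0 : 0 <= q.
  by rewrite addr_ge0 ?sqr_ge0// divr_ge0 ?sqr_ge0// ltW// x_gt0.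
have qb : 1 + q <= (1 + 8 * K + 4 * (K ^+ 2 * beta ^+ 2)) * (1 + y ^+ 2).
  have mb := moment_bound n1; rewrite -/S in mb.
  set z := Num.sqrt K * y - K * beta in mb.
  pose m := (x n y - S) / sg n; rewrite -/m in mb.
  have qE : q = x n y / sg n ^+ 2 + m ^+ 2 by [].
  have v0 : 0 <= x n y / sg n ^+ 2 by rewrite divr_ge0 ?sqr_ge0// ltW// x_gt0.
  have h1 : q <= 2 * (x n y / sg n ^+ 2 + (m - z) ^+ 2) + 2 * z ^+ 2.
    have : m ^+ 2 <= 2 * (m - z) ^+ 2 + 2 * z ^+ 2 by have := sqr_ge0 (m - 2 * z); lra.
    by rewrite qE; lra.
  have h2 : K * (1 + `|y| + y ^+ 2) / (b n + 1) <= 2 * K * (1 + y ^+ 2).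
    rewrite ler_pdivrMr; last by have := b0 n; lra.
    apply: (@le_trans _ _ (2 * K * (1 + y ^+ 2) * 1)).
      rewrite mulr1 -[leRHS]mulrA [leRHS]mulrCA; apply: ler_wpM2l => //.
      by rewrite -(real_normK (num_real y)); have := sqr_ge0 (`|y| - 1); have := sqr_ge0 `|y|; lra.
    apply: ler_wpM2l; last by have := b0 n; lra.
    by rewrite !mulr_ge0// addr_ge0// sqr_ge0.
  have h3 : z ^+ 2 <= 2 * (K * y ^+ 2) + 2 * (K ^+ 2 * beta ^+ 2).
    have -> : K * y ^+ 2 = (Num.sqrt K * y) ^+ 2 by rewrite exprMn sqr_sqrtr.
    rewrite /z -exprMn; have := sqr_ge0 (Num.sqrt K * y + K * beta); lra.
  have h4 : 0 <= K ^+ 2 * beta ^+ 2 by rewrite mulr_ge0 ?sqr_ge0.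
  have h5 : 0 <= K ^+ 2 * beta ^+ 2 * y ^+ 2 by rewrite mulr_ge0 ?sqr_ge0.
  have h6 : 0 <= K * y ^+ 2 by rewrite mulr_ge0 ?sqr_ge0.
  have h7 := sqr_ge0 y.
  lra.
apply: (@le_trans _ _ ((C * (1 + q))%:E * (w n y)%:E)%E).
  by apply: lee_wpmul2r => //; rewrite lee_fin gamma_weight_ge0.
rewrite -EFinM lee_fin /dominator.
set P := 1 + 8 * K + _ in qb P0 *.
have -> : C * P * 256 * expR (3 / 2) * expR (- (8^-1 * `|y|)) =
   C * (P * (256 * expR (`|y| / 8))) * expR (3 / 2 - `|y| / 4).
  have -> : expR (3 / 2 - `|y| / 4) = expR (3 / 2) * expR (- (8^-1 * `|y|)) * expR (- (`|y| / 8)).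
    by rewrite -!expRD; congr expR; field.
  have : expR (`|y| / 8) * expR (- (`|y| / 8)) = 1 by rewrite -expRD subrr expR0.
  move: (expR (`|y| / 8)) (expR (- (`|y| / 8))) => E1 E2 E12.
  rewrite -[LHS]mulr1 -E12; ring.
apply: ler_pM.
- by rewrite mulr_ge0// addr_ge0.
- exact: gamma_weight_ge0.
- apply: ler_wpM2l => //; apply: (le_trans qb); apply: ler_wpM2l => //.
  exact: quadratic_le_expR.
- exact: gamma_weight_le.
Qed.

Let measurable_h f C n : quadratic_test f C ->
  measurable_fun setT (fun y => h f n y * (w n y)%:E)%E.
Proof.
move=> [mf f0 _ _]; apply: emeasurable_funM.
  apply: (measurableT_comp (f := poisson_mean ^~ _)).
    by apply: measurable_poisson_mean => // j; rewrite lee_fin.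
  by apply: measurable_funM => //; apply: measurable_funD => //; exact: measurable_funM.
by apply/measurable_EFinP; exact: measurable_gamma_weight.
Qed.

Let cvg_weighted f C : quadratic_test f C ->
  mu.-integrable setT
    (fun y => (f (Num.sqrt K * y - K * beta) * expR (- (y ^+ 2 / 2)))%:E) /\
  (\int[mu]_y (h f n y * (w n y)%:E))%E @[n --> \oo] -->
  (\int[mu]_y (f (Num.sqrt K * y - K * beta) * expR (- (y ^+ 2 / 2)))%:E)%E.
Proof.
move=> ftest; have [mf f0 _ _] := ftest.
have mlim : measurable_fun setT
    (fun y => (f (Num.sqrt K * y - K * beta) * expR (- (y ^+ 2 / 2)))%:E).
  apply/measurable_EFinP; apply: measurable_funM.
    by apply: measurableT_comp => //; apply: measurable_funB.
  apply: measurableT_comp => //; apply: measurableT_comp => //.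
  by apply: measurable_funM => //; exact: measurable_funX.
(* At the exceptional y the limit is the jump of f. *)
have aelim : {ae mu, forall y, setT y ->
    (h f n y * (w n y)%:E)%E @[n --> \oo] -->
    (f (Num.sqrt K * y - K * beta) * expR (- (y ^+ 2 / 2)))%:E}.
  exists [set Num.sqrt K * beta]; split => //.
    exact: lebesgue_measure_set1.
  move=> y /=; apply: contra_notP => /eqP yn _.
  exact: cvg_h ftest yn.
have idom : mu.-integrable setT (fun y => (dominator C y)%:E).
  rewrite (_ : (fun y => _) = (fun y => (C * (1 + 8 * K + 4 * (K ^+ 2 * beta ^+ 2)) *
      256 * expR (3 / 2))%:E * (expR (- (8^-1 * `|y|)))%:E)%E); last first.
    by apply/funext => y; rewrite -EFinM.
  by apply: integrableZl => //; apply: integrable_expRN_norm; rewrite invr_gt0.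
have ledom : {ae mu, forall y n, setT y ->
    (`|h f n y * (w n y)%:E| <= (dominator C y)%:E)%E}.
  by apply: aeW => y n _; exact: h_dominated.
by have [] := @dominated_convergence _ _ _ mu setT measurableT _ _ _
  (fun n => measurable_h n ftest) mlim aelim idom ledom.
Qed.

(** Given the Gamma variable, the Poisson noise is negligible on the scale sg
    as b grows, and the standardized Gamma variable becomes Gaussian as a
    grows. Dividing by the same integral for f = 1 disposes of the
    normalization. The limit is the mean of f under the normal law of mean
    - (k + 1) beta and variance k + 1. *)
Lemma cvg_walk_mean f C : quadratic_test f C ->
  walk_mean (gamma_poisson_pmf (a n) (b n)) (fun j => j%:R - (s n)%:R) k.+1
    (fun u => (f (u / sg n))%:E) @[n --> \oo] -->
  (((Num.sqrt 2 * Num.sqrt pi)^-1)%:E *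
   \int[mu]_y (f (Num.sqrt K * y - K * beta) * expR (- (y ^+ 2 / 2)))%:E)%E.
Proof.
move=> ftest; have [mf f0 _ _] := ftest.
have [int1 lim1] := cvg_weighted quadratic_test1.
have [intf limf] := cvg_weighted ftest.
have fin := integrable_fin_num measurableT intf.
move: limf; rewrite -(fineK fin) => /fine_cvgP[nfin limf].
have E1 : (\int[mu]_y (1 * expR (- (y ^+ 2 / 2)))%:E =
    (Num.sqrt 2 * Num.sqrt pi)%:E)%E.
  by rewrite -gaussian_integral; apply: eq_integral => y _; rewrite mul1r.
move: lim1; rewrite E1 => /fine_cvgP[nfin1 lim1].
have g0 : 0 < Num.sqrt 2 * Num.sqrt pi :> R by rewrite mulr_gt0 ?sqrtr_gt0 ?pi_gt0.
set L := fine _ in limf *; rewrite -EFinM mulrC.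
apply: (@cvg_trans _ ((EFin \o (fun n => fine (\int[mu]_y (h f n y * (w n y)%:E))%E /
    fine (\int[mu]_y (h (fun=> 1%R) n y * (w n y)%:E))%E)) @ \oo)); last first.
  apply: cvg_EFin; first exact: nearW.
  by apply: cvgM => //; apply: cvgV => //; exact: lt0r_neq0.
apply: near_eq_cvg; near=> n.
have fn : (\int[mu]_y (h f n y * (w n y)%:E))%E \is a fin_num by near: n.
have fn1 : (\int[mu]_y (h (fun=> 1%R) n y * (w n y)%:E))%E \is a fin_num by near: n.
have al1 : 1 < K * a n by have := al2 n; lra.
have an1 : 1 < a n by have := a2 n; lra.
have [c c0 cE] := gamma_poisson_weighted al1 (b0 n).
have := cE (fun=> 1%E) (fun=> lee01).
have -> : (\sum_(j <oo) (gamma_poisson_pmf (K * a n) (b n) j)%:E * 1 = 1 :> \bar R)%E.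
  exact: (gamma_poisson_mass 0 al1 (b0 n)).
rewrite -/(x n) -[X in (c%:E * X)%E]/(\int[mu]_y (h (fun=> 1%R) n y * (w n y)%:E))%E.
rewrite -(fineK fn1) -EFinM => -[] c1.
rewrite walk_mean_gamma_poisson//; last by move=> u; rewrite lee_fin.
under eq_eseriesr do rewrite natrM.
rewrite cE; last by move=> j; rewrite lee_fin.
rewrite -[X in _ = (c%:E * X)%E]/(\int[mu]_y (h f n y * (w n y)%:E))%E.
rewrite -(fineK fn) -EFinM /=; congr EFin.
set t := fine _ in c1 *; set r := fine _.
have t0 : t != 0 by apply/eqP => t0; move: c1; rewrite t0 mulr0 => /eqP; rewrite oner_eq0.
by rewrite -[c]mulr1 -(mulfV t0) mulrA -c1 mul1r mulrC.
Unshelve. all: by end_near. Qed.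

End Limit.
End FixedTime.

(** * Gaussian integrals *)

Section GaussianIntegrals.
Context {R : realType}.
Local Notation mu := (@lebesgue_measure R).
Implicit Types (A C r t w : R).

Lemma integral_gaussT A : 0 < A ->
  (\int[mu]_t (expR (- (A * t ^+ 2)))%:E = (Num.sqrt pi / Num.sqrt A)%:E)%E.
Proof.
move=> A0; have s0 : 0 < Num.sqrt A by rewrite sqrtr_gt0.
have mg : measurable_fun setT (fun y : R => (gauss_fun y)%:E).
  by apply/measurable_EFinP; exact: measurable_gauss_fun.
have := @ge0_integral_affine R _ 0 _ s0 mg.
rewrite integralT_gauss => /(_ _); rewrite mulrC EFinM => ->; last first.
  by move=> x; rewrite lee_fin gauss_fun_ge0.
rewrite muleA -EFinM mulVf ?gt_eqF// mul1e; apply: eq_integral => y _.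
by rewrite /gauss_fun addr0 exprMn sqr_sqrtr// ltW.
Qed.

Lemma integrable_gaussT A : 0 < A ->
  mu.-integrable setT (fun t => (expR (- (A * t ^+ 2)))%:E).
Proof.
move=> A0; apply/integrableP; split.
  apply/measurable_EFinP; apply: measurableT_comp => //; apply: measurableT_comp => //.
  by apply: measurable_funM => //; exact: measurable_funX.
under eq_integral do rewrite gee0_abs ?lee_fin ?expR_ge0//.
by rewrite integral_gaussT// ltry.
Qed.

Lemma is_derive_gauss A t :
  is_derive t 1 (fun u => expR (- (A * u ^+ 2))) (- (2 * A * t) * expR (- (A * t ^+ 2))).
Proof.
have h : is_derive t (1 : R) (fun u : R => - (A * u ^+ 2)) (- (2 * A * t)).
  by apply: is_derive_eq; rewrite /GRing.scale/=; ring.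
have := @is_derive1_comp _ expR _ t _ _ (is_derive_expR _) h.
by rewrite mulrC.
Qed.

Lemma continuous_gauss A : continuous (fun t => expR (- (A * t ^+ 2))).
Proof.
move=> t; apply: differentiable_continuous; apply/derivable1_diffP.
by have [] := is_derive_gauss A t.
Qed.

Lemma integral_gauss A : 0 < A ->
  (\int[mu]_(t in `[0%R, +oo[) (expR (- (A * t ^+ 2)))%:E =
   (Num.sqrt pi / (2 * Num.sqrt A))%:E)%E.
Proof.
move=> A0; have s0 : 0 < Num.sqrt A by rewrite sqrtr_gt0.
have := integral_gaussT A0; rewrite ge0_symfun_integralT//=.
- rewrite (_ : [set x | _] = `[0, +oo[%classic); last first.
    by apply/seteqP; split => x/=; rewrite in_itv/= andbT.
  move=> h; rewrite -[LHS]mul1e; have -> : 1%E = (2^-1%:E * 2%:E)%E :> \bar R.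
    by rewrite -EFinM mulVf.
  by rewrite -muleA h -EFinM; congr EFin; field; rewrite gt_eqF.
- exact: continuous_gauss.
- by move=> x/=; rewrite sqrrN.
Qed.

Lemma integrable_gauss_le (D : set R) (f : R -> R) C A : measurable D ->
  measurable_fun D f -> 0 < A ->
  (forall t, D t -> `|f t| <= C * expR (- (A * t ^+ 2))) ->
  mu.-integrable D (EFin \o f).
Proof.
move=> mD mf A0 fC.
apply: (@le_integrable _ _ _ mu D mD _ (fun t => (C%:E * (expR (- (A * t ^+ 2)))%:E)%E)).
- exact/measurable_EFinP.
- move=> t Dt /=; rewrite lee_fin (le_trans (fC t Dt))//.
  exact: ler_norm.
- apply: integrableZl => //; apply: integrableS (integrable_gaussT A0) => //.
Qed.

(** From x <= exp x at x = A t^2 / 2. *)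
Lemma sqr_expR_le A t : 0 < A ->
  t ^+ 2 * expR (- (A * t ^+ 2)) <= 2 / A * expR (- (A / 2 * t ^+ 2)).
Proof.
move=> A0; have e0 := expR_gt0 (- (A / 2 * t ^+ 2)).
have -> : - (A * t ^+ 2) = - (A / 2 * t ^+ 2) - (A / 2 * t ^+ 2) by field.
rewrite expRD mulrA ler_pM2r//.
have h := expR_ge1Dx (A / 2 * t ^+ 2).
have h2 : expR (A / 2 * t ^+ 2) * expR (- (A / 2 * t ^+ 2)) = 1 by rewrite expRxMexpNx_1.
have h3 : A / 2 * t ^+ 2 * expR (- (A / 2 * t ^+ 2)) <= 1.
  by rewrite -[leRHS]h2 ler_pM2r//; lra.
set E := expR _ in h3 *.
have -> : t ^+ 2 * E = 2 / A * (A / 2 * t ^+ 2 * E) by field; rewrite gt_eqF.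
by rewrite -[leRHS]mulr1; apply: ler_wpM2l => //; rewrite divr_ge0// ltW.
Qed.

Lemma cvgr_gauss A : 0 < A -> expR (- (A * t ^+ 2)) @[t --> +oo%R] --> (0 : R).
Proof.
move=> A0.
apply: (@squeeze_cvgr _ _ _ _ (cst 0) (fun t => expR (- (A * t)))).
- near=> t; rewrite /= expR_ge0/= ler_expR lerN2 ler_pM2l//.
  have t1 : 1 <= t by near: t; exact: nbhs_pinfty_ge.
  by rewrite expr2 ler_peMr// (le_trans _ t1).
- exact: cvg_cst.
- exact: cvgr_expRN.
Unshelve. all: by end_near. Qed.

Lemma cvgr_mul_gauss A : 0 < A -> t * expR (- (A * t ^+ 2)) @[t --> +oo%R] --> (0 : R).
Proof.
move=> A0.
apply: (@squeeze_cvgr _ _ _ _ (cst 0) (fun t => 2 / A * expR (- (A / 2 * t ^+ 2)))).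
- near=> t; have t1 : 1 <= t by near: t; exact: nbhs_pinfty_ge.
  have t0 : 0 <= t by rewrite (le_trans _ t1).
  rewrite /= mulr_ge0 ?expR_ge0//=; apply: le_trans (sqr_expR_le t A0).
  by rewrite ler_wpM2r ?expR_ge0// expr2 ler_peMr.
- exact: cvg_cst.
- rewrite -[X in _ --> X](mulr0 (2 / A)); apply: cvgM; first exact: cvg_cst.
  by apply: cvgr_gauss; rewrite divr_gt0.
Unshelve. all: by end_near. Qed.

Lemma integral_mul_gauss A r : 0 < A -> 0 <= r ->
  (\int[mu]_(w in `[r, +oo[) (2 * w * expR (- (A * w ^+ 2)))%:E =
   (expR (- (A * r ^+ 2)) / A)%:E)%E.
Proof.
move=> A0 r0.
rewrite (@ge0_continuous_FTC2y _ _ (fun t => - A^-1 * expR (- (A * t ^+ 2))) r 0).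
- by rewrite -EFinB; congr EFin; ring.
- by move=> x rx; rewrite mulr_ge0 ?expR_ge0// mulr_ge0// (le_trans r0).
- apply: continuous_subspaceT => x; apply: cvgM; last exact: continuous_gauss.
  by apply: cvgM; [exact: cvg_cst|exact: cvg_id].
- rewrite -[X in _ --> X](mulr0 (- A^-1)); apply: cvgM; first exact: cvg_cst.
  exact: cvgr_gauss.
- by move=> x _; apply: derivableM => //; have [] := is_derive_gauss A x.
- apply: cvg_at_right_filter; apply: cvgM; [exact: cvg_cst|exact: continuous_gauss].
- move=> x _; rewrite derive1E; have [d dE] := is_derive_gauss A x.
  by rewrite deriveMl// dE; field; rewrite gt_eqF.
Qed.

(** Partial integration: the second moment of a Gaussian tail. *)
Lemma integral_sqr_gauss A r : 0 < A -> 0 <= r ->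
  \int[mu]_(w in `[r, +oo[) (w ^+ 2 * expR (- (A * w ^+ 2))) =
  (r * expR (- (A * r ^+ 2)) +
   \int[mu]_(w in `[r, +oo[) expR (- (A * w ^+ 2))) / (2 * A).
Proof.
move=> A0 r0; pose D : set R := `[r, +oo[%classic.
have mD : measurable D by exact: measurable_itv.
have i0 : mu.-integrable D (EFin \o (fun w => expR (- (A * w ^+ 2)))).
  by apply: integrableS (integrable_gaussT A0).
have mg : measurable_fun setT (fun w : R => expR (- (A * w ^+ 2))).
  by apply: continuous_measurable_fun; exact: continuous_gauss.
have i2 : mu.-integrable D (EFin \o (fun w => w ^+ 2 * expR (- (A * w ^+ 2)))).
  apply: (@integrable_gauss_le _ _ (2 / A) (A / 2)) => //.
  - by apply: measurable_funTS; apply: measurable_funM => //; exact: measurable_funX.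
  - by rewrite divr_gt0.
  - move=> t _; rewrite ger0_norm; first exact: sqr_expR_le.
    by rewrite mulr_ge0 ?sqr_ge0 ?expR_ge0.
pose f w := w ^+ 2 * expR (- (A * w ^+ 2)) - (2 * A)^-1 * expR (- (A * w ^+ 2)).
have i0' : mu.-integrable D (EFin \o (fun w => (2 * A)^-1 * expR (- (A * w ^+ 2)))).
  rewrite (_ : EFin \o _ = (fun w => (2 * A)^-1%:E * (expR (- (A * w ^+ 2)))%:E)%E).
    exact: integrableZl.
  by apply/funext => w; rewrite /= EFinM.
have key : \int[mu]_(w in D) f w = r * expR (- (A * r ^+ 2)) / (2 * A).
  rewrite (@integrable_continuous_FTC2y _ f
      (fun t => - (2 * A)^-1 * (t * expR (- (A * t ^+ 2)))) r 0).
  - by field; rewrite gt_eqF.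
  - apply: continuous_subspaceT => x; apply: cvgB; apply: cvgM.
    + exact: exprn_continuous.
    + exact: continuous_gauss.
    + exact: cvg_cst.
    + exact: continuous_gauss.
  - by apply: (@integrableB _ _ _ mu D mD (EFin \o (fun w => w ^+ 2 * expR (- (A * w ^+ 2))))
      (EFin \o (fun w => (2 * A)^-1 * expR (- (A * w ^+ 2))))).
  - rewrite -[X in _ --> X](mulr0 (- (2 * A)^-1)); apply: cvgM; first exact: cvg_cst.
    exact: cvgr_mul_gauss.
  - by move=> x _; apply: derivableM => //; apply: derivableM.
  - apply: cvg_at_right_filter; apply: cvgM; first exact: cvg_cst.
    by apply: cvgM; [exact: cvg_id|exact: continuous_gauss].
  - move=> x _; rewrite derive1E; have dg := is_derive_gauss A x.
    have [_ ->] : is_derive x 1 (fun t => - (2 * A)^-1 * (t * expR (- (A * t ^+ 2)))) (f x).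
      by apply: is_derive_eq; rewrite /GRing.scale/= /f; field; rewrite gt_eqF.
    by [].
rewrite -/D mulrDl -key RintegralB// RintegralZl//.
by rewrite [X in _ = _ - X + _]mulrC subrK.
Qed.

(** Writing exp(- K A) / A as an integral of 2 w exp(- A w^2) turns an integral
    with a rational factor into a Gaussian tail. *)
Lemma integral_gauss_over c2 K : 0 < c2 -> 0 < K ->
  (\int[mu]_(t in `[0%R, +oo[) (expR (- (K * (c2 + t ^+ 2))) / (c2 + t ^+ 2))%:E =
   (Num.sqrt pi)%:E * \int[mu]_(w in `[Num.sqrt K, +oo[) (expR (- (c2 * w ^+ 2)))%:E)%E.
Proof.
move=> c0 K0; have rK0 : 0 < Num.sqrt K by rewrite sqrtr_gt0.
have A0 (t : R) : 0 < c2 + t ^+ 2 by rewrite ltr_pwDl// sqr_ge0.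
pose D1 : set R := `[0, +oo[%classic; pose D2 : set R := `[Num.sqrt K, +oo[%classic.
have mD1 : measurable D1 by exact: measurable_itv.
have mD2 : measurable D2 by exact: measurable_itv.
pose F (z : R * R) : R := (\1_D1 z.1 * \1_D2 z.2) *
  (2 * z.2 * expR (- ((c2 + z.1 ^+ 2) * z.2 ^+ 2))).
have indE (D : set R) (g : R -> R) : measurable D ->
    (\int[mu]_(x in D) (g x)%:E = \int[mu]_x (\1_D x * g x)%:E)%E.
  move=> mD; rewrite integral_mkcond; apply: eq_integral => x _.
  by rewrite patchE indicE; case: ifP => _; rewrite ?mul1r ?mul0r.
have inner_w (t : R) : (\int[mu]_w (F (t, w))%:E =
    (\1_D1 t * (expR (- (K * (c2 + t ^+ 2))) / (c2 + t ^+ 2)))%:E)%E.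
  transitivity ((\1_D1 t)%:E *
      \int[mu]_(w in D2) (2 * w * expR (- ((c2 + t ^+ 2) * w ^+ 2)))%:E)%E; last first.
    have := integral_mul_gauss (A0 t) (ltW rK0); rewrite -/D2 => ->.
    by rewrite -EFinM (sqr_sqrtr (ltW K0)) [K * _]mulrC.
  rewrite (indE D2 _ mD2) -ge0_integralZl_EFin.
  - by apply: eq_integral => w _; rewrite -EFinM; congr EFin; rewrite -[LHS]mulrA.
  - by [].
  - move=> w _; rewrite lee_fin indicE; case: (boolP (w \in D2)); last by rewrite mul0r.
    rewrite inE /D2/= in_itv/= andbT => Kw; rewrite mul1r mulr_ge0 ?expR_ge0// mulr_ge0//.
    by rewrite (le_trans _ Kw)// ltW.
  - apply/measurable_EFinP; apply: measurable_funM; first exact: measurable_indic.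
    apply: measurable_funM; first exact: measurable_funM.
    by apply: continuous_measurable_fun; exact: continuous_gauss.
  - by rewrite indicE.
have inner_t (w : R) : (\int[mu]_t (F (t, w))%:E =
    (Num.sqrt pi * (\1_D2 w * expR (- (c2 * w ^+ 2))))%:E)%E.
  have [Kw|Kw] := boolP (w \in D2); last first.
    rewrite indicE (negbTE Kw) mul0r mulr0; apply: integral0_eq => t _.
    by rewrite /F/= [\1_D2 w]indicE (negbTE Kw) mulr0 mul0r.
  have w0 : 0 < w.
    by move: (Kw); rewrite inE /D2/= in_itv/= andbT; exact: lt_le_trans.
  transitivity ((2 * w * expR (- (c2 * w ^+ 2)))%:E *
     \int[mu]_(t in D1) (expR (- (w ^+ 2 * t ^+ 2)))%:E)%E; last first.
    rewrite integral_gauss ?exprn_gt0// sqrtr_sqr gtr0_norm// -EFinM indicE Kw mul1r.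
    by congr EFin; field; rewrite gt_eqF.
  rewrite (indE D1 _ mD1) -ge0_integralZl_EFin.
  - apply: eq_integral => t _; rewrite -EFinM /F/= [\1_D2 w]indicE Kw mulr1.
    have -> : - ((c2 + t ^+ 2) * w ^+ 2) = - (c2 * w ^+ 2) + - (w ^+ 2 * t ^+ 2) by ring.
    by rewrite expRD; congr EFin; ring.
  - by [].
  - by move=> t _; rewrite lee_fin mulr_ge0 ?expR_ge0// indicE.
  - apply/measurable_EFinP; apply: measurable_funM; first exact: measurable_indic.
    by apply: continuous_measurable_fun; exact: continuous_gauss.
  - by rewrite mulr_ge0 ?expR_ge0// mulr_ge0// ltW.
have F0 z : 0 <= F z.
  rewrite /F !indicE; have [z2|z2] := boolP (z.2 \in D2); last by rewrite mulr0 mul0r.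
  rewrite !mulr_ge0 ?expR_ge0//.
  by move: z2; rewrite inE /D2/= in_itv/= andbT; apply: le_trans; exact: ltW.
have mF : measurable_fun setT (EFin \o F).
  apply/measurable_EFinP; apply: measurable_funM.
    apply: measurable_funM.
      by apply: (@measurableT_comp _ _ _ _ _ _ (\1_D1 : R -> R)) => //; exact: measurable_indic.
    by apply: (@measurableT_comp _ _ _ _ _ _ (\1_D2 : R -> R)) => //; exact: measurable_indic.
  apply: measurable_funM; first exact: measurable_funM.
  apply: measurableT_comp => //; apply: measurableT_comp => //.
  apply: measurable_funM; last by apply: measurable_funX.
  by apply: measurable_funD => //; apply: measurable_funX.
have {mF F0} E := @fubini_tonelli _ _ _ _ _ mu mu (EFin \o F) mF (fun z => F0 z).
transitivity (\int[mu]_t \int[mu]_w (F (t, w))%:E)%E.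
  rewrite -/D1 (indE D1 _ mD1); apply: eq_integral => t _.
  by rewrite inner_w.
rewrite [LHS]E -/D2 (indE D2 _ mD2) -ge0_integralZl_EFin.
- by apply: eq_integral => w _; rewrite -EFinM; exact: inner_t.
- by [].
- by move=> w _; rewrite lee_fin mulr_ge0 ?expR_ge0// indicE.
- apply/measurable_EFinP; apply: measurable_funM; first exact: measurable_indic.
  by apply: continuous_measurable_fun; exact: continuous_gauss.
- exact: sqrtr_ge0.
Qed.

End GaussianIntegrals.

(** * The part above 0 of a Gaussian law with negative mean *)

Section GaussianTails.
Context {R : realType}.
Local Notation mu := (@lebesgue_measure R).
Local Notation D := (`[0, +oo[%classic : set R).
Variables (beta K : R).
Hypotheses (beta0 : 0 < beta) (K0 : 0 < K).
Let c2 : R := beta ^+ 2 / 2.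
Let A (t : R) : R := c2 + t ^+ 2.
Let r : R := Num.sqrt K.
Local Notation Dr := (`[r, +oo[%classic : set R).
Let e : R := expR (- (c2 * K)).
Let W : R := \int[mu]_(w in Dr) expR (- (c2 * w ^+ 2)).
Let J0 : R := \int[mu]_(t in D) (expR (- (K * A t)) / A t).

Let c20 : 0 < c2. Proof. by rewrite divr_gt0// exprn_gt0. Qed.
Let A0 t : 0 < A t. Proof. by rewrite ltr_pwDl// sqr_ge0. Qed.
Let r0 : 0 < r. Proof. by rewrite sqrtr_gt0. Qed.
Let r2 : r ^+ 2 = K. Proof. by rewrite sqr_sqrtr// ltW. Qed.
Let mD : measurable D. Proof. exact: measurable_itv. Qed.
Let mDr : measurable Dr. Proof. exact: measurable_itv. Qed.

Let mg (a : R) : measurable_fun setT (fun w : R => expR (- (a * w ^+ 2))).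
Proof. by apply: continuous_measurable_fun; exact: continuous_gauss. Qed.

Let iW : mu.-integrable Dr (EFin \o (fun w => expR (- (c2 * w ^+ 2)))).
Proof. by apply: integrableS (integrable_gaussT c20). Qed.

Let iw1 : mu.-integrable Dr (EFin \o (fun w => w * expR (- (c2 * w ^+ 2)))).
Proof.
apply: (@integrable_gauss_le _ _ _ (r^-1 * (2 / c2)) (c2 / 2)) => //.
- by apply: measurable_funTS; exact: measurable_funM.
- by rewrite divr_gt0.
- move=> t /=; rewrite in_itv/= andbT => rt; have t0 := lt_le_trans r0 rt.
  rewrite ger0_norm; last by rewrite mulr_ge0 ?expR_ge0// ltW.
  apply: (@le_trans _ _ (r^-1 * (t ^+ 2 * expR (- (c2 * t ^+ 2))))); last first.
    by rewrite -[leRHS]mulrA ler_pM2l ?invr_gt0//; exact: sqr_expR_le.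
  rewrite [leRHS]mulrA; apply: ler_wpM2r; first exact: expR_ge0.
  by rewrite mulrC ler_pdivlMr// expr2 ler_pM2l.
Qed.

Let iw2 : mu.-integrable Dr (EFin \o (fun w => w ^+ 2 * expR (- (c2 * w ^+ 2)))).
Proof.
apply: (@integrable_gauss_le _ _ _ (2 / c2) (c2 / 2)) => //.
- by apply: measurable_funTS; apply: measurable_funM => //; exact: measurable_funX.
- by rewrite divr_gt0.
- move=> t _; rewrite ger0_norm; first exact: sqr_expR_le.
  by rewrite mulr_ge0 ?sqr_ge0 ?expR_ge0.
Qed.

Let Iw1 : \int[mu]_(w in Dr) (w * expR (- (c2 * w ^+ 2))) = e / beta ^+ 2.
Proof.
apply: (@mulfI _ 2) => //; rewrite -RintegralZl//.
transitivity (\int[mu]_(w in Dr) (2 * w * expR (- (c2 * w ^+ 2)))).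
  by apply: eq_Rintegral => w _; rewrite mulrA.
rewrite /Rintegral integral_mul_gauss ?(ltW r0)// /= r2 -/e /c2.
by field; exact: lt0r_neq0.
Qed.

Let Iw2 : \int[mu]_(w in Dr) (w ^+ 2 * expR (- (c2 * w ^+ 2))) = (r * e + W) / beta ^+ 2.
Proof.
rewrite integral_sqr_gauss ?(ltW r0)// r2 -/e -/W /c2.
by field; exact: lt0r_neq0.
Qed.

(** The part of the law N(- K beta, K) that lies above 0, with the variable
    rescaled so that only the lower limit depends on K. *)
Let integral_tail (g : R -> R) (p : R -> R) : measurable_fun setT g ->
  (forall u, 0 <= g u) -> (forall u, u <= 0 -> g u = 0) ->
  (forall w, r < w -> g (beta * r * (w - r)) = p w) ->
  mu.-integrable Dr (EFin \o (fun w => p w * expR (- (c2 * w ^+ 2)))) ->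
  (\int[mu]_y (g (r * y - K * beta) * expR (- (y ^+ 2 / 2)))%:E =
   (beta * \int[mu]_(w in Dr) (p w * expR (- (c2 * w ^+ 2))))%:E)%E.
Proof.
move=> mg' g0 gneg gp ip.
have mG : measurable_fun setT (fun y : R => (g (r * y - K * beta) * expR (- (y ^+ 2 / 2)))%:E).
  apply/measurable_EFinP; apply: measurable_funM.
    by apply: measurableT_comp => //; apply: measurable_funB.
  rewrite (_ : (fun y => _) = (fun y => expR (- (2^-1 * y ^+ 2)))); last first.
    by apply/funext => y; rewrite mulrC.
  exact: mg.
rewrite (@ge0_integral_affine _ beta 0)//; last first.
  by move=> y; rewrite lee_fin mulr_ge0 ?expR_ge0.
rewrite EFinM; congr (_ * _)%E.
rewrite /Rintegral fineK; last exact: integrable_fin_num.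
rewrite -integral_itv_obnd_cbnd; last first.
  have /measurable_int := ip; apply: measurable_funS => //.
  by move=> w /=; rewrite !in_itv/= !andbT => /ltW.
rewrite [RHS]integral_mkcond; apply: eq_integral => w _.
rewrite patchE addr0.
have -> : r * (beta * w) - K * beta = beta * r * (w - r) by rewrite -r2; ring.
have -> : - ((beta * w) ^+ 2 / 2) = - (c2 * w ^+ 2) by rewrite /c2; field.
case: ifPn => [|wr]; first by rewrite inE/= in_itv/= andbT => rw; rewrite gp.
rewrite gneg ?mul0r// pmulr_rle0 ?mulr_gt0// subr_le0 leNgt.
by apply: contra wr => rw; rewrite inE/= in_itv/= rw.
Qed.

Let tail_gt0 :
  (\int[mu]_y ((0 < r * y - K * beta)%R%:R * expR (- (y ^+ 2 / 2)))%:E =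
   (beta * W)%:E)%E.
Proof.
rewrite (@integral_tail (fun u => (0 < u)%R%:R) (fun=> 1)).
- by congr (_ * _)%:E; apply: eq_Rintegral => w _; rewrite mul1r.
- by have [] := @quadratic_test_gt0 R.
- by move=> u; rewrite ler0n.
- by move=> u u0; rewrite ltNge u0.
- by move=> w rw; rewrite mulr_gt0 ?mulr_gt0// subr_gt0.
- by move: iW; congr (integrable _ _ _); apply/funext => w; rewrite /= mul1r.
Qed.

Let tail_pos :
  (\int[mu]_y (Num.max (r * y - K * beta) 0 * expR (- (y ^+ 2 / 2)))%:E =
   (r * e - beta ^+ 2 * K * W)%:E)%E.
Proof.
have i1 : mu.-integrable Dr (EFin \o (fun w => beta * r * (w * expR (- (c2 * w ^+ 2))))).
  rewrite (_ : EFin \o _ = (fun w => (beta * r)%:E * (w * expR (- (c2 * w ^+ 2)))%:E)%E).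
    exact: integrableZl.
  by apply/funext => w; rewrite /= EFinM.
have i2 : mu.-integrable Dr (EFin \o (fun w => beta * K * expR (- (c2 * w ^+ 2)))).
  rewrite (_ : EFin \o _ = (fun w => (beta * K)%:E * (expR (- (c2 * w ^+ 2)))%:E)%E).
    exact: integrableZl.
  by apply/funext => w; rewrite /= EFinM.
have E : (fun w => beta * r * (w - r) * expR (- (c2 * w ^+ 2))) =
   (fun w => beta * r * (w * expR (- (c2 * w ^+ 2))) - beta * K * expR (- (c2 * w ^+ 2))).
  by apply/funext => w; rewrite -r2; ring.
rewrite (@integral_tail (fun u => Num.max u 0) (fun w => beta * r * (w - r))).
- rewrite E RintegralB// !RintegralZl// Iw1 -/W; congr EFin; field; exact: lt0r_neq0.
- by have [] := @quadratic_test_pos R.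
- by move=> u; rewrite le_max lexx orbT.
- by move=> u u0; apply/max_idPr.
- by move=> w rw; apply/max_idPl; rewrite mulr_ge0 ?subr_ge0 ?(ltW rw)// mulr_ge0// ltW.
- rewrite E; exact: (@integrableB _ _ _ mu Dr mDr
    (EFin \o (fun w => beta * r * (w * expR (- (c2 * w ^+ 2)))))
    (EFin \o (fun w => beta * K * expR (- (c2 * w ^+ 2))))).
Qed.

Let tail_possq :
  (\int[mu]_y (Num.max (r * y - K * beta) 0 ^+ 2 * expR (- (y ^+ 2 / 2)))%:E =
   (beta * K * ((1 + beta ^+ 2 * K) * W - r * e))%:E)%E.
Proof.
have iZ (c : R) (h : R -> R) : mu.-integrable Dr (EFin \o h) ->
    mu.-integrable Dr (EFin \o (fun w => c * h w)).
  move=> ih; rewrite (_ : EFin \o _ = (fun w => c%:E * (h w)%:E)%E).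
    exact: integrableZl.
  by apply/funext => w; rewrite /= EFinM.
have iD (h h' : R -> R) : mu.-integrable Dr (EFin \o h) -> mu.-integrable Dr (EFin \o h') ->
    mu.-integrable Dr (EFin \o (fun w => h w + h' w)).
  move=> ih ih'; exact: (@integrableD _ _ _ mu Dr mDr (EFin \o h) (EFin \o h')).
have E : (fun w => (beta * r * (w - r)) ^+ 2 * expR (- (c2 * w ^+ 2))) =
   (fun w => beta ^+ 2 * K * (w ^+ 2 * expR (- (c2 * w ^+ 2))) +
     (- (2 * beta ^+ 2 * K * r) * (w * expR (- (c2 * w ^+ 2))) +
      beta ^+ 2 * K ^+ 2 * expR (- (c2 * w ^+ 2)))).
  by apply/funext => w; rewrite -r2; ring.
rewrite (@integral_tail (fun u => Num.max u 0 ^+ 2) (fun w => (beta * r * (w - r)) ^+ 2)).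
- rewrite E !RintegralD ?RintegralZl//; try by [exact: iZ|apply: iD; exact: iZ].
  rewrite Iw1 Iw2 -/W; congr EFin; field; exact: lt0r_neq0.
- by have [] := @quadratic_test_possq R.
- by move=> u; rewrite sqr_ge0.
- by move=> u u0; rewrite (max_idPr u0) expr0n.
- move=> w rw; congr (_ ^+ 2); apply/max_idPl.
  by rewrite mulr_ge0 ?subr_ge0 ?(ltW rw)// mulr_ge0// ltW.
- by rewrite E; apply: (iD); [exact: iZ|apply: (iD); exact: iZ].
Qed.

Let J0E : J0 = Num.sqrt pi * W.
Proof.
rewrite /J0 /Rintegral integral_gauss_over//.
have -> : (\int[mu]_(w in Dr) (expR (- (c2 * w ^+ 2)))%:E = W%:E)%E.
  by rewrite /W /Rintegral fineK//; exact: integrable_fin_num.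
by rewrite -EFinM.
Qed.

Let eKA (t : R) : expR (- (K * A t)) = e * expR (- (K * t ^+ 2)).
Proof. by rewrite /e /A -expRD; congr expR; ring. Qed.

Let mA : measurable_fun setT A.
Proof. by apply: measurable_funD => //; exact: measurable_funX. Qed.

Let mAV : measurable_fun setT (fun t => (A t)^-1).
Proof.
apply: continuous_measurable_fun => t; apply: cvgV; first exact: lt0r_neq0.
by apply: cvgD; [exact: cvg_cst|exact: exprn_continuous].
Qed.

Let meKA : measurable_fun setT (fun t => expR (- (K * A t))).
Proof. by do 2 apply: measurableT_comp => //; exact: measurable_funM. Qed.

Let ie : mu.-integrable D (EFin \o (fun t => expR (- (K * A t)))).
Proof.
apply: (@integrable_gauss_le _ _ _ e K) => //; first exact: measurable_funTS.
by move=> t _; rewrite eKA ger0_norm// mulr_ge0 ?expR_ge0.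
Qed.

Let iJ0 : mu.-integrable D (EFin \o (fun t => expR (- (K * A t)) / A t)).
Proof.
apply: (@integrable_gauss_le _ _ _ (e / c2) K) => //.
  by apply: measurable_funTS; exact: measurable_funM.
move=> t _; rewrite eKA ger0_norm; last by rewrite divr_ge0 ?(ltW (A0 t))// mulr_ge0 ?expR_ge0.
rewrite mulrAC; apply: ler_wpM2r; first exact: expR_ge0.
by rewrite ler_wpM2l ?expR_ge0// lef_pV2 ?posrE// lerDl sqr_ge0.
Qed.

Let Ie : \int[mu]_(t in D) expR (- (K * A t)) = e * (Num.sqrt pi / (2 * r)).
Proof.
transitivity (\int[mu]_(t in D) (e * expR (- (K * t ^+ 2)))).
  by apply: eq_Rintegral => t _; rewrite eKA.
rewrite RintegralZl//; last by apply: integrableS (integrable_gaussT K0).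
by rewrite /Rintegral integral_gauss.
Qed.

Let J1E : \int[mu]_(t in D) (t ^+ 2 / A t * expR (- (K * A t))) =
  e * (Num.sqrt pi / (2 * r)) - c2 * J0.
Proof.
have ic : mu.-integrable D (EFin \o (fun t => c2 * (expR (- (K * A t)) / A t))).
  rewrite (_ : EFin \o _ = (fun t => c2%:E * (expR (- (K * A t)) / A t)%:E)%E).
    exact: integrableZl.
  by apply/funext => w; rewrite /= EFinM.
rewrite -Ie -RintegralZl// -RintegralB//; apply: eq_Rintegral => t _.
by have := A0 t; rewrite /A => At; field; exact: lt0r_neq0.
Qed.

(** Partial integration against t exp(- K t^2) / A t. *)
Let J2E : \int[mu]_(t in D) (t ^+ 2 / A t ^+ 2 * expR (- (K * A t))) =
  ((1 + K * beta ^+ 2) * J0 - 2 * K * (e * (Num.sqrt pi / (2 * r)))) / 2.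
Proof.
have iZ (c : R) (h : R -> R) : mu.-integrable D (EFin \o h) ->
    mu.-integrable D (EFin \o (fun w => c * h w)).
  move=> ih; rewrite (_ : EFin \o _ = (fun w => c%:E * (h w)%:E)%E).
    exact: integrableZl.
  by apply/funext => w; rewrite /= EFinM.
have i2 : mu.-integrable D (EFin \o (fun t => t ^+ 2 / A t ^+ 2 * expR (- (K * A t)))).
  apply: (@integrable_gauss_le _ _ _ (e / c2) K) => //.
    apply: measurable_funTS; apply: measurable_funM => //; apply: measurable_funM => //.
    rewrite (_ : (fun x => _) = (fun x => (A x)^-1 ^+ 2)).
      exact: measurable_funX.
    by apply/funext => x; rewrite exprVn.
  move=> t _; rewrite eKA ger0_norm; last first.
    by rewrite mulr_ge0 ?divr_ge0 ?sqr_ge0// mulr_ge0 ?expR_ge0.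
  rewrite mulrA; apply: ler_wpM2r; first exact: expR_ge0.
  rewrite mulrC; apply: ler_wpM2l; first exact: expR_ge0.
  rewrite ler_pdivrMr ?exprn_gt0// expr2 mulrA.
  apply: (@le_trans _ _ (A t)); first by rewrite /A lerDr ltW.
  rewrite -[leLHS]mul1r ler_pM2r// mulrC ler_pdivlMr// mul1r.
  by rewrite /A lerDl sqr_ge0.
pose F (t : R) := e * (t * expR (- (K * t ^+ 2)) / A t).
pose f (t : R) := (1 + 2 * K * c2) * (expR (- (K * A t)) / A t) +
  (- (2 * K) * expR (- (K * A t)) + - 2 * (t ^+ 2 / A t ^+ 2 * expR (- (K * A t)))).
have iD (h h' : R -> R) : mu.-integrable D (EFin \o h) -> mu.-integrable D (EFin \o h') ->
    mu.-integrable D (EFin \o (fun w => h w + h' w)).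
  move=> ih ih'; exact: (@integrableD _ _ _ mu D mD (EFin \o h) (EFin \o h')).
have i_f : mu.-integrable D (EFin \o f) by apply: (iD); [exact: iZ|apply: (iD); exact: iZ].
have dA (t : R) : is_derive t 1 A (2 * t).
  by apply: is_derive_eq; rewrite /GRing.scale/=; ring.
have dAV (t : R) : is_derive t 1 (fun u => (A u)^-1) (- (A t) ^- 2 * (2 * t)).
  by have := is_deriveV (lt0r_neq0 (A0 t)) (dA t).
have dF (t : R) : is_derive t 1 F (f t).
  have dg := is_derive_gauss K t; rewrite /F.
  apply: is_derive_eq; rewrite /GRing.scale/= /f !eKA /A.
  by have := A0 t; rewrite /A => At; field; exact: lt0r_neq0.
have cA (t : R) : A u @[u --> t] --> A t.
  by apply: cvgD; [exact: cvg_cst|exact: exprn_continuous].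
have cAV (t : R) : (A u)^-1 @[u --> t] --> (A t)^-1.
  exact: (cvgV (lt0r_neq0 (A0 t)) (cA t)).
have cE (t : R) : expR (- (K * A u)) @[u --> t] --> expR (- (K * A t)).
  apply: (@continuous_comp _ _ _ (fun u => - (K * A u)) expR); last exact: continuous_expR.
  by apply: cvgN; apply: cvgM; [exact: cvg_cst|exact: cA].
have key : \int[mu]_(t in D) f t = 0.
  rewrite (@integrable_continuous_FTC2y _ f F 0 0)//.
  - by rewrite /F mul0r mul0r mulr0 subr0.
  - apply: continuous_subspaceT => t; apply: cvgD.
      by apply: cvgM; [exact: cvg_cst|exact: (cvgM (cE t) (cAV t))].
    apply: cvgD; apply: cvgM; try exact: cvg_cst; first exact: cE.
    apply: cvgM; last exact: cE.
    apply: cvgM; first exact: exprn_continuous.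
    under eq_fun do rewrite -exprVn; rewrite -exprVn.
    by apply: (@cvg_comp _ _ _ (fun u => (A u)^-1) (fun x => x ^+ 2)); [exact: cAV|exact: exprn_continuous].
  - apply: (@squeeze_cvgr _ _ _ _ (cst 0) (fun t => e / c2 * (t * expR (- (K * t ^+ 2))))).
    + near=> t; have t0 : 0 <= t by near: t; exact: nbhs_pinfty_ge.
      have h0 : 0 <= t * expR (- (K * t ^+ 2)) by rewrite mulr_ge0 ?expR_ge0.
      rewrite /F mulr_ge0 ?expR_ge0 ?divr_ge0 ?(ltW (A0 t))//=.
      rewrite -[leRHS]mulrA; apply: ler_wpM2l; first exact: expR_ge0.
      rewrite [leLHS]mulrC; apply: ler_wpM2r => //.
      by rewrite lef_pV2 ?posrE// /A lerDl sqr_ge0.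
    + exact: cvg_cst.
    + rewrite -[X in _ --> X](mulr0 (e / c2)); apply: cvgM; first exact: cvg_cst.
      exact: cvgr_mul_gauss.
  - apply: cvg_at_right_filter; apply: differentiable_continuous; apply/derivable1_diffP.
    by have [] := dF 0.
  - by move=> t _; rewrite derive1E; have [_ ->] := dF t.
move: key; rewrite /f RintegralD; [|exact: mD|exact: iZ|by apply: iD; apply: iZ].
rewrite RintegralD; [|exact: mD|exact: iZ|exact: iZ].
rewrite RintegralZl// RintegralZl// RintegralZl// Ie -/J0 => key.
apply: (@mulfI _ 2) => //; rewrite mulrCA mulfV// mulr1.
have -> : 1 + K * beta ^+ 2 = 1 + 2 * K * c2 by rewrite /c2; field.
move: key; set X := (\int[mu]_(t in D) _); lra.
Unshelve. all: by end_near. Qed.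

Let rpi : R := Num.sqrt pi.
Let rpi0 : 0 < rpi. Proof. by rewrite sqrtr_gt0 pi_gt0. Qed.
Let rpi2 : pi = rpi ^+ 2 :> R. Proof. by rewrite sqr_sqrtr// ltW// pi_gt0. Qed.
Let r20 : 0 < Num.sqrt 2 :> R. Proof. by rewrite sqrtr_gt0. Qed.
Let r22 : Num.sqrt 2 ^+ 2 = 2 :> R. Proof. by rewrite sqr_sqrtr. Qed.

Let r2V : (Num.sqrt 2)^-1 = Num.sqrt 2 / 2 :> R.
Proof. by rewrite -[in X in _ / X]r22; field; exact: lt0r_neq0. Qed.

(** Here and in the next two identities, both sides are combinations of the
    Gaussian tail W and of exp(- K beta^2 / 2). *)
Lemma gaussian_gt0 :
  (((Num.sqrt 2 * Num.sqrt pi)^-1)%:E *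
   \int[mu]_y ((0 < Num.sqrt K * y - K * beta)%R%:R * expR (- (y ^+ 2 / 2)))%:E =
   (beta / (Num.sqrt 2 * pi) *
    \int[mu]_(t in D) (expR (- (K * (beta ^+ 2 / 2 + t ^+ 2))) /
                       (beta ^+ 2 / 2 + t ^+ 2)))%:E)%E.
Proof.
rewrite tail_gt0 -EFinM -/J0 J0E -/rpi rpi2; congr EFin.
by field; rewrite !lt0r_neq0.
Qed.

Lemma gaussian_pos :
  (((Num.sqrt 2 * Num.sqrt pi)^-1)%:E *
   \int[mu]_y (Num.max (Num.sqrt K * y - K * beta) 0 * expR (- (y ^+ 2 / 2)))%:E =
   (K * (Num.sqrt 2 / pi *
    \int[mu]_(t in D) (t ^+ 2 / (beta ^+ 2 / 2 + t ^+ 2) *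
                       expR (- (K * (beta ^+ 2 / 2 + t ^+ 2))))))%:E)%E.
Proof.
rewrite tail_pos -EFinM J1E J0E -/rpi rpi2 /c2 -r2; congr EFin.
by rewrite invfM r2V; field; rewrite !lt0r_neq0.
Qed.

Lemma gaussian_possq :
  (((Num.sqrt 2 * Num.sqrt pi)^-1)%:E *
   \int[mu]_y (Num.max (Num.sqrt K * y - K * beta) 0 ^+ 2 * expR (- (y ^+ 2 / 2)))%:E =
   (K * (Num.sqrt 2 * beta / pi *
    \int[mu]_(t in D) (t ^+ 2 / (beta ^+ 2 / 2 + t ^+ 2) ^+ 2 *
                       expR (- (K * (beta ^+ 2 / 2 + t ^+ 2))))))%:E)%E.
Proof.
rewrite tail_possq -EFinM J2E J0E -/rpi rpi2 -r2; congr EFin.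
by rewrite invfM r2V; field; rewrite !lt0r_neq0.
Qed.

End GaussianTails.

(** * Geometric and logarithmic series under the integral sign *)

Section GaussianSeries.
Context {R : realType}.
Local Notation mu := (@lebesgue_measure R).
Local Notation D := (`[0, +oo[%classic : set R).

Lemma geometric_nneseries (q : R) : 0 <= q < 1 ->
  (\sum_(k <oo) (q ^+ k)%:E = ((1 - q)^-1)%:E)%E.
Proof.
move=> /andP[q0 q1]; apply: cvg_lim => //.
rewrite (_ : (fun n => _) = EFin \o series (geometric 1 q)); last first.
  apply/funext => n /=; rewrite /series /= -sumEFin.
  by apply: eq_bigr => i _; rewrite mul1r.
apply: cvg_EFin; first exact: nearW.
have q1' : `|q| < 1 by rewrite ger0_norm.
by have := @cvg_geometric_series R 1 q q1'; rewrite mul1r.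
Qed.

Lemma geometric_nneseriesS (q : R) : 0 <= q < 1 ->
  (\sum_(k <oo) (q ^+ k.+1)%:E = (q / (1 - q))%:E)%E.
Proof.
move=> q01; have /andP[q0 q1] := q01.
transitivity (\sum_(k <oo) (q%:E * (q ^+ k)%:E))%E.
  by apply: eq_eseriesr => k _; rewrite exprS EFinM.
rewrite nneseriesZl; last by move=> k _; rewrite lee_fin exprn_ge0.
by rewrite geometric_nneseries.
Qed.

(** The geometric coefficients q^n are those of the exponential of the sum of
    the (q z)^k / k, and the value at 1 of the former is 1 / (1 - q). *)
Lemma log_nneseries (q : R) : 0 <= q < 1 ->
  (\sum_(k <oo) (q ^+ k.+1 / k.+1%:R)%:E = (- ln (1 - q))%:E)%E.
Proof.
move=> q01; have /andP[q0 q1] := q01.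
have r01 k : 0 <= q ^+ k.+1 <= 1 by rewrite exprn_ge0//= exprn_ile1// ltW.
have S0 : (0 <= \sum_(k <oo) (q ^+ k.+1 / k.+1%:R)%:E)%E.
  by apply: nneseries_ge0 => k _ _; rewrite lee_fin divr_ge0// exprn_ge0.
have Sfin : (\sum_(k <oo) (q ^+ k.+1 / k.+1%:R)%:E \is a fin_num)%E.
  rewrite ge0_fin_numE//; apply: (@le_lt_trans _ _ (q / (1 - q))%:E); last exact: ltry.
  rewrite -geometric_nneseriesS//; apply: lee_nneseries => k *.
    by rewrite lee_fin divr_ge0// exprn_ge0.
  by rewrite lee_fin ler_piMr ?exprn_ge0// invf_le1// ler1n.
have LE := fineK Sfin; rewrite -LE; congr EFin.
set L := fine _ in LE *.
have := sum_exp_coef r01 (esym LE).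
have wP : exp_coef_of (fun k => q ^+ k.+1) (fun n => q ^+ n).
  split=> // n; rewrite (eq_bigr (fun=> q ^+ n)).
    by rewrite sumr_const card_ord mulr_natl.
  by move=> k _; rewrite -exprD subnKC.
under eq_eseriesr do rewrite (exp_coef_unique (exp_coefP _) wP).
rewrite geometric_nneseries// => -[] h.
apply: oppr_inj; rewrite opprK -[LHS]expRK expRN -h invrK.
by [].
Qed.

Section Mixture.
Variables (c2 : R) (F : R -> R).
Hypotheses (c20 : 0 < c2) (mF : measurable_fun setT F) (F0 : forall t, 0 <= F t).
Let A (t : R) : R := c2 + t ^+ 2.
Let q01 t : 0 <= expR (- A t) < 1.
Proof. by rewrite expR_ge0/= -[ltRHS]expR0 ltr_expR oppr_lt0 ltr_pwDl// sqr_ge0. Qed.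
Let expKA (k : nat) t : expR (- (k.+1%:R * A t)) = expR (- A t) ^+ k.+1.
Proof. by rewrite -expRM_natl -mulrN. Qed.
Let mE (k : nat) : measurable_fun D (fun t => (F t * expR (- (k.+1%:R * A t)))%:E).
Proof.
apply: measurable_funTS; apply/measurable_EFinP; apply: measurable_funM => //.
do 2 apply: measurableT_comp => //; apply: measurable_funM => //.
by apply: measurable_funD => //; exact: measurable_funX.
Qed.
Let E0 (k : nat) t : (0 <= (F t * expR (- (k.+1%:R * A t)))%:E)%E.
Proof. by rewrite lee_fin mulr_ge0 ?expR_ge0. Qed.

Lemma nneseries_integral_geometric :
  (\sum_(k <oo) \int[mu]_(t in D) (F t * expR (- (k.+1%:R * (c2 + t ^+ 2))))%:E =
   \int[mu]_(t in D)
     (F t * (expR (- (c2 + t ^+ 2)) / (1 - expR (- (c2 + t ^+ 2)))))%:E)%E.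
Proof.
rewrite -integral_nneseries; [|exact: measurable_itv|exact: mE|by move=> *; exact: E0].
apply: eq_integral => t _; rewrite EFinM -geometric_nneseriesS; last exact: q01.
rewrite -nneseriesZl; last by move=> k _; rewrite lee_fin exprn_ge0// expR_ge0.
by apply: eq_eseriesr => k _; rewrite -EFinM -expKA.
Qed.

Lemma nneseries_integral_log :
  (\sum_(k <oo) (k.+1%:R^-1)%:E *
     \int[mu]_(t in D) (F t * expR (- (k.+1%:R * (c2 + t ^+ 2))))%:E =
   \int[mu]_(t in D) (F t * - ln (1 - expR (- (c2 + t ^+ 2))))%:E)%E.
Proof.
transitivity (\sum_(k <oo) \int[mu]_(t in D)
    ((k.+1%:R^-1)%:E * (F t * expR (- (k.+1%:R * A t)))%:E))%E.
  apply: eq_eseriesr => k _; rewrite ge0_integralZl_EFin//; first exact: mE.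
rewrite -integral_nneseries; last 3 first.
- exact: measurable_itv.
- by move=> k; apply: emeasurable_funM; [exact: measurable_cst|exact: mE].
- by move=> k t _; rewrite mule_ge0.
apply: eq_integral => t _; rewrite EFinM -log_nneseries; last exact: q01.
rewrite -nneseriesZl; last first.
  by move=> k _; rewrite lee_fin divr_ge0// exprn_ge0// expR_ge0.
by apply: eq_eseriesr => k _; rewrite -!EFinM expKA; congr EFin; ring.
Qed.

End Mixture.
End GaussianSeries.

(** * The stationary queue in terms of the walk *)

Section OneQueue.
Context {R : realType}.
Variables (a b beta : R) (s : nat).
Hypotheses (a1 : 1 < a) (b1 : 1 <= b) (beta0 : 0 < beta) (abeta : beta ^+ 2 / 16 <= a).
Let sg := Num.sqrt (a * b * (b + 1)).
Hypothesis sE : s%:R = a * b + beta * sg.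
Let p := gamma_poisson_pmf a b.
Let x (j : nat) : R := j%:R - s%:R.

(** The mean of f at the k-th partial sum in units of the standard deviation
    of one arrival count. *)
Definition scaled_walk_mean (k : nat) (f : R -> R) : R :=
  fine (walk_mean p x k (fun u => (f (u / sg))%:E)).
Local Notation G := scaled_walk_mean.

Let b0 : 0 < b. Proof. exact: lt_le_trans b1. Qed.
Let a0 : 0 < a. Proof. exact: lt_trans a1. Qed.
Let sg0 : 0 < sg. Proof. by rewrite sqrtr_gt0 !mulr_gt0// addr_gt0. Qed.
Let p_ge0 j : 0 <= p j. Proof. exact: gamma_poisson_pmf_ge0. Qed.
Let mass1 : step_mean p x (fun=> 1%E) = 1%E. Proof. exact: gamma_poisson_mass. Qed.
Let th := beta / 16 / sg.
Let th0 : 0 < th. Proof. by rewrite !divr_gt0. Qed.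
Let q := expR (- (beta ^+ 2 / 32)).

Let walk_bound k (f : R -> R) C : (forall u, 0 <= f u) -> 0 <= C ->
  (forall u, f (u / sg) <= C * expR (th * u)) ->
  (walk_mean p x k (fun u => (f (u / sg))%:E) <= (C * q ^+ k)%:E)%E.
Proof.
move=> f0 C0 fC.
have [rho /andP[rho0 rhoq] rhoE] := gamma_poisson_chernoff a1 b1 beta0 abeta sE.
apply: (@le_trans _ _ (C * rho ^+ k)%:E).
  apply: (walk_le_exp p_ge0 k C0 _ rhoE) => u.
    by rewrite lee_fin.
  by rewrite lee_fin.
by rewrite lee_fin; apply: ler_wpM2l => //; rewrite lerXn2r// nnegrE// (le_trans rho0).
Qed.

Let walk_ge0 k (f : R -> R) : (forall u, 0 <= f u) ->
  (0 <= walk_mean p x k (fun u => (f (u / sg))%:E))%E.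
Proof. by move=> f0; apply: iter_mean_ge0 => // u; rewrite lee_fin. Qed.

Lemma scaled_walk_mean_bound k (f : R -> R) C : (forall u, 0 <= f u) -> 0 <= C ->
  (forall u, f u <= C * expR (beta / 16 * u)) -> 0 <= G k f <= C * q ^+ k.
Proof.
move=> f0 C0 fC.
have W : (walk_mean p x k (fun u => (f (u / sg))%:E) <= (C * q ^+ k)%:E)%E.
  apply: walk_bound => // u; apply: (le_trans (fC _)).
  by rewrite (_ : beta / 16 * (u / sg) = th * u)// /th; ring.
have Wf : walk_mean p x k (fun u => (f (u / sg))%:E) \is a fin_num.
  by rewrite ge0_fin_numE ?walk_ge0// (le_lt_trans W)// ltry.
rewrite fine_ge0 ?walk_ge0//=.
by rewrite -lee_fin /scaled_walk_mean fineK.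
Qed.

Let beta16 : 0 < beta / 16. Proof. by rewrite divr_gt0. Qed.

Lemma scaled_gt0_bound k : 0 <= G k (fun u => (0 < u)%R%:R) <= q ^+ k.
Proof.
have := @scaled_walk_mean_bound k (fun u => (0 < u)%R%:R) 1.
rewrite mul1r; apply => // u; rewrite mul1r; case: ltP => u0 /=; last exact: expR_ge0.
by rewrite -[leLHS]expR0 ler_expR mulr_ge0 ?(ltW beta16) ?(ltW u0).
Qed.

Lemma scaled_pos_bound k :
  0 <= G k (fun u => Num.max u 0) <= (beta / 16)^-1 * q ^+ k.
Proof.
apply: scaled_walk_mean_bound => [u||u]; first by rewrite le_max lexx orbT.
  by rewrite invr_ge0 ltW.
exact: pos_le_expR.
Qed.

Lemma scaled_possq_bound k :
  0 <= G k (fun u => Num.max u 0 ^+ 2) <= 2 * (beta / 16)^-1 ^+ 2 * q ^+ k.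
Proof.
apply: scaled_walk_mean_bound => [u||u]; first by rewrite sqr_ge0.
  by rewrite mulr_ge0 ?sqr_ge0.
exact: possq_le_expR.
Qed.

Let q1 : q < 1.
Proof. by rewrite -[ltRHS]expR0 ltr_expR oppr_lt0 divr_gt0// exprn_gt0. Qed.

Let sum_fin (g : nat -> R) C : (forall k, 0 <= g k <= C * q ^+ k.+1) ->
  (\sum_(k <oo) (g k / k.+1%:R)%:E \is a fin_num)%E.
Proof.
move=> gC.
have g0 k : 0 <= g k by have /andP[] := gC k.
have C0 : 0 <= C.
  have /andP[h1 h2] := gC 0%N; rewrite -(@pmulr_lge0 _ (q ^+ 1)) ?exprn_gt0 ?expR_gt0//.
  exact: le_trans h2.
rewrite ge0_fin_numE; last by apply: nneseries_ge0 => k _ _; rewrite lee_fin divr_ge0.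
apply: (@le_lt_trans _ _ (C%:E * (q / (1 - q))%:E)%E); last by rewrite -EFinM ltry.
rewrite -geometric_nneseriesS; last by rewrite expR_ge0.
rewrite -nneseriesZl; last by move=> k _; rewrite lee_fin exprn_ge0// expR_ge0.
apply: lee_nneseries => k *; first by rewrite lee_fin divr_ge0.
rewrite -EFinM lee_fin; have /andP[_] := gC k; apply: le_trans.
by rewrite ler_piMr// invf_le1// ler1n.
Qed.

Let expm : exists m, step_mean p x (fun u => (expR (th * `|u|))%:E) = m%:E.
Proof.
have [rho _ rhoE] := gamma_poisson_chernoff a1 b1 beta0 abeta sE.
exact: gamma_poisson_exp_moment a1 b0 th0 rhoE.
Qed.

Let mean_sum := fine (\sum_(k <oo) (G k.+1 (fun u => Num.max u 0) / k.+1%:R)%:E)%E.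
Let var_sum := fine (\sum_(k <oo) (G k.+1 (fun u => Num.max u 0 ^+ 2) / k.+1%:R)%:E)%E.
Let gt0_sum := fine (\sum_(k <oo) (G k.+1 (fun u => (0 < u)%R%:R) / k.+1%:R)%:E)%E.

Let walk_scaled k (f : R -> R) (g : R -> \bar R) (c : R) : 0 < c -> (forall u, 0 <= f u) ->
  (forall u, g u = (c * f (u / sg))%:E) ->
  walk_mean p x k.+1 (fun u => (f (u / sg))%:E) \is a fin_num ->
  fine (walk_mean p x k.+1 g) = c * G k.+1 f.
Proof.
move=> c0 f0 gE ffin.
have -> : walk_mean p x k.+1 g = (c%:E * walk_mean p x k.+1 (fun u => (f (u / sg))%:E))%E.
  rewrite /walk_mean -iter_meanZ ?(ltW c0)//; last by move=> u; rewrite lee_fin.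
  by apply: eq_iter_mean => u; rewrite gE EFinM.
by rewrite -(fineK ffin) -EFinM.
Qed.

Let fin_scaled k (f : R -> R) C : (forall u, 0 <= f u) -> 0 <= C ->
  (forall u, f u <= C * expR (beta / 16 * u)) ->
  walk_mean p x k (fun u => (f (u / sg))%:E) \is a fin_num.
Proof.
move=> f0 C0 fC; rewrite ge0_fin_numE ?walk_ge0//.
apply: le_lt_trans (ltry (C * q ^+ k)); apply: walk_bound => // u.
apply: (le_trans (fC _)).
by rewrite (_ : beta / 16 * (u / sg) = th * u)// /th; ring.
Qed.

Let max_scaled u : Num.max u 0 = sg * Num.max (u / sg) 0.
Proof.
rewrite maxr_pMr ?(ltW sg0)// mulr0 mulrC divfK// lt0r_neq0//.
Qed.

Let walk_pos k : fine (walk_mean p x k.+1 (pos_fun (R := R))) =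
  sg * G k.+1 (fun u => Num.max u 0).
Proof.
apply: walk_scaled => //.
- by move=> u; rewrite le_max lexx orbT.
- by move=> u; rewrite /pos_fun max_scaled.
apply: (@fin_scaled _ (fun u => Num.max u 0) (beta / 16)^-1).
- by move=> u; rewrite le_max lexx orbT.
- by rewrite invr_ge0 ltW.
- by move=> u; exact: pos_le_expR.
Qed.

Let walk_possq k : fine (walk_mean p x k.+1 (possq_fun (R := R))) =
  sg ^+ 2 * G k.+1 (fun u => Num.max u 0 ^+ 2).
Proof.
apply: walk_scaled; first exact: exprn_gt0.
- by move=> u; rewrite sqr_ge0.
- by move=> u; rewrite /possq_fun max_scaled exprMn.
apply: (@fin_scaled _ (fun u => Num.max u 0 ^+ 2) (2 * (beta / 16)^-1 ^+ 2)).
- by move=> u; rewrite sqr_ge0.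
- by rewrite mulr_ge0 ?sqr_ge0.
- by move=> u; exact: possq_le_expR.
Qed.

Let walk_gt0 k : fine (walk_mean p x k.+1 (gt0_fun (R := R))) =
  G k.+1 (fun u => (0 < u)%R%:R).
Proof.
congr (fine _); apply: eq_iter_mean => u; rewrite /gt0_fun.
by rewrite pmulr_lgt0// invr_gt0.
Qed.

Section Stationary.
Context (d d' : measure_display) (T : measurableType d) (T' : measurableType d').
Variables (P : probability T R) (P' : probability T' R).
Variables (A : nat -> {RV P >-> nat}) (Q : {RV P' >-> R}).
Hypotheses (A_law : forall i, has_gamma_poisson_law a b (A i))
  (A_indep : mutually_independent A)
  (Q_stat : is_stationary_queue_length A s Q).

Let law i j : P [set w | A i w = j] = (p j)%:E. Proof. exact: A_law. Qed.

Lemma queue_mean : ('E_(P')[Q] =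
  (sg * fine (\sum_(k <oo) (G k.+1 (fun u => Num.max u 0) / k.+1%:R)%:E)%E)%:E)%E.
Proof.
have [m mE] := expm.
have h1 := stationary_mean A_indep law Q_stat.
have h2 := cvg_max_mean_pos p_ge0 th0 mass1 mE.
rewrite -(cvg_lim _ h1)// (cvg_lim _ h2)// EFinM fineK; last first.
  by apply: sum_fin => k; exact: scaled_pos_bound.
rewrite -nneseriesZl; last first.
  move=> k _; rewrite lee_fin divr_ge0//.
  by have /andP[] := scaled_pos_bound k.+1.
by apply: eq_eseriesr => k _; rewrite walk_pos -EFinM mulrA.
Qed.

(** The square of the mean cancels against the Cauchy square in the second
    moment. *)
Lemma queue_variance : ('V_(P')[Q] =
  (sg ^+ 2 * fine (\sum_(k <oo) (G k.+1 (fun u => Num.max u 0 ^+ 2) / k.+1%:R)%:E)%E)%:E)%E.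
Proof.
have [m mE] := expm.
have E1 : (\sum_(k <oo) (fine (walk_mean p x k.+1 (pos_fun (R := R))) / k.+1%:R)%:E =
    (sg * mean_sum)%:E)%E.
  rewrite EFinM fineK; last by apply: sum_fin => k; exact: scaled_pos_bound.
  rewrite -nneseriesZl; last first.
    move=> k _; rewrite lee_fin divr_ge0//.
    by have /andP[] := scaled_pos_bound k.+1.
  by apply: eq_eseriesr => k _; rewrite walk_pos -EFinM mulrA.
have E2 : (\sum_(k <oo) (fine (walk_mean p x k.+1 (possq_fun (R := R))) / k.+1%:R)%:E =
    (sg ^+ 2 * var_sum)%:E)%E.
  rewrite EFinM fineK; last by apply: sum_fin => k; exact: scaled_possq_bound.
  rewrite -nneseriesZl; last first.
    move=> k _; rewrite lee_fin divr_ge0//.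
    by have /andP[] := scaled_possq_bound k.+1.
  by apply: eq_eseriesr => k _; rewrite walk_possq -EFinM mulrA.
have h1 := stationary_second_moment A_indep law Q_stat.
have h2 := cvg_max_mean_possq p_ge0 th0 mass1 mE E1 E2.
have Q2 : (\int[P']_w (Q w ^+ 2)%:E = (sg ^+ 2 * var_sum + (sg * mean_sum) ^+ 2)%:E)%E.
  by rewrite -(cvg_lim _ h1)// (cvg_lim _ h2).
have QL : (Q : T' -> R) \in Lfun P' 2%:E.
  rewrite inE/=; apply/andP; split; rewrite inE//=.
  rewrite /finite_norm unlock poweR_lty//.
  apply: le_lt_trans (ltry (sg ^+ 2 * var_sum + (sg * mean_sum) ^+ 2)); rewrite -Q2.
  rewrite le_eqVlt; apply/orP; left; apply/eqP; apply: eq_integral => w _ /=.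
  by rewrite powR_mulrn// real_normK ?num_real.
rewrite varianceE// queue_mean expectation_def.
rewrite (_ : (\int[P']_w _)%E = (\int[P']_w (Q w ^+ 2)%:E)%E); last first.
  by apply: eq_integral => w _.
by rewrite Q2 -/mean_sum -EFin_expe -EFinB addrK.
Qed.

Lemma queue_empty : P' [set w | Q w = 0] =
  (expR (- fine (\sum_(k <oo) (G k.+1 (fun u => (0 < u)%R%:R) / k.+1%:R)%:E)%E))%:E.
Proof.
have [m mE] := expm.
have h1 := stationary_empty A_indep law Q_stat.
have h2 := max_mean_le0 p_ge0 th0 mass1 mE.
have Pfin : P' [set w | Q w = 0] \is a fin_num.
  rewrite fin_num_measure// -[X in measurable X]setTI.
  exact: (measurable_funP Q measurableT _ (measurable_set1 0)).
rewrite -(fineK Pfin); congr EFin.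
have E0 : (\sum_(k <oo) (fine (walk_mean p x k.+1 (gt0_fun (R := R))) / k.+1%:R)%:E =
    gt0_sum%:E)%E.
  rewrite fineK; last by apply: (@sum_fin _ 1) => k; rewrite mul1r; exact: scaled_gt0_bound.
  by apply: eq_eseriesr => k _; rewrite walk_gt0.
apply: (renewal_limit _ E0 h2).
  move=> k; rewrite walk_gt0; have /andP[-> h] := scaled_gt0_bound k.+1.
  by rewrite /= (le_trans h)// exprn_ile1 ?expR_ge0// ltW.
by move: h1; rewrite -(fineK Pfin) => /fine_cvgP[].
Qed.

End Stationary.
End OneQueue.

(** * Continuity in beta of the limiting integrals *)

Section ParameterIntegrals.
Context {R : realType}.
Local Notation mu := (@lebesgue_measure R).
Local Notation D := (`[0, +oo[%classic : set R).

Definition mean_integrand (b t : R) : R :=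
  t ^+ 2 / (b ^+ 2 / 2 + t ^+ 2) *
  (expR (- (b ^+ 2 / 2) - t ^+ 2) / (1 - expR (- (b ^+ 2 / 2) - t ^+ 2))).

Definition variance_integrand (b t : R) : R :=
  t ^+ 2 / (b ^+ 2 / 2 + t ^+ 2) ^+ 2 *
  (expR (- (b ^+ 2 / 2) - t ^+ 2) / (1 - expR (- (b ^+ 2 / 2) - t ^+ 2))).

Definition empty_integrand (b t : R) : R :=
  b / Num.sqrt 2 / (b ^+ 2 / 2 + t ^+ 2) * ln (1 - expR (- (b ^+ 2 / 2) - t ^+ 2)).

Let A_gt0 (b t : R) : 0 < b -> 0 < b ^+ 2 / 2 + t ^+ 2.
Proof. by move=> b0; rewrite ltr_pwDl ?sqr_ge0// divr_gt0// exprn_gt0. Qed.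

Let E_lt1 (b t : R) : 0 < b -> 0 < 1 - expR (- (b ^+ 2 / 2) - t ^+ 2).
Proof.
by move=> b0; rewrite subr_gt0 -[ltRHS]expR0 ltr_expR -opprD oppr_lt0 A_gt0.
Qed.

Let exp_ratio_ge0 (b t : R) : 0 < b ->
  0 <= expR (- (b ^+ 2 / 2) - t ^+ 2) / (1 - expR (- (b ^+ 2 / 2) - t ^+ 2)).
Proof. by move=> b0; rewrite divr_ge0 ?expR_ge0// ltW// E_lt1. Qed.

Section Continuity.
Context {T : Type} {F : set_system T} {FF : Filter F}.
Variables (bf tf : T -> R) (b t : R).
Hypotheses (b0 : 0 < b) (bl : bf x @[x --> F] --> b) (tl : tf x @[x --> F] --> t).

Let sqrl (g : T -> R) (c : R) : g x @[x --> F] --> c -> g x ^+ 2 @[x --> F] --> c ^+ 2.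
Proof. by move=> gc; under eq_fun do rewrite expr2; rewrite expr2; exact: cvgM. Qed.

Let bl2 : bf x ^+ 2 / 2 @[x --> F] --> b ^+ 2 / 2.
Proof. by apply: cvgM; [exact: sqrl|exact: cvg_cst]. Qed.

Let tl2 : tf x ^+ 2 @[x --> F] --> t ^+ 2. Proof. exact: sqrl. Qed.

Let Al : bf x ^+ 2 / 2 + tf x ^+ 2 @[x --> F] --> b ^+ 2 / 2 + t ^+ 2.
Proof. exact: cvgD. Qed.

Let AVl : (bf x ^+ 2 / 2 + tf x ^+ 2)^-1 @[x --> F] --> (b ^+ 2 / 2 + t ^+ 2)^-1.
Proof. exact: (cvgV (lt0r_neq0 (A_gt0 t b0)) Al). Qed.

Let El : expR (- (bf x ^+ 2 / 2) - tf x ^+ 2) @[x --> F] --> expR (- (b ^+ 2 / 2) - t ^+ 2).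
Proof.
by apply: continuous_cvg; [exact: continuous_expR|apply: cvgB => //; exact: cvgN].
Qed.

Let E1l : 1 - expR (- (bf x ^+ 2 / 2) - tf x ^+ 2) @[x --> F] -->
  1 - expR (- (b ^+ 2 / 2) - t ^+ 2).
Proof. by apply: cvgB => //; exact: cvg_cst. Qed.

Let Ql : expR (- (bf x ^+ 2 / 2) - tf x ^+ 2) / (1 - expR (- (bf x ^+ 2 / 2) - tf x ^+ 2))
  @[x --> F] --> expR (- (b ^+ 2 / 2) - t ^+ 2) / (1 - expR (- (b ^+ 2 / 2) - t ^+ 2)).
Proof. by apply: cvgM => //; exact: (cvgV (lt0r_neq0 (E_lt1 t b0)) E1l). Qed.

Lemma cvg_mean_integrand : mean_integrand (bf x) (tf x) @[x --> F] --> mean_integrand b t.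
Proof. by apply: cvgM => //; exact: cvgM. Qed.

Lemma cvg_variance_integrand :
  variance_integrand (bf x) (tf x) @[x --> F] --> variance_integrand b t.
Proof.
apply: cvgM => //; apply: cvgM => //.
have An : (b ^+ 2 / 2 + t ^+ 2) ^+ 2 != 0.
  by rewrite expf_neq0// lt0r_neq0// A_gt0.
exact: (cvgV An (sqrl Al)).
Qed.

Lemma cvg_empty_integrand : empty_integrand (bf x) (tf x) @[x --> F] --> empty_integrand b t.
Proof.
apply: cvgM.
  by apply: cvgM => //; apply: cvgM => //; exact: cvg_cst.
by apply: continuous_cvg => //; apply: continuous_ln; exact: E_lt1.
Qed.

End Continuity.

Let cont_measurable (g : R -> R) : (forall t : R, g u @[u --> t] --> g t) ->
  measurable_fun D g.
Proof. by move=> cg; apply: measurable_funTS; exact: continuous_measurable_fun. Qed.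

Lemma measurable_mean_integrand b : 0 < b -> measurable_fun D (mean_integrand b).
Proof.
move=> b0; apply: cont_measurable => t.
by apply: (cvg_mean_integrand (bf := fun=> b)) => //; exact: cvg_cst.
Qed.

Lemma measurable_variance_integrand b : 0 < b -> measurable_fun D (variance_integrand b).
Proof.
move=> b0; apply: cont_measurable => t.
by apply: (cvg_variance_integrand (bf := fun=> b)) => //; exact: cvg_cst.
Qed.

Lemma measurable_empty_integrand b : 0 < b -> measurable_fun D (empty_integrand b).
Proof.
move=> b0; apply: cont_measurable => t.
by apply: (cvg_empty_integrand (bf := fun=> b)) => //; exact: cvg_cst.
Qed.

Lemma ln1B_le_ratio (x : R) : 0 <= x < 1 -> 0 <= - ln (1 - x) <= x / (1 - x).
Proof.
move=> /andP[x0 x1]; have x10 : 0 < 1 - x by rewrite subr_gt0.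
rewrite oppr_ge0 ln_le0 ?lerBlDr ?lerDl//= -lnV ?posrE//.
have E : (1 - x)^-1 = 1 + x / (1 - x) by field; lra.
by rewrite [X in ln X]E; apply: le_ln1Dx; rewrite (@lt_le_trans _ _ 0)// divr_ge0// ltW.
Qed.

Section Bounds.
Variables (dl B : R).
Hypotheses (dl0 : 0 < dl).
Let m := dl ^+ 2 / 2.
Let C0 := (1 - expR (- m))^-1.
Let m0 : 0 < m. Proof. by rewrite divr_gt0// exprn_gt0. Qed.
Let em1 : 0 < 1 - expR (- m).
Proof. by rewrite subr_gt0 -[ltRHS]expR0 ltr_expR oppr_lt0. Qed.
Let C00 : 0 <= C0. Proof. by rewrite invr_ge0 ltW. Qed.

Let mb (b : R) : dl <= b -> m <= b ^+ 2 / 2.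
Proof. by move=> db; rewrite ler_pM2r ?invr_gt0// lerXn2r// nnegrE ltW// (lt_le_trans dl0). Qed.

Let mA (b t : R) : dl <= b -> m <= b ^+ 2 / 2 + t ^+ 2.
Proof. by move=> db; apply: (le_trans (mb db)); rewrite lerDl sqr_ge0. Qed.

(** A bound that holds for all b >= dl at once: the numerator gives the decay in
    t, and the denominator is smallest at b = dl and t = 0. *)
Lemma exp_ratio_le (b t : R) : dl <= b ->
  expR (- (b ^+ 2 / 2) - t ^+ 2) / (1 - expR (- (b ^+ 2 / 2) - t ^+ 2)) <=
  C0 * expR (- (1 * t ^+ 2)).
Proof.
move=> db; have b0 : 0 < b := lt_le_trans dl0 db.
rewrite mulrC; apply: ler_pM; rewrite ?invr_ge0 ?expR_ge0 ?(ltW (E_lt1 t b0))//.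
  rewrite /C0 lef_pV2; [|rewrite posrE; exact: E_lt1|rewrite posrE; exact: em1].
  by rewrite lerD2l lerN2 ler_expR -opprD lerN2; exact: mA.
rewrite ler_expR mul1r gerDr oppr_le0.
by rewrite divr_ge0 ?sqr_ge0.
Qed.

Lemma mean_integrand_le b t : dl <= b ->
  `|mean_integrand b t| <= C0 * expR (- (1 * t ^+ 2)).
Proof.
move=> db; have b0 : 0 < b := lt_le_trans dl0 db.
rewrite /mean_integrand ger0_norm; last first.
  by rewrite mulr_ge0 ?exp_ratio_ge0// divr_ge0 ?sqr_ge0// ltW// A_gt0.
rewrite -[leRHS]mul1r; apply: ler_pM; rewrite ?exp_ratio_ge0 ?exp_ratio_le//.
  by rewrite divr_ge0 ?sqr_ge0// ltW// A_gt0.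
by rewrite ler_pdivrMr ?A_gt0// mul1r lerDr divr_ge0 ?sqr_ge0.
Qed.

Lemma variance_integrand_le b t : dl <= b ->
  `|variance_integrand b t| <= m^-1 * C0 * expR (- (1 * t ^+ 2)).
Proof.
move=> db; have b0 : 0 < b := lt_le_trans dl0 db; have A0 := A_gt0 t b0.
rewrite /variance_integrand ger0_norm; last first.
  by rewrite mulr_ge0 ?exp_ratio_ge0// divr_ge0 ?sqr_ge0.
rewrite -[leRHS]mulrA; apply: ler_pM; rewrite ?exp_ratio_ge0 ?exp_ratio_le//.
  by rewrite divr_ge0 ?sqr_ge0.
apply: (@le_trans _ _ (b ^+ 2 / 2 + t ^+ 2)^-1); last by rewrite lef_pV2 ?posrE// mA.
rewrite ler_pdivrMr ?exprn_gt0// expr2 mulrA mulVf ?lt0r_neq0// mul1r.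
by rewrite lerDr divr_ge0 ?sqr_ge0.
Qed.

Lemma empty_integrand_le b t : dl <= b -> b <= B ->
  `|empty_integrand b t| <= B / Num.sqrt 2 / m * C0 * expR (- (1 * t ^+ 2)).
Proof.
move=> db bB; have b0 : 0 < b := lt_le_trans dl0 db; have A0 := A_gt0 t b0.
have r20 : 0 < Num.sqrt 2 :> R by rewrite sqrtr_gt0.
rewrite /empty_integrand normrM -[leRHS]mulrA; apply: ler_pM => //.
  rewrite ger0_norm; last by rewrite divr_ge0 ?(ltW A0)// divr_ge0 ?(ltW r20) ?(ltW b0).
  apply: ler_pM; rewrite ?invr_ge0 ?(ltW A0)//; first by rewrite divr_ge0 ?(ltW r20) ?(ltW b0).
    by rewrite ler_pM2r ?invr_gt0.
  by rewrite lef_pV2 ?posrE// mA.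
have q01 : 0 <= expR (- (b ^+ 2 / 2) - t ^+ 2) < 1 by rewrite expR_ge0/= -subr_gt0 E_lt1.
have /andP[h1 h2] := ln1B_le_ratio q01.
by rewrite -normrN ger0_norm//; apply: (le_trans h2); exact: exp_ratio_le.
Qed.

End Bounds.

Let cvg_Rintegral_dominated (f : nat -> R -> R) (g : R -> R) (C : R) :
  (forall n, measurable_fun D (f n)) -> measurable_fun D g ->
  (forall n t, `|f n t| <= C * expR (- (1 * t ^+ 2))) ->
  (forall t, f n t @[n --> \oo] --> g t) ->
  mu.-integrable D (EFin \o g) /\
  \int[mu]_(t in D) f n t @[n --> \oo] --> \int[mu]_(t in D) g t.
Proof.
move=> mf mg fC fg.
have mD : measurable D by exact: measurable_itv.
have iC : mu.-integrable D (fun t => (C * expR (- (1 * t ^+ 2)))%:E).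
  rewrite (_ : (fun t => _) = (fun t => C%:E * (expR (- (1 * t ^+ 2)))%:E)%E).
    by apply: integrableZl => //; apply: integrableS (integrable_gaussT ltr01).
  by apply/funext => t; rewrite EFinM.
have mf' n : measurable_fun D (EFin \o f n) by exact/measurable_EFinP.
have mg' : measurable_fun D (EFin \o g) by exact/measurable_EFinP.
have ae1 : {ae mu, forall t, D t -> (EFin \o f n) t @[n --> \oo] --> (EFin \o g) t}.
  by apply: aeW => t _; apply: cvg_EFin; [exact: nearW|exact: fg].
have ae2 : {ae mu, forall t n, D t -> (`|(EFin \o f n) t| <= (C * expR (- (1 * t ^+ 2)))%:E)%E}.
  by apply: aeW => t n _; rewrite /= lee_fin.
have [ig _ lim] := @dominated_convergence _ _ _ mu D mD _ _ _ mf' mg' ae1 iC ae2.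
split => //; rewrite /Rintegral; apply: fine_cvg; rewrite fineK//.
exact: integrable_fin_num.
Qed.

Section Limits.
Variables (bn : nat -> R) (b : R).
Hypotheses (b0 : 0 < b) (bnb : bn n @[n --> \oo] --> b)
  (bn_ge : forall n, b / 2 <= bn n) (bn_le : forall n, bn n <= b).
Let b20 : 0 < b / 2. Proof. by rewrite divr_gt0. Qed.
Let bn0 n : 0 < bn n. Proof. exact: lt_le_trans (bn_ge n). Qed.

Lemma cvg_mean_integral :
  mu.-integrable D (EFin \o mean_integrand b) /\
  \int[mu]_(t in D) mean_integrand (bn n) t @[n --> \oo] -->
  \int[mu]_(t in D) mean_integrand b t.
Proof.
apply: (@cvg_Rintegral_dominated _ _ (1 - expR (- ((b / 2) ^+ 2 / 2)))^-1).
- by move=> n; exact: measurable_mean_integrand.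
- exact: measurable_mean_integrand.
- by move=> n t; exact: mean_integrand_le.
- by move=> t; apply: (cvg_mean_integrand (tf := fun=> t)) => //; exact: cvg_cst.
Qed.

Lemma cvg_variance_integral :
  mu.-integrable D (EFin \o variance_integrand b) /\
  \int[mu]_(t in D) variance_integrand (bn n) t @[n --> \oo] -->
  \int[mu]_(t in D) variance_integrand b t.
Proof.
apply: (@cvg_Rintegral_dominated _ _
  (((b / 2) ^+ 2 / 2)^-1 * (1 - expR (- ((b / 2) ^+ 2 / 2)))^-1)).
- by move=> n; exact: measurable_variance_integrand.
- exact: measurable_variance_integrand.
- by move=> n t; exact: variance_integrand_le.
- by move=> t; apply: (cvg_variance_integrand (tf := fun=> t)) => //; exact: cvg_cst.
Qed.

Lemma cvg_empty_integral :
  mu.-integrable D (EFin \o empty_integrand b) /\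
  \int[mu]_(t in D) empty_integrand (bn n) t @[n --> \oo] -->
  \int[mu]_(t in D) empty_integrand b t.
Proof.
apply: (@cvg_Rintegral_dominated _ _
  (b / Num.sqrt 2 / ((b / 2) ^+ 2 / 2) * (1 - expR (- ((b / 2) ^+ 2 / 2)))^-1)).
- by move=> n; exact: measurable_empty_integrand.
- exact: measurable_empty_integrand.
- by move=> n t; exact: empty_integrand_le.
- by move=> t; apply: (cvg_empty_integrand (tf := fun=> t)) => //; exact: cvg_cst.
Qed.

End Limits.

Let integral_gt0 (f : R -> R) c : 0 < c -> mu.-integrable D (EFin \o f) ->
  (forall t, 0 <= f t) -> (forall t, 1 <= t <= 2 -> c <= f t) ->
  0 < \int[mu]_(t in D) f t.
Proof.
move=> c0 fint f0 fc; rewrite /Rintegral -lte_fin fineK; last first.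
  by apply: integrable_fin_num => //; exact: measurable_itv.
have /measurable_int mf := fint.
have sD : `[1%R, 2%R]%classic `<=` D.
  by move=> x /=; rewrite !in_itv/= andbT => /andP[x1 _]; apply: le_trans x1.
apply: (@lt_le_trans _ _ (\int[mu]_(x in `[1%R, 2%R]) c%:E)%E).
  rewrite integral_cst//= lebesgue_measure_itv/= lte_fin ltr1n -EFinD -EFinM lte_fin.
  by rewrite mulr_gt0//; lra.
apply: (@le_trans _ _ (\int[mu]_(x in `[1%R, 2%R]) (f x)%:E)%E).
  have m12 : measurable_fun (`[1%R, 2%R]%classic : set R) (EFin \o f).
    by apply: measurable_funS mf => //; exact: measurable_itv.
  have c12 (t : R) : (`[1%R, 2%R]%classic : set R) t -> (c%:E <= (f t)%:E)%E.
    by rewrite /= in_itv/= lee_fin => /fc.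
  by apply: ge0_le_integral => // t _; rewrite lee_fin ?f0 ?(ltW c0).
by apply: ge0_subset_integral => // t _; rewrite lee_fin.
Qed.

Let ratio_ge (b t : R) : 0 < b -> 1 <= t <= 2 ->
  expR (- (b ^+ 2 / 2 + 4)) <=
  expR (- (b ^+ 2 / 2) - t ^+ 2) / (1 - expR (- (b ^+ 2 / 2) - t ^+ 2)).
Proof.
move=> b0 /andP[t1 t2]; rewrite ler_pdivlMr ?E_lt1//.
have h : expR (- (b ^+ 2 / 2 + 4)) <= expR (- (b ^+ 2 / 2) - t ^+ 2).
  by rewrite ler_expR -opprD lerN2; nra.
by apply: le_trans h; rewrite ler_piMr ?expR_ge0// gerBl expR_ge0.
Qed.

Lemma mean_integral_gt0 b : 0 < b -> 0 < \int[mu]_(t in D) mean_integrand b t.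
Proof.
move=> b0; have A40 : 0 < b ^+ 2 / 2 + 4 by rewrite addr_gt0// divr_gt0// exprn_gt0.
have hb : b / 2 <= b by lra.
have [ib _] := @cvg_mean_integral (fun=> b) b b0 (cvg_cst _) (fun=> hb).
apply: (@integral_gt0 _ ((b ^+ 2 / 2 + 4)^-1 * expR (- (b ^+ 2 / 2 + 4)))).
- by rewrite mulr_gt0 ?expR_gt0 ?invr_gt0.
- exact: ib.
- by move=> t; rewrite mulr_ge0 ?exp_ratio_ge0// divr_ge0 ?sqr_ge0// ltW// A_gt0.
- move=> t t12; apply: ler_pM; rewrite ?ratio_ge ?expR_ge0 ?invr_ge0 ?(ltW A40)//.
  have /andP[t1 t2] := t12.
  rewrite -[leLHS]mul1r; apply: ler_pM => //; first by rewrite invr_ge0 ltW.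
    by nra.
  by rewrite lef_pV2 ?posrE ?A_gt0// lerD2l; nra.
Qed.

Lemma variance_integral_gt0 b : 0 < b -> 0 < \int[mu]_(t in D) variance_integrand b t.
Proof.
move=> b0; have A40 : 0 < b ^+ 2 / 2 + 4 by rewrite addr_gt0// divr_gt0// exprn_gt0.
have hb : b / 2 <= b by lra.
have [ib _] := @cvg_variance_integral (fun=> b) b b0 (cvg_cst _) (fun=> hb).
apply: (@integral_gt0 _ ((b ^+ 2 / 2 + 4) ^- 2 * expR (- (b ^+ 2 / 2 + 4)))).
- by rewrite mulr_gt0 ?expR_gt0 ?invr_gt0 ?exprn_gt0.
- exact: ib.
- by move=> t; rewrite mulr_ge0 ?exp_ratio_ge0// divr_ge0 ?sqr_ge0.
- move=> t t12; apply: ler_pM; rewrite ?ratio_ge ?expR_ge0 ?invr_ge0 ?sqr_ge0//.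
  have /andP[t1 t2] := t12.
  rewrite -[leLHS]mul1r; apply: ler_pM => //; first by rewrite invr_ge0 sqr_ge0.
    by nra.
  rewrite lef_pV2 ?posrE ?exprn_gt0 ?A_gt0//.
  by rewrite lerXn2r ?nnegrE ?(ltW A40) ?(ltW (A_gt0 t b0))// lerD2l; nra.
Qed.

End ParameterIntegrals.

(** * Summing the Gaussian limits *)

Section SummedLimits.
Context {R : realType}.
Local Notation mu := (@lebesgue_measure R).
Local Notation D := (`[0, +oo[%classic : set R).
Implicit Types (t : R) (F : R -> R).

Let mD : measurable D. Proof. exact: measurable_itv. Qed.

Section Mixture.
Variables (c2 : R) (F : R -> R).
Hypotheses (c20 : 0 < c2) (mF : measurable_fun setT F) (F0 : forall t, 0 <= F t).
Let E t : R := expR (- (c2 + t ^+ 2)).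
Hypothesis iF : mu.-integrable D (EFin \o (fun t => F t * (E t / (1 - E t)))).

Let E01 t : 0 <= E t < 1.
Proof. by rewrite expR_ge0/= -[ltRHS]expR0 ltr_expR oppr_lt0 ltr_pwDl// sqr_ge0. Qed.

Let E10 t : 0 < 1 - E t. Proof. by rewrite subr_gt0; have /andP[] := E01 t. Qed.

Let mE : measurable_fun setT E.
Proof.
by do 2 apply: measurableT_comp => //; apply: measurable_funD => //; exact: measurable_funX.
Qed.

Let EkE (k : nat) t : expR (- (k.+1%:R * (c2 + t ^+ 2))) = E t ^+ k.+1.
Proof. by rewrite -expRM_natl -mulrN. Qed.

Lemma integrable_mixture_term (k : nat) :
  mu.-integrable D (EFin \o (fun t => F t * expR (- (k.+1%:R * (c2 + t ^+ 2))))).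
Proof.
apply: le_integrable iF => //.
  apply: measurable_funTS; apply/measurable_EFinP; apply: measurable_funM => //.
  under eq_fun do rewrite EkE.
  exact: measurable_funX.
move=> t _ /=; have /andP[e0 e1] := E01 t.
have i0 : 0 <= (1 - E t)^-1 by rewrite invr_ge0; exact: ltW.
rewrite lee_fin !ger0_norm ?mulr_ge0 ?expR_ge0//.
apply: ler_wpM2l => //; rewrite EkE ler_pdivlMr//.
apply: (@le_trans _ _ (E t ^+ k.+1)); first by rewrite ler_piMr ?exprn_ge0// gerBl.
by rewrite exprS ler_piMr// exprn_ile1// ltW.
Qed.

Lemma nneseries_Rintegral_geometric :
  (\sum_(k <oo) (\int[mu]_(t in D) (F t * expR (- (k.+1%:R * (c2 + t ^+ 2)))))%R%:E =
   (\int[mu]_(t in D) (F t * (E t / (1 - E t))))%R%:E)%E.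
Proof.
rewrite [in RHS]/Rintegral fineK; last exact: integrable_fin_num.
rewrite -nneseries_integral_geometric//; apply: eq_eseriesr => k _.
by rewrite /Rintegral fineK//; apply: integrable_fin_num => //; exact: integrable_mixture_term.
Qed.

Lemma integrable_mixture_log :
  mu.-integrable D (EFin \o (fun t => F t * - ln (1 - E t))).
Proof.
apply: le_integrable iF => //.
  apply: measurable_funTS; apply/measurable_EFinP; apply: measurable_funM => //.
  apply: measurableT_comp => //; apply: measurableT_comp; first exact: measurable_ln.
  exact: measurable_funB.
move=> t _; have /andP[h1 h2] := ln1B_le_ratio (E01 t).
have /andP[e0 _] := E01 t.
have i0 : 0 <= (1 - E t)^-1 by rewrite invr_ge0; exact: ltW.
by rewrite /= lee_fin !ger0_norm ?mulr_ge0//; exact: ler_wpM2l.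
Qed.

Lemma nneseries_Rintegral_log :
  (\sum_(k <oo) ((\int[mu]_(t in D) (F t * expR (- (k.+1%:R * (c2 + t ^+ 2)))))%R / k.+1%:R)%:E =
   (\int[mu]_(t in D) (F t * - ln (1 - E t)))%R%:E)%E.
Proof.
rewrite [in RHS]/Rintegral fineK; last first.
  by apply: integrable_fin_num => //; exact: integrable_mixture_log.
rewrite -nneseries_integral_log//; apply: eq_eseriesr => k _.
rewrite mulrC EFinM; congr (_ * _)%E.
by rewrite /Rintegral fineK//; apply: integrable_fin_num => //; exact: integrable_mixture_term.
Qed.

End Mixture.

Section Sums.
Variable beta : R.
Hypothesis beta0 : 0 < beta.
Let c2 := beta ^+ 2 / 2.
Let c20 : 0 < c2. Proof. by rewrite divr_gt0// exprn_gt0. Qed.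
Let A t : R := c2 + t ^+ 2.
Let A0 t : 0 < A t. Proof. by rewrite ltr_pwDl// sqr_ge0. Qed.
Let EE t : expR (- (beta ^+ 2 / 2) - t ^+ 2) = expR (- (c2 + t ^+ 2)).
Proof. by rewrite opprD. Qed.

Let mAV : measurable_fun setT (fun t => (A t)^-1).
Proof.
apply: continuous_measurable_fun => t; apply: cvgV; first exact: lt0r_neq0.
by apply: cvgD; [exact: cvg_cst|exact: exprn_continuous].
Qed.

Let hb : beta / 2 <= beta. Proof. by have := beta0; lra. Qed.

Let i_mean : mu.-integrable D (EFin \o (fun t => t ^+ 2 / A t *
  (expR (- (c2 + t ^+ 2)) / (1 - expR (- (c2 + t ^+ 2)))))).
Proof.
have [h _] := @cvg_mean_integral R (fun=> beta) beta beta0 (cvg_cst _) (fun=> hb).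
move: h; congr (integrable _ _ _); apply/funext => t.
by rewrite /= /mean_integrand EE.
Qed.

Let i_var : mu.-integrable D (EFin \o (fun t => t ^+ 2 / A t ^+ 2 *
  (expR (- (c2 + t ^+ 2)) / (1 - expR (- (c2 + t ^+ 2)))))).
Proof.
have [h _] := @cvg_variance_integral R (fun=> beta) beta beta0 (cvg_cst _) (fun=> hb).
move: h; congr (integrable _ _ _); apply/funext => t.
by rewrite /= /variance_integrand EE.
Qed.

Let m2 : measurable_fun setT (fun t : R => t ^+ 2 / A t).
Proof. by apply: measurable_funM => //; exact: measurable_funX. Qed.

Let m4 : measurable_fun setT (fun t : R => t ^+ 2 / A t ^+ 2).
Proof.
rewrite (_ : (fun t => _) = (fun t => t ^+ 2 * (A t)^-1 ^+ 2)); last first.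
  by apply/funext => t; rewrite exprVn.
by apply: measurable_funM; exact: measurable_funX.
Qed.

Lemma gaussian_mean_sum :
  (\sum_(k <oo) (Num.sqrt 2 / pi * \int[mu]_(t in D)
      (t ^+ 2 / (beta ^+ 2 / 2 + t ^+ 2) *
       expR (- (k.+1%:R * (beta ^+ 2 / 2 + t ^+ 2)))))%:E =
   (Num.sqrt 2 / pi * \int[mu]_(t in D) mean_integrand beta t)%:E)%E.
Proof.
have F0 t : 0 <= t ^+ 2 / A t by rewrite divr_ge0 ?sqr_ge0// ltW.
have pos : 0 <= Num.sqrt 2 / pi :> R by rewrite divr_ge0 ?sqrtr_ge0// pi_ge0.
have S := nneseries_Rintegral_geometric c20 m2 F0 i_mean.
under eq_eseriesr do rewrite EFinM.
rewrite nneseriesZl; last first.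
  move=> k _; rewrite lee_fin; apply: Rintegral_ge0 => t _.
  by rewrite mulr_ge0 ?expR_ge0// F0.
rewrite S -EFinM; congr (_ * _)%:E; apply: eq_Rintegral => t _.
by rewrite /mean_integrand EE.
Qed.

Lemma gaussian_variance_sum :
  (\sum_(k <oo) (Num.sqrt 2 * beta / pi * \int[mu]_(t in D)
      (t ^+ 2 / (beta ^+ 2 / 2 + t ^+ 2) ^+ 2 *
       expR (- (k.+1%:R * (beta ^+ 2 / 2 + t ^+ 2)))))%:E =
   (Num.sqrt 2 * beta / pi * \int[mu]_(t in D) variance_integrand beta t)%:E)%E.
Proof.
have F0 t : 0 <= t ^+ 2 / A t ^+ 2 by rewrite divr_ge0 ?sqr_ge0.
have pos : 0 <= Num.sqrt 2 * beta / pi :> R.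
  by rewrite divr_ge0 ?mulr_ge0 ?sqrtr_ge0 ?pi_ge0// ltW.
have S := nneseries_Rintegral_geometric c20 m4 F0 i_var.
under eq_eseriesr do rewrite EFinM.
rewrite nneseriesZl; last first.
  move=> k _; rewrite lee_fin; apply: Rintegral_ge0 => t _.
  by rewrite mulr_ge0 ?expR_ge0// F0.
rewrite S -EFinM; congr (_ * _)%:E; apply: eq_Rintegral => t _.
by rewrite /variance_integrand EE.
Qed.

Let i_gt0 : mu.-integrable D (EFin \o (fun t => (A t)^-1 *
  (expR (- (c2 + t ^+ 2)) / (1 - expR (- (c2 + t ^+ 2)))))).
Proof.
apply: (@integrable_gauss_le _ _ _ (c2^-1 * (1 - expR (- c2))^-1) 1) => //.
- apply: measurable_funTS; apply: measurable_funM => //; apply: measurable_funM.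
    by do 2 apply: measurableT_comp => //; apply: measurable_funD => //; exact: measurable_funX.
  apply: continuous_measurable_fun => t; apply: cvgV.
    by rewrite subr_eq0 gt_eqF// -[ltRHS]expR0 ltr_expR oppr_lt0; exact: A0.
  apply: cvgB; first exact: cvg_cst.
  apply: (@continuous_comp _ _ _ (fun u => - A u) expR); last exact: continuous_expR.
  by apply: cvgN; apply: cvgD; [exact: cvg_cst|exact: exprn_continuous].
- move=> t _; have := @exp_ratio_le R beta beta0 beta t (lexx _); rewrite EE => h.
  have e1 : 0 < 1 - expR (- (c2 + t ^+ 2)).
    by rewrite subr_gt0 -[ltRHS]expR0 ltr_expR oppr_lt0; exact: A0.
  have e2 : 0 <= expR (- (c2 + t ^+ 2)) / (1 - expR (- (c2 + t ^+ 2))).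
    by rewrite divr_ge0 ?expR_ge0// ltW.
  rewrite ger0_norm; last by rewrite mulr_ge0// invr_ge0 ltW.
  rewrite -mulrA; apply: ler_pM => //; first by rewrite invr_ge0 ltW.
  by rewrite lef_pV2 ?posrE// lerDl sqr_ge0.
Qed.

Lemma gaussian_gt0_sum :
  (\sum_(k <oo) (beta / (Num.sqrt 2 * pi) * \int[mu]_(t in D)
      (expR (- (k.+1%:R * (beta ^+ 2 / 2 + t ^+ 2))) / (beta ^+ 2 / 2 + t ^+ 2)) / k.+1%:R)%:E =
   (- (1 / pi * \int[mu]_(t in D) empty_integrand beta t))%:E)%E.
Proof.
have F0 t : 0 <= (A t)^-1 by rewrite invr_ge0 ltW.
have r20 : 0 < Num.sqrt 2 :> R by rewrite sqrtr_gt0.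
have pi0 : 0 < pi :> R := pi_gt0 R.
have pos : 0 <= beta / (Num.sqrt 2 * pi) by rewrite divr_ge0 ?mulr_ge0// ltW.
have S := nneseries_Rintegral_log c20 mAV F0 i_gt0.
transitivity (\sum_(k <oo) ((beta / (Num.sqrt 2 * pi))%:E *
   ((\int[mu]_(t in D) ((A t)^-1 * expR (- (k.+1%:R * (c2 + t ^+ 2)))))%R / k.+1%:R)%:E))%E.
  apply: eq_eseriesr => k _; rewrite -EFinM mulrA; congr (_ * _ / _)%:E.
  by apply: eq_Rintegral => t _; rewrite mulrC.
rewrite nneseriesZl; last first.
  move=> k _; rewrite lee_fin divr_ge0//; apply: Rintegral_ge0 => t _.
  by rewrite mulr_ge0 ?expR_ge0// F0.
rewrite S -EFinM; congr EFin.
transitivity (- (1 / pi * (- (beta / Num.sqrt 2) *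
    \int[mu]_(t in D) ((A t)^-1 * - ln (1 - expR (- (c2 + t ^+ 2))))))).
  move: (\int[mu]_(t in D) _) => I; move: (pi : R) (Num.sqrt 2) pi0 r20 => c r c0 r0.
  by field; rewrite !lt0r_neq0.
congr (- (_ * _)); rewrite -RintegralZl//; last exact: integrable_mixture_log F0 i_gt0.
by apply: eq_Rintegral => t _; rewrite /empty_integrand EE /A; ring.
Qed.

End Sums.
End SummedLimits.

(** * Heavy traffic *)

Section LeadingOrder.
Context {R : realType}.

Lemma leading_order_scaled (u : nat -> \bar R) (v g x y : nat -> R) (L : R) : L != 0 ->
  (forall n, u n = (g n * x n)%:E) -> (forall n, v n = g n * y n) ->
  x @ \oo --> L -> y @ \oo --> L -> leading_order u v.
Proof.
move=> L0 uE vE xL yL; exists (fun n => x n / y n - 1); split.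
  rewrite -[X in _ --> X](subrr (1 : R)); apply: cvgB; last exact: cvg_cst.
  by rewrite -[X in _ --> X](mulfV L0); apply: cvgM => //; exact: cvgV.
have yn0 : \forall n \near \oo, y n != 0.
  have : \forall n \near \oo, `|L - y n| < `|L|.
    by move/cvgrPdist_lt : yL; apply; rewrite normr_gt0.
  apply: filterS => n; apply: contraTN => /eqP ->.
  by rewrite subr0 ltxx.
near=> n; have y0 : y n != 0 by near: n.
by rewrite uE vE addrC subrK -mulrA [y n * _]mulrC divfK.
Unshelve. all: by end_near. Qed.

(** Hypotheses that hold eventually may be assumed to hold always. *)
Lemma leading_order_shift (N : nat) (u : nat -> \bar R) (v : nat -> R) :
  leading_order (fun n => u (n + N)%N) (fun n => v (n + N)%N) -> leading_order u v.
Proof.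
move=> [e [e0 [M _ eE]]]; exists (fun n => e (n - N)%N); split.
  rewrite -(cvg_shiftn N); apply: cvg_trans e0; apply: near_eq_cvg.
  by apply: nearW => n; rewrite /= addnK.
exists (M + N)%N => // n /= MNn.
have Nn : (N <= n)%N by apply: leq_trans MNn; exact: leq_addl.
by have := eE (n - N)%N; rewrite /= subnK//; apply; rewrite leq_subRL// addnC.
Qed.

End LeadingOrder.

Section HeavyTraffic.
Context {R : realType}.
Local Notation mu := (@lebesgue_measure R).
Local Notation D := (`[0, +oo[%classic : set R).
Variables (a b : nat -> R) (s : nat -> nat) (beta : R) (rho beta_ : nat -> R).
Hypotheses (a2 : forall n, 2 <= a n) (b1 : forall n, 1 <= b n)
  (abeta : forall n, beta ^+ 2 / 16 <= a n)
  (a_infty : a @ \oo --> +oo) (b_infty : b @ \oo --> +oo) (beta0 : 0 < beta).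
Let sg n := Num.sqrt (a n * b n * (b n + 1)).
Hypotheses (sE : forall n, (s n)%:R = a n * b n + beta * sg n)
  (rhoE : forall n, rho n = a n * b n / (s n)%:R)
  (beta_n_gt0 : forall n, 0 < beta_ n)
  (beta_nE : forall n, beta_ n ^+ 2 =
     (s n)%:R * ((1 - rho n) / (b n + 1)) ^+ 2 * (1 + b n / rho n)).

Let a1 n : 1 < a n. Proof. by apply: lt_le_trans (a2 n); rewrite ltr1n. Qed.
Let a0 n : 0 < a n. Proof. exact: lt_trans (a1 n). Qed.
Let b0 n : 0 < b n. Proof. exact: lt_le_trans (b1 n). Qed.
Let b10 n : 0 < b n + 1. Proof. exact: addr_gt0. Qed.
Let ab0 n : 0 < a n * b n. Proof. exact: mulr_gt0. Qed.
Let sg0 n : 0 < sg n. Proof. by rewrite sqrtr_gt0 mulr_gt0. Qed.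
Let sg2 n : sg n ^+ 2 = a n * b n * (b n + 1).
Proof. by rewrite sqr_sqrtr// mulr_ge0// ltW. Qed.
Let s0 n : 0 < (s n)%:R :> R. Proof. by rewrite sE addr_gt0// mulr_gt0. Qed.
Let rho0 n : 0 < rho n. Proof. by rewrite rhoE divr_gt0. Qed.
Let rho1 n : rho n <= 1.
Proof. by rewrite rhoE ler_pdivrMr// mul1r sE lerDl mulr_ge0// ltW. Qed.

Let t n := (b n + rho n) / (b n + 1).

Let t_ge n : 2^-1 <= t n.
Proof.
rewrite /t ler_pdivlMr//; have := b1 n; have := rho0 n; lra.
Qed.

Let t_le n : t n <= 1.
Proof. by rewrite /t ler_pdivrMr// mul1r lerD2l. Qed.

Let t0 n : 0 < t n. Proof. by apply: lt_le_trans (t_ge n); rewrite invr_gt0. Qed.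

Let cvg_t : t @ \oo --> (1 : R).
Proof.
apply/cvgrPdist_le => e e0; near=> n.
rewrite ger0_norm ?subr_ge0//.
have -> : 1 - t n = (1 - rho n) / (b n + 1) by rewrite /t; field; exact: lt0r_neq0.
rewrite ler_pdivrMr//.
have h : e^-1 <= b n by near: n; move/cvgryPge : b_infty; apply.
have : 1 <= e * (b n + 1).
  rewrite -(@ler_pM2l _ e^-1) ?invr_gt0// mulrA mulVf ?lt0r_neq0// mul1r mulr1; lra.
have := rho0 n; lra.
Unshelve. all: by end_near. Qed.

Let rho_inv n : (rho n)^-1 = 1 + beta * (sg n / (a n * b n)).
Proof.
rewrite rhoE sE; field; rewrite !lt0r_neq0//=.
by rewrite -sE; exact: s0.
Qed.

Let cvg_rho_inv : (rho n)^-1 @[n --> \oo] --> (1 : R).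
Proof.
rewrite (_ : (fun n => _) = (fun n => 1 + beta * (sg n / (a n * b n)))); last first.
  by apply/funext => n; rewrite rho_inv.
rewrite -[X in _ --> X](addr0 (1 : R)) -[X in _ --> _ + X](mulr0 beta).
apply: cvgD; first exact: cvg_cst.
apply: cvgM; first exact: cvg_cst.
apply/cvgrPdist_lt => e e0; near=> n.
rewrite sub0r normrN ger0_norm ?divr_ge0 ?(ltW (sg0 n)) ?(ltW (ab0 n))//.
rewrite -(@ltr_pXn2r _ 2) ?nnegrE ?(ltW e0)//; last first.
  by rewrite divr_ge0 ?(ltW (sg0 n)) ?(ltW (ab0 n)).
rewrite exprMn exprVn sg2.
have -> : a n * b n * (b n + 1) / (a n * b n) ^+ 2 = (b n + 1) / (a n * b n).
  by field; rewrite !lt0r_neq0.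
have h : 2 / e ^+ 2 < a n by near: n; move/cvgryPgt : a_infty; apply.
rewrite ltr_pdivrMr//.
have h2 : 2 < e ^+ 2 * a n by rewrite mulrC -ltr_pdivrMr// exprn_gt0.
apply: (@le_lt_trans _ _ (2 * b n)); first by have := b1 n; lra.
by rewrite mulrA ltr_pM2r.
Unshelve. all: by end_near. Qed.

Let one_sub_rho n : 1 - rho n = beta * sg n / (s n)%:R.
Proof.
have -> : beta * sg n = (s n)%:R - a n * b n by rewrite sE; ring.
by rewrite rhoE; field; exact: lt0r_neq0.
Qed.

(** This simplification of the definition of beta_n shows beta_n --> beta. *)
Let beta_n_sqr n : beta_ n ^+ 2 = beta ^+ 2 * t n.
Proof.
rewrite beta_nE one_sub_rho rhoE /t rhoE.
have sn := lt0r_neq0 (s0 n).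
transitivity (beta ^+ 2 * sg n ^+ 2 / ((s n)%:R * (b n + 1) ^+ 2) * (1 + (s n)%:R / a n)).
  by field; rewrite sn !lt0r_neq0.
by rewrite sg2; field; rewrite sn !lt0r_neq0.
Qed.

Let beta_n_sqrt n : beta_ n = beta * Num.sqrt (t n).
Proof.
apply: (@pexpIrn _ 2) => //; rewrite ?nnegrE ?mulr_ge0 ?sqrtr_ge0 ?ltW//.
by rewrite exprMn sqr_sqrtr ?beta_n_sqr// ltW.
Qed.

Let sqrt_t_bound n : 2^-1 <= Num.sqrt (t n) <= 1.
Proof.
have h : Num.sqrt (t n) ^+ 2 = t n by rewrite sqr_sqrtr// ltW.
have h0 : 0 <= Num.sqrt (t n) by exact: sqrtr_ge0.
have h1 := t_ge n; have h2 := t_le n.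
by apply/andP; split; nra.
Qed.

Let beta_n_ge n : beta / 2 <= beta_ n.
Proof. by rewrite beta_n_sqrt; apply: ler_wpM2l; [exact: ltW|have /andP[] := sqrt_t_bound n]. Qed.

Let beta_n_le n : beta_ n <= beta.
Proof. by rewrite beta_n_sqrt ler_piMr ?(ltW beta0)//; have /andP[] := sqrt_t_bound n. Qed.

Let cvg_beta_n : beta_ @ \oo --> beta.
Proof.
rewrite (_ : beta_ = (fun n => beta * Num.sqrt (t n))); last exact/funext.
suff : beta * Num.sqrt (t n) @[n --> \oo] --> beta * Num.sqrt 1 by rewrite sqrtr1 mulr1.
apply: cvgM; first exact: cvg_cst.
by apply: continuous_cvg => //; exact: sqrt_continuous.
Qed.

(** The prefactor of the mean is sigma / beta up to a factor that tends to 1. *)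
Let traffic_ratio n : (b n + rho n) / (1 - rho n) = sg n * (t n / rho n / beta).
Proof.
rewrite one_sub_rho /t.
have sn := lt0r_neq0 (s0 n).
have -> : (rho n)^-1 = (s n)%:R / (a n * b n) by rewrite rhoE invf_div.
transitivity ((b n + rho n) * (s n)%:R * sg n / (beta * sg n ^+ 2)).
  by field; rewrite sn !lt0r_neq0.
by rewrite sg2; field; rewrite !lt0r_neq0.
Qed.

Let G n := scaled_walk_mean (a n) (b n) (s n).
Let q := expR (- (beta ^+ 2 / 32)).

Let cvg_scaled f C k (r : R) : quadratic_test f C ->
  (((Num.sqrt 2 * Num.sqrt pi)^-1)%:E *
   \int[mu]_y (f (Num.sqrt k.+1%:R * y - k.+1%:R * beta) * expR (- (y ^+ 2 / 2)))%:E =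
   r%:E)%E ->
  G n k.+1 f @[n --> \oo] --> r.
Proof.
move=> ftest rE.
have := cvg_walk_mean (k := k) a2 b1 a_infty b_infty sE ftest.
by rewrite rE => /fine_cvg.
Qed.

Let cvg_scaled_sum (f : R -> R) (l : nat -> R) (C L : R) :
  (forall n k, 0 <= G n k.+1 f <= C * q ^+ k.+1) ->
  (forall k, G n k.+1 f @[n --> \oo] --> l k) ->
  (\sum_(k <oo) (l k / k.+1%:R)%:E = L%:E)%E ->
  fine (\sum_(k <oo) (G n k.+1 f / k.+1%:R)%:E)%E @[n --> \oo] --> L.
Proof.
move=> GC Gl lL; apply: fine_cvg; rewrite -lL.
have q01 : 0 <= q < 1.
  by rewrite expR_ge0/= -[ltRHS]expR0 ltr_expR oppr_lt0 divr_gt0// exprn_gt0.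
have Cq k : 0 <= C * q ^+ k.+1.
  by have /andP[h1 h2] := GC 0%N k; exact: le_trans h2.
have C0 : 0 <= C.
  by have := Cq 0%N; rewrite pmulr_lge0// exprn_gt0// expR_gt0.
apply: (@cvg_nneseries_dominated _ _ _ (fun k => C * q ^+ k.+1)).
- move=> n k; have /andP[h1 h2] := GC n k; rewrite divr_ge0//=.
  by apply: le_trans h2; rewrite ler_piMr// invf_le1// ler1n.
- under eq_eseriesr do rewrite EFinM.
  rewrite nneseriesZl; last by move=> k _; rewrite lee_fin exprn_ge0// expR_ge0.
  by rewrite geometric_nneseriesS// -EFinM ltry.
- by move=> k; apply: cvgM; [exact: Gl|exact: cvg_cst].
Qed.

Let k0 (k : nat) : 0 < k.+1%:R :> R. Proof. by rewrite ltr0n. Qed.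

Let cvg_mean_sum :
  fine (\sum_(k <oo) (G n k.+1 (fun u => Num.max u 0) / k.+1%:R)%:E)%E @[n --> \oo] -->
  Num.sqrt 2 / pi * \int[mu]_(t in D) mean_integrand beta t.
Proof.
apply: (cvg_scaled_sum (C := (beta / 16)^-1)).
- by move=> n k; exact: scaled_pos_bound.
- by move=> k; exact: (cvg_scaled (quadratic_test_pos) (gaussian_pos beta0 (k0 k))).
- rewrite -gaussian_mean_sum//; apply: eq_eseriesr => k _.
  by rewrite mulrAC divff ?mul1r.
Qed.

Let cvg_variance_sum :
  fine (\sum_(k <oo) (G n k.+1 (fun u => Num.max u 0 ^+ 2) / k.+1%:R)%:E)%E @[n --> \oo] -->
  Num.sqrt 2 * beta / pi * \int[mu]_(t in D) variance_integrand beta t.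
Proof.
apply: (cvg_scaled_sum (C := 2 * (beta / 16)^-1 ^+ 2)).
- by move=> n k; exact: scaled_possq_bound.
- by move=> k; exact: (cvg_scaled (quadratic_test_possq) (gaussian_possq beta0 (k0 k))).
- rewrite -gaussian_variance_sum//; apply: eq_eseriesr => k _.
  by rewrite mulrAC divff ?mul1r.
Qed.

Let cvg_gt0_sum :
  fine (\sum_(k <oo) (G n k.+1 (fun u => (0 < u)%R%:R) / k.+1%:R)%:E)%E @[n --> \oo] -->
  - (1 / pi * \int[mu]_(t in D) empty_integrand beta t).
Proof.
apply: (cvg_scaled_sum (C := 1)).
- by move=> n k; rewrite mul1r; exact: scaled_gt0_bound.
- by move=> k; exact: (cvg_scaled (quadratic_test_gt0) (gaussian_gt0 beta0 (k0 k))).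
- by rewrite -gaussian_gt0_sum.
Qed.

Let cvg_tr : t n / rho n @[n --> \oo] --> (1 : R).
Proof.
have := cvgM cvg_t cvg_rho_inv; rewrite mulr1; exact.
Qed.

Lemma leading_order_mean (u : nat -> \bar R) :
  (forall n, u n =
    (sg n * fine (\sum_(k <oo) (G n k.+1 (fun u => Num.max u 0) / k.+1%:R)%:E)%E)%:E) ->
  leading_order u (fun n => Num.sqrt 2 * beta_ n / pi * ((b n + rho n) / (1 - rho n)) *
    \int[mu]_(t in D) mean_integrand (beta_ n) t).
Proof.
move=> uE; have [_ Il] := cvg_mean_integral beta0 cvg_beta_n beta_n_ge.
have r20 : 0 < Num.sqrt 2 :> R by rewrite sqrtr_gt0.
apply: (@leading_order_scaled _ _ _ sg _
  (fun n => Num.sqrt 2 * beta_ n / pi * (t n / rho n / beta) *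
    \int[mu]_(t in D) mean_integrand (beta_ n) t) _ _ uE _ cvg_mean_sum).
- by rewrite !mulf_neq0 ?invr_eq0 ?lt0r_neq0 ?pi_gt0 ?mean_integral_gt0.
- by move=> n; rewrite traffic_ratio; ring.
- have -> : Num.sqrt 2 / pi = Num.sqrt 2 * beta / pi * (1 / beta) :> R.
    by move: (pi : R) (pi_gt0 R) => c c0; field; rewrite !lt0r_neq0.
  apply: cvgM => //; apply: cvgM.
    by apply: cvgM; [apply: cvgM => //; exact: cvg_cst|exact: cvg_cst].
  by apply: cvgM => //; exact: cvg_cst.
Qed.

Lemma leading_order_variance (u : nat -> \bar R) :
  (forall n, u n = (sg n ^+ 2 *
    fine (\sum_(k <oo) (G n k.+1 (fun u => Num.max u 0 ^+ 2) / k.+1%:R)%:E)%E)%:E) ->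
  leading_order u (fun n => beta_ n ^+ 3 / Num.sqrt 2 / pi *
    ((b n + rho n) / (1 - rho n)) ^+ 2 * ((b n + 1) / (b n + rho n) + 1) *
    \int[mu]_(t in D) variance_integrand (beta_ n) t).
Proof.
move=> uE; have [_ Il] := cvg_variance_integral beta0 cvg_beta_n beta_n_ge.
have r20 : 0 < Num.sqrt 2 :> R by rewrite sqrtr_gt0.
have r22 : Num.sqrt 2 ^+ 2 = 2 :> R by rewrite sqr_sqrtr.
apply: (@leading_order_scaled _ _ _ (fun n => sg n ^+ 2) _
  (fun n => beta_ n ^+ 3 / Num.sqrt 2 / pi * (t n / rho n / beta) ^+ 2 * ((t n)^-1 + 1) *
    \int[mu]_(t in D) variance_integrand (beta_ n) t) _ _ uE _ cvg_variance_sum).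
- by rewrite !mulf_neq0 ?invr_eq0 ?lt0r_neq0 ?pi_gt0 ?variance_integral_gt0.
- by move=> n; rewrite traffic_ratio /t invf_div; ring.
- have -> : Num.sqrt 2 * beta / pi =
      beta ^+ 3 / Num.sqrt 2 / pi * (1 / beta) ^+ 2 * (1^-1 + 1) :> R.
    have E : (Num.sqrt 2)^-1 = Num.sqrt 2 / 2 :> R.
      by rewrite -[in X in _ / X]r22; field; exact: lt0r_neq0.
    by rewrite E; move: (pi : R) (pi_gt0 R) => c c0; field; rewrite !lt0r_neq0.
  apply: cvgM => //; apply: cvgM; last first.
    by apply: cvgD; [exact: (cvgV (oner_neq0 _) cvg_t)|exact: cvg_cst].
  apply: cvgM.
    apply: cvgM; last exact: cvg_cst.
    apply: cvgM; last exact: cvg_cst.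
    by apply: (@cvg_comp _ _ _ beta_ (fun x => x ^+ 3)); [exact: cvg_beta_n|exact: exprn_continuous].
  apply: (@cvg_comp _ _ _ (fun n => t n / rho n / beta) (fun x => x ^+ 2));
    last exact: exprn_continuous.
  by apply: cvgM => //; exact: cvg_cst.
Qed.

Lemma leading_order_empty (u : nat -> \bar R) :
  (forall n, u n = (expR (-
    fine (\sum_(k <oo) (G n k.+1 (fun u => (0 < u)%R%:R) / k.+1%:R)%:E)%E))%:E) ->
  leading_order u (fun n => expR (1 / pi * ((b n + rho n) / (b n + 1)) *
    \int[mu]_(t in D) empty_integrand (beta_ n) t)).
Proof.
move=> uE; have [_ Il] := cvg_empty_integral beta0 cvg_beta_n beta_n_ge beta_n_le.
apply: (@leading_order_scaled _ _ _ (fun=> 1)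
  (fun n => expR (- fine (\sum_(k <oo) (G n k.+1 (fun u => (0 < u)%R%:R) / k.+1%:R)%:E)%E))
  (fun n => expR (1 / pi * t n * \int[mu]_(t in D) empty_integrand (beta_ n) t))
  (expR (1 / pi * 1 * \int[mu]_(t in D) empty_integrand beta t))).
- exact: lt0r_neq0 (expR_gt0 _).
- by move=> n; rewrite mul1r.
- by move=> n; rewrite [RHS]mul1r.
- apply: continuous_cvg; first exact: continuous_expR.
  by rewrite mulr1 -[X in _ --> X]opprK; apply: cvgN; exact: cvg_gt0_sum.
- apply: continuous_cvg; first exact: continuous_expR.
  by apply: cvgM => //; apply: cvgM => //; exact: cvg_cst.
Qed.

End HeavyTraffic.

(** * The asymptotics of the stationary queue *)

Theorem theorem2 (R : realType) (a b : nat -> R) (s : nat -> nat) (beta : R)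
    (rho beta_ : nat -> R)
    (d d' : nat -> measure_display)
    (T : forall n, measurableType (d n)) (T' : forall n, measurableType (d' n))
    (P : forall n, probability (T n) R) (P' : forall n, probability (T' n) R)
    (A : forall n, nat -> {RV (P n) >-> nat})
    (Q : forall n, {RV (P' n) >-> R})
    (a_gt0 : forall n, 0 < a n) (b_gt0 : forall n, 0 < b n)
    (a_infty : a @ \oo --> +oo) (b_infty : b @ \oo --> +oo)
    (beta_gt0 : 0 < beta)
    (sE : forall n, (s n)%:R =
       a n * b n + beta * Num.sqrt (a n * b n * (b n + 1)))
    (rhoE : forall n, rho n = a n * b n / (s n)%:R)
    (beta_n_gt0 : forall n, 0 < beta_ n)
    (beta_nE : forall n, beta_ n ^+ 2 =
       (s n)%:R * ((1 - rho n) / (b n + 1)) ^+ 2 * (1 + b n / rho n))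
    (A_law : forall n i, has_gamma_poisson_law (a n) (b n) (A n i))
    (A_indep : forall n, mutually_independent (A n))
    (Q_stat : forall n, is_stationary_queue_length (A n) (s n) (Q n)) :
  [/\ leading_order (fun n => 'E_(P' n)[Q n])%E
        (fun n =>
           Num.sqrt 2 * beta_ n / pi * ((b n + rho n) / (1 - rho n)) *
           \int[lebesgue_measure]_(t in `[0%R, +oo[)
             (t ^+ 2 / (beta_ n ^+ 2 / 2 + t ^+ 2) *
              (expR (- (beta_ n ^+ 2 / 2) - t ^+ 2) /
               (1 - expR (- (beta_ n ^+ 2 / 2) - t ^+ 2))))),
      leading_order (fun n => P' n [set w | Q n w = 0])
        (fun n =>
           expR (1 / pi * ((b n + rho n) / (b n + 1)) *
             \int[lebesgue_measure]_(t in `[0%R, +oo[)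
               (beta_ n / Num.sqrt 2 / (beta_ n ^+ 2 / 2 + t ^+ 2) *
                ln (1 - expR (- (beta_ n ^+ 2 / 2) - t ^+ 2)))))
    & leading_order (fun n => 'V_(P' n)[Q n])%E
        (fun n =>
           beta_ n ^+ 3 / Num.sqrt 2 / pi *
           ((b n + rho n) / (1 - rho n)) ^+ 2 *
           ((b n + 1) / (b n + rho n) + 1) *
           \int[lebesgue_measure]_(t in `[0%R, +oo[)
             (t ^+ 2 / (beta_ n ^+ 2 / 2 + t ^+ 2) ^+ 2 *
              (expR (- (beta_ n ^+ 2 / 2) - t ^+ 2) /
               (1 - expR (- (beta_ n ^+ 2 / 2) - t ^+ 2)))))].
Proof.
have near_all : \forall n \near \oo, [/\ 2 <= a n, beta ^+ 2 / 16 <= a n & 1 <= b n].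
  near=> n; split; near: n.
  - by move/cvgryPge : a_infty; apply.
  - by move/cvgryPge : a_infty; apply.
  - by move/cvgryPge : b_infty; apply.
have [N _ Nab] := near_all.
have ge n : [/\ 2 <= a (n + N)%N, beta ^+ 2 / 16 <= a (n + N)%N & 1 <= b (n + N)%N].
  by apply: Nab; exact: leq_addl.
have a2 n : 2 <= a (n + N)%N by have [] := ge n.
have a1 n : 1 < a (n + N)%N by apply: lt_le_trans (a2 n); rewrite ltr1n.
have abeta n : beta ^+ 2 / 16 <= a (n + N)%N by have [] := ge n.
have b1 n : 1 <= b (n + N)%N by have [] := ge n.
have aN : (fun n => a (n + N)%N) @ \oo --> +oo by rewrite cvg_shiftn.
have bN : (fun n => b (n + N)%N) @ \oo --> +oo by rewrite cvg_shiftn.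
split; apply: (@leading_order_shift _ N).
- apply: (leading_order_mean a2 b1 abeta aN bN beta_gt0 (fun n => sE (n + N)%N)
    (fun n => rhoE (n + N)%N) (fun n => beta_n_gt0 (n + N)%N)
    (fun n => beta_nE (n + N)%N)) => n.
  exact: (queue_mean (a1 n) (b1 n) beta_gt0 (abeta n) (sE _) (A_law _) (A_indep _) (Q_stat _)).
- apply: (leading_order_empty a2 b1 abeta aN bN beta_gt0 (fun n => sE (n + N)%N)
    (fun n => rhoE (n + N)%N) (fun n => beta_n_gt0 (n + N)%N)
    (fun n => beta_nE (n + N)%N)) => n.
  exact: (queue_empty (a1 n) (b1 n) beta_gt0 (abeta n) (sE _) (A_law _) (A_indep _) (Q_stat _)).
- apply: (leading_order_variance a2 b1 abeta aN bN beta_gt0 (fun n => sE (n + N)%N)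
    (fun n => rhoE (n + N)%N) (fun n => beta_n_gt0 (n + N)%N)
    (fun n => beta_nE (n + N)%N)) => n.
  exact: (queue_variance (a1 n) (b1 n) beta_gt0 (abeta n) (sE _) (A_law _) (A_indep _) (Q_stat _)).
Unshelve. all: by end_near. Qed.
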